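(* Let $C$ be a finite simplicial complex, and let $\pi\in\mathbb{R}^3$ be a nonzero vector such that $C$ admits a $\pi$-tight linear embedding in $\mathbb{R}^3$ with respect to which $\pi$ is in general position (no two vertices of the embedded complex have the same value of the linear functional $\langle\pi,-\rangle$). Then $C$ admits a perfect discrete Morse function. If in addition $C$ has trivial (reduced) homology, then $C$ is also non-evasive.
   Context: Homology is taken with $\mathbb{Z}_2$-coefficients, and $\beta_i$ denotes the $i$-th non-reduced Betti number. Let $|C|\subset\mathbb{R}^k$ be a linear embedding (geometric realization) of a simplicial complex $C$, and let $\pi\in\mathbb{R}^k$ be a nonzero vector. For an affine hyperplane $h$ orthogonal to $\pi$, let $h^+$ be the open halfspace delimited by $h$ in direction $\pi$. $|C|$ is $\pi$-tight if for every affine hyperplane $h$ orthogonal to $\pi$ and every $i$ the homomorphism $H_i(h^+\cap|C|)\to H_i(|C|)$ induced by inclusion is injective. A discrete Morse function on $C$ is a weakly increasing map $f$ from the poset of nonempty faces of $C$ (ordered by inclusion) to $\mathbb{Z}$ that is at most $2$-to-$1$. A face $\sigma$ is critical under $f$ if $f$ is strictly increasing at $\sigma$, i.e. there is no face $\tau\neq\sigma$ comparable to $\sigma$ with $f(\tau)=f(\sigma)$. The function is perfect if for each $i$ it has exactly $\beta_i(C)$ critical $i$-dimensional faces. Non-evasiveness is defined recursively: a $0$-dimensional simplicial complex is non-evasive if and only if it is a single point; a $d$-dimensional simplicial complex ($d>0$) is non-evasive if and only if it has some vertex $v$ such that the link of $v$ and the deletion of $v$ (the subcomplex of all faces not containing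 $v$) are both non-evasive. *)

(* Defs.v *)
From HB Require Import structures.
From mathcomp Require Import all_boot all_order all_algebra.
From mathcomp Require Import all_classical all_reals all_analysis.
From mathcomp.multinomials Require Import freeg.

Set Implicit Arguments.
Unset Strict Implicit.
Unset Printing Implicit Defensive.
Import Order.TTheory GRing.Theory Num.Theory.
Import numFieldNormedType.Exports.
Local Open Scope ring_scope.

(** * Finite simplicial complexes *)

(* Faces are subsets of a finite ambient type V; the empty face is a face.
   An element of V need not be a vertex of C. *)
Definition simplicial_complex (V : finType) (C : {set {set V}}) : Prop :=
  finset.set0 \in C /\
  (forall s t : {set V}, s \in C -> t \subset s -> t \in C).

Definition vertices (V : finType) (C : {set {set V}}) : {set V} :=
  [set v | finset.set1 v \in C]%SET.

Definition nonempty_faces (V : finType) (C : {set {set V}}) : {set {set V}} :=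
  (C :\ finset.set0)%SET.

Definition link (V : finType) (C : {set {set V}}) (v : V) : {set {set V}} :=
  [set t : {set V} | (v \notin t) && ((v |: t)%SET \in C)]%SET.

Definition deletion (V : finType) (C : {set {set V}}) (v : V) : {set {set V}} :=
  [set t in C | v \notin t]%SET.

(* dim C + 1, i.e. the maximal number of vertices of a face. *)
Definition dimS (V : finType) (C : {set {set V}}) : nat :=
  (\max_(s in C) #|s|)%N.

Inductive non_evasive (V : finType) : {set {set V}} -> Prop :=
| NonEvasive_point (C : {set {set V}}) :
    dimS C = 1%N -> #|vertices C| = 1%N -> non_evasive C
| NonEvasive_step (C : {set {set V}}) (v : V) :
    (1 < dimS C)%N -> v \in vertices C ->
    non_evasive (link C v) -> non_evasive (deletion C v) -> non_evasive C.

(** * Simplicial homology over 'F_2 *)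

Definition faces_of_card (V : finType) (D : {set {set V}}) (j : nat) :
  {set {set V}} := [set s in D | #|s| == j]%SET.

(* Acts on row vectors: row s is the boundary of the face s.  For j = 0 the
   only possible entry is (set0 \proper set0) = 0. *)
Definition boundary_mx (V : finType) (D : {set {set V}}) (j : nat) :
  'M['F_2]_(#|faces_of_card D j|, #|faces_of_card D j.-1|) :=
  \matrix_(a, b) ((enum_val b : {set V}) \proper (enum_val a : {set V}))%:R.

(* dim ker - dim im at the faces of cardinality j, i.e. of dimension j - 1. *)
Definition homology_dim (V : finType) (D : {set {set V}}) (j : nat) : nat :=
  (\rank (kermx (boundary_mx D j)) - \rank (boundary_mx D j.+1))%N.

(* Non-reduced: the empty face is removed from the chain complex. *)
Definition betti (V : finType) (C : {set {set V}}) (i : nat) : nat :=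
  homology_dim (nonempty_faces C) i.+1.

(* Here the empty face is kept, so this is reduced homology.  Since j = 0
   (degree -1) is included, the complex whose only face is empty does not have
   trivial reduced homology. *)
Definition trivial_reduced_homology (V : finType) (C : {set {set V}}) : Prop :=
  forall j : nat, homology_dim C j = 0%N.

(** * Discrete Morse functions *)

Definition discrete_morse (V : finType) (C : {set {set V}})
    (f : {set V} -> int) : Prop :=
  {in nonempty_faces C &, forall s t : {set V}, s \subset t -> f s <= f t} /\
  (forall k : int, #|[set s in nonempty_faces C | f s == k]%SET| <= 2)%N.

Definition critical (V : finType) (C : {set {set V}})
    (f : {set V} -> int) (s : {set V}) : bool :=
  (s \in nonempty_faces C) &&
  [forall t in nonempty_faces C,
     (t != s) && ((t \subset s) || (s \subset t)) ==> (f t != f s)].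

Definition perfect (V : finType) (C : {set {set V}})
    (f : {set V} -> int) : Prop :=
  forall i : nat,
    #|[set s : {set V} | critical C f s && (#|s| == i.+1)]%SET| = betti C i.

(** * Singular homology over 'F_2 *)

Definition std_simplex (R : realType) (n : nat) : set 'rV[R]_n.+1 :=
  [set t : 'rV[R]_n.+1 |
     (forall i, 0 <= t 0 i) /\ \sum_i t 0 i = 1]%classic.
Arguments std_simplex : clear implicits.

Definition singular_simplex (R : realType) (n : nat) (X : topologicalType) :=
  continuousType (std_simplex R n) X.

Definition chain (R : realType) (n : nat) (X : topologicalType) :=
  {freeg (singular_simplex R n X) / 'F_2}.

(* Inserts a zero coordinate at position i. *)
Definition face_row (R : realType) (n : nat) (i : 'I_n.+2) (t : 'rV[R]_n.+1) :
  'rV[R]_n.+2 := \row_j (if unlift i j is Some k then t 0 k else 0).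

Lemma face_row_std (R : realType) (n : nat) (i : 'I_n.+2) (t : 'rV[R]_n.+1) :
  std_simplex R n t -> std_simplex R n.+1 (face_row i t).
Proof.
move=> [t0 t1]; split=> [j|].
  by rewrite mxE; case: unlift => [k|//]; exact: t0.
rewrite (bigD1_ord i) //= mxE unlift_none add0r -[RHS]t1.
by apply: eq_bigr => k _; rewrite mxE liftK.
Qed.

Definition face_map (R : realType) (n : nat) (i : 'I_n.+2)
    (t : std_simplex R n) : std_simplex R n.+1 :=
  SigSub (mem_set (face_row_std i (set_valP t))).

Lemma face_row_continuous (R : realType) (n : nat) (i : 'I_n.+2) :
  continuous (@face_row R n i).
Proof.
have coord j : continuous (fun s : 'rV[R]_n.+1 => face_row i s 0 j).
  case E: (unlift i j) => [k|].
    rewrite (_ : (fun s => _) = (fun s : 'rV[R]_n.+1 => s 0 k)).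
      exact: coord_continuous.
    by apply/funext => s; rewrite mxE E.
  rewrite (_ : (fun s => _) = (fun s : 'rV[R]_n.+1 => 0)).
    exact: cst_continuous.
  by apply/funext => s; rewrite mxE E.
move=> t A [P nP PA].
have FF : Filter (nbhs t) by exact: (@nbhs_filter 'rV[R]_n.+1 t).
pose Q j (s : 'rV[R]_n.+1) := P 0 j (face_row i s 0 j).
have QF : \forall s \near t, forall j, Q j s.
  by apply: (@filter_forall _ _ Q _ FF) => j; exact: (coord j t _ (nP 0 j)).
apply: (@filterS _ _ FF _ _ _ QF) => s Qs.
by apply: PA => a j; rewrite ord1; exact: Qs.
Qed.

Lemma face_map_continuous (R : realType) (n : nat) (i : 'I_n.+2) :
  continuous (@face_map R n i).
Proof.
apply: continuous_comp_initial => t.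
apply: (@continuous_comp _ _ _ set_val (@face_row R n i)).
  exact: initial_continuous.
exact: face_row_continuous.
Qed.

HB.instance Definition _ (R : realType) (n : nat) (i : 'I_n.+2) :=
  isContinuous.Build _ _ (@face_map R n i) (@face_map_continuous R n i).

Definition singular_boundary (R : realType) (n : nat) (X : topologicalType) :
  chain R n.+1 X -> chain R n X :=
  fglift (fun s : singular_simplex R n.+1 X =>
    \sum_(i < n.+2) << (s \o @face_map R n i : singular_simplex R n X) >>).

Definition singular_cycle (R : realType) (X : topologicalType) (n : nat) :
  chain R n X -> Prop :=
  match n with
  | 0 => fun=> True
  | _.+1 => fun z => singular_boundary z = 0
  end.

Definition homologous (R : realType) (X : topologicalType) (n : nat)
    (z1 z2 : chain R n X) : Prop :=
  exists w : chain R n.+1 X, singular_boundary w = z1 - z2.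

Definition pushforward (R : realType) (X Y : topologicalType) (n : nat)
    (f : continuousType X Y) : chain R n X -> chain R n Y :=
  fglift (fun s : singular_simplex R n X =>
    << (f \o s : singular_simplex R n Y) >>).

(* Injectivity of f_* : H_n(X) -> H_n(Y), homology classes being classes of
   cycles modulo [homologous]. *)
Definition injective_on_homology (R : realType) (X Y : topologicalType)
    (n : nat) (f : continuousType X Y) : Prop :=
  forall z1 z2 : chain R n X, singular_cycle z1 -> singular_cycle z2 ->
    homologous (pushforward f z1) (pushforward f z2) -> homologous z1 z2.

Definition sub_incl (T : topologicalType) (A B : set T)
    (AB : (A `<=` B)%classic) (x : A) : B := SigSub (mem_set (AB _ (set_valP x))).

Lemma sub_incl_continuous (T : topologicalType) (A B : set T)
  (AB : (A `<=` B)%classic) : continuous (sub_incl AB).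
Proof.
by apply: continuous_comp_initial => x; exact: initial_continuous.
Qed.

HB.instance Definition _ (T : topologicalType) (A B : set T)
    (AB : (A `<=` B)%classic) :=
  isContinuous.Build _ _ (sub_incl AB) (@sub_incl_continuous T A B AB).

(** * Linear embeddings and tightness *)

(* The realization of C in barycentric coordinates. *)
Definition barycentric (R : realType) (V : finType) (C : {set {set V}}) :
  set {ffun V -> R} :=
  [set a : {ffun V -> R} | [/\ forall v, 0 <= a v, \sum_v a v = 1
     & [set v | a v != 0]%SET \in C]]%classic.
Arguments barycentric R {V} C.

Definition simplexwise_linear (R : realType) (V : finType) (k : nat)
    (p : V -> 'rV[R]_k) (a : {ffun V -> R}) : 'rV[R]_k := \sum_v a v *: p v.

(* By compactness an injective map from the realization is a homeomorphism
   onto its image. *)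
Definition linear_embedding (R : realType) (V : finType) (k : nat)
    (C : {set {set V}}) (p : V -> 'rV[R]_k) : Prop :=
  {in barycentric R C &, injective (simplexwise_linear p)}.

Definition polyhedron (R : realType) (V : finType) (k : nat)
    (C : {set {set V}}) (p : V -> 'rV[R]_k) : set 'rV[R]_k :=
  (simplexwise_linear p @` barycentric R C)%classic.

Definition dot (R : realType) (k : nat) (x y : 'rV[R]_k) : R :=
  \sum_i x 0 i * y 0 i.

Definition open_halfspace (R : realType) (k : nat) (pi : 'rV[R]_k) (c : R) :
  set 'rV[R]_k := [set x | c < dot pi x]%classic.

(* The hyperplanes orthogonal to pi are the level sets of dot pi. *)
Definition tight (R : realType) (k : nat) (pi : 'rV[R]_k) (X : set 'rV[R]_k) :
  Prop :=
  forall (c : R) (i : nat),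
    injective_on_homology R i
      (sub_incl (@subIsetr _ (open_halfspace pi c) X)).

Definition general_position (R : realType) (V : finType) (k : nat)
    (pi : 'rV[R]_k) (C : {set {set V}}) (p : V -> 'rV[R]_k) : Prop :=
  {in vertices C &, injective (fun v => dot pi (p v))}.

(* Main.v *)
From HB Require Import structures.
Require Import Defs.
From mathcomp Require Import all_boot all_order all_algebra.
From mathcomp Require Import all_classical all_reals all_analysis.
From mathcomp.multinomials Require Import freeg.
From mathcomp Require Import ring lra.

(* Let h be the height <pi, -> and add the vertices of C one at a time from the
   top down. Adding v cones off its upper link L, the link of v in the part of
   C on the vertices of height at least h(v). Radial projection from v
   embeds L linearly in a plane. Every planar complex is built from a point by
   attaching matched pairs of faces and critical vertices and edges, each
   critical face sigma closing up a cycle z = sigma + ... of L: triangles are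
   removed through free edges, and the remaining graph is grown greedily.
   Coning these steps builds the star of v, and a critical face v * sigma again
   creates homology: z is the boundary of v * z in C, so by tightness z = bd y
   with y above v, and v * z + y is a cycle through v * sigma. A Morse function all of whose
   critical faces create homology is perfect.

   If C is acyclic then so are the part of C above v and the upper link L, hence
   by induction it is enough that acyclic planar complexes are non-evasive. The
   two extreme vertices of such a complex for a generic height have linear
   links. If such a link is not acyclic then the vertex is a cut vertex, and one
   recurses into a block; this produces a vertex with acyclic linear link.

   Planar complexes carry no 2-cycles, so tightness is used for cycles z of
   degree 0 and 1 only. If z is the boundary of a singular chain w above the level
   a, subdivide the simplices of w finely and send each point x to a vertex of
   height > a of the carrier of x. Vertices assigned to nearby points span a face, so
   the boundary of w goes to a simplicial boundary, and it goes to z. *)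

Set Implicit Arguments.
Unset Strict Implicit.
Unset Printing Implicit Defensive.
Import Order.TTheory GRing.Theory Num.Theory.
Import numFieldNormedType.Exports.
Import boot.fintype boot.finset.
Local Open Scope ring_scope.

(** * Chains over the two-element field *)

(** Simplicial and singular homology are never identified. It suffices that [realize] is a chain map
    into singular chains and that, in degrees 0 and 1, it has a one-sided inverse taking singular
    boundaries to simplicial ones; the singular filling itself may be arbitrary. Stopping at degree
    1 keeps subdivision elementary: only segments and triangles are cut up.

    Planarity enters only combinatorially, through [layered], without any separation theorem for the
    plane: the descent to upper links yields the absence of top cycles, the free faces, and the
    linear links of extreme vertices.

    Chains carry the empty face, so a cardinality j stands for degree j - 1 and acyclicity is
    reduced. Betti numbers are non-reduced; this is why vertices are singled out among critical
    faces and why there are two closure conditions, [down_closed] and [face_closed]. *)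

Notation simplicial_chain V := {ffun {set V} -> (('F_2)^o)%type}.

Section Chains.
Variable V : finType.
Implicit Types (v : V) (s t : {set V}) (c u z : simplicial_chain V) (D K : {set {set V}}).

Lemma addFF (T : lmodType 'F_2) (a : T) : a + a = 0.
Proof.
by rewrite -[a]scale1r -scalerDl (_ : 1 + 1 = 0 :> 'F_2) ?scale0r //; apply/val_inj.
Qed.

Lemma oppFF (T : lmodType 'F_2) (a : T) : - a = a.
Proof. by apply/eqP; rewrite eq_sym -addr_eq0 addFF. Qed.

(* Chains are not graded and the empty face is kept, so this is the reduced
   boundary, in all degrees at once. *)
Definition bd c : simplicial_chain V :=
  [ffun t : {set V} => \sum_(x | x \notin t) c (x |: t)%SET].

Definition cell s : simplicial_chain V := [ffun t : {set V} => (t == s)%:R].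

Definition supported c D : Prop := forall s, s \notin D -> c s = 0.

Lemma bd_is_linear : linear bd.
Proof.
move=> a c u; apply/ffunP => t; rewrite !ffunE scaler_sumr -big_split /=.
by apply: eq_bigr => x _; rewrite !ffunE.
Qed.
HB.instance Definition _ := GRing.isLinear.Build _ _ _ _ bd bd_is_linear.

(** The terms at (x, y) and (y, x) cancel in characteristic two; [enum_rank] only serves to pick one
    of each pair. *)
Lemma sum_symmetric (F : V -> V -> ('F_2)^o) :
  (forall x y, F x y = F y x) -> (forall x, F x x = 0) ->
  \sum_x \sum_y F x y = 0.
Proof.
move=> Fsym F0.
rewrite (_ : \sum_x _ = \sum_x (\sum_(y | (enum_rank x < enum_rank y)%N) F x y
    + \sum_(y | (enum_rank y < enum_rank x)%N) F x y)); last first.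
  apply: eq_bigr => x _.
  rewrite (bigID (fun y => (enum_rank x < enum_rank y)%N)) /=; congr (_ + _).
  rewrite (bigD1 x) ?ltnn //= F0 add0r; apply: eq_bigl => y.
  by rewrite -leqNgt andbC ltn_neqAle; congr (_ && _); rewrite (inj_eq val_inj) (inj_eq enum_rank_inj).
rewrite big_split /= [X in _ + X](exchange_big_dep predT) //=.
rewrite [X in _ + X](eq_bigr (fun x => \sum_(y | (enum_rank x < enum_rank y)%N) F x y)).
  exact: addFF.
by move=> x _; apply: eq_bigr => y _.
Qed.

Lemma bdbd c : bd (bd c) = 0.
Proof.
apply/ffunP => t; rewrite !ffunE.
pose F x y := if [&& x \notin t, y \notin t & x != y] then c (x |: (y |: t))%SET else 0.
rewrite -[RHS](@sum_symmetric F); first last.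
- by move=> x; rewrite /F eqxx !andbF.
- by move=> x y; rewrite /F andbCA eq_sym setUCA.
rewrite big_mkcond; apply: eq_bigr => x _; rewrite /F.
case: ifP => xt /=; last by rewrite big1.
rewrite ffunE big_mkcond; apply: eq_bigr => y _.
by rewrite in_setU1 negb_or setUCA (eq_sym y) andbC.
Qed.


Lemma bd_cell (s : {set V}) : bd (cell s) = \sum_(x in s) cell (s :\ x)%SET.
Proof.
apply/ffunP => t; rewrite sum_ffunE !ffunE big_mkcond [RHS]big_mkcond /=.
apply: eq_bigr => x _; rewrite !ffunE.
case: (boolP (x \in t)) => xt /=.
  case: ifP => // xs; case: eqP => // tE.
  by move: xt; rewrite tE !inE eqxx.
case: eqP => [<-|ne]; first by rewrite setU11 setU1K ?eqxx.
case: ifP => // xs; case: eqP => // tE.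
by case: ne; rewrite tE setD1K.
Qed.

Lemma bd_cell1 x : bd (cell [set x]%SET) = cell set0.
Proof. by rewrite bd_cell big_set1 setDv. Qed.

Lemma bd_cell2 x y : x != y ->
  bd (cell [set x; y]%SET) = cell [set x]%SET + cell [set y]%SET.
Proof.
move=> xy; rewrite bd_cell big_setU1 ?inE //= big_set1 addrC.
congr (cell _ + cell _); apply/setP => z; rewrite !inE.
  by case: (eqVneq z x) xy => [->|_ _] /=; [move/negbTE-> | case: eqP].
by case: (eqVneq z x) xy => [->|_ _] /=; [move/negbTE-> | case: eqP].
Qed.

Lemma supported0 D : supported 0 D.
Proof. by move=> s _; rewrite ffunE. Qed.

Lemma supportedD c u D : supported c D -> supported u D -> supported (c + u) D.
Proof. by move=> cD uD s sD; rewrite ffunE cD // uD // addr0. Qed.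

Lemma supported_sum (I : Type) (r : seq I) (P : pred I) (F : I -> simplicial_chain V) D :
  (forall i, P i -> supported (F i) D) -> supported (\sum_(i <- r | P i) F i) D.
Proof.
by move=> FD; elim/big_ind : _ => //; [exact: supported0 | move=> *; exact: supportedD].
Qed.

Lemma supportedS c D K : D \subset K -> supported c D -> supported c K.
Proof. by move=> DK cD s sK; apply: cD; apply: contra sK; exact: (subsetP DK). Qed.

Lemma supported_cell s D : s \in D -> supported (cell s) D.
Proof. by move=> sD t tD; rewrite ffunE; case: eqP tD => // ->; rewrite sD. Qed.

Lemma supported_mem c D s : supported c D -> c s != 0 -> s \in D.
Proof. by move=> cD; apply: contraR => /cD ->. Qed.

Definition down_closed D : Prop :=
  forall s t : {set V}, s \in D -> t \subset s -> t \in D.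

Lemma supported_bd c D : down_closed D -> supported c D -> supported (bd c) D.
Proof.
move=> Dcl cD t tD; rewrite ffunE big1 // => x xt; apply: cD.
by apply: contra tD => /Dcl; apply; exact: subsetUr.
Qed.

(** * Restriction and homogeneous components of chains *)

Definition restrict (P : pred {set V}) c : simplicial_chain V :=
  [ffun t : {set V} => if P t then c t else 0].

Lemma supported_restrict P c D : supported c D ->
  supported (restrict P c) [set s in D | P s]%SET.
Proof.
move=> cD s; rewrite ffunE inE negb_and => /orP[sD|/negbTE -> //].
by rewrite cD // if_same.
Qed.

Definition homog j := restrict (fun s => #|s| == j).

Lemma bd_homog j c : bd (homog j.+1 c) = homog j (bd c).
Proof.
apply/ffunP => t; rewrite !ffunE; case: ifP => tj.
  by apply: eq_bigr => x xt; rewrite ffunE cardsU1 xt (eqP tj) eqxx.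
by rewrite big1 // => x xt; rewrite ffunE cardsU1 xt add1n eqSS tj.
Qed.

Lemma bd_homog0 c : bd (homog 0 c) = 0.
Proof.
by apply/ffunP => t; rewrite !ffunE big1 // => x xt; rewrite ffunE cardsU1 xt.
Qed.

Lemma homog_sum c : c = \sum_(j < #|V|.+1) homog j c.
Proof.
apply/ffunP => t; rewrite sum_ffunE.
have tj : (#|t| < #|V|.+1)%N by rewrite ltnS max_card.
rewrite (bigD1 (Ordinal tj)) //= ffunE eqxx big1 ?addr0 // => i ne.
rewrite ffunE; case: eqP => // E; case/eqP: ne; exact/val_inj.
Qed.

(** * Cones, links and deletions of chains *)

Definition cone v c : simplicial_chain V :=
  [ffun t : {set V} => if v \in t then c (t :\ v)%SET else 0].
Definition chain_link v c : simplicial_chain V :=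
  [ffun t : {set V} => if v \in t then 0 else c (v |: t)%SET].
Definition chain_del v c : simplicial_chain V :=
  [ffun t : {set V} => if v \in t then 0 else c t].

Lemma chain_linkD v : {morph chain_link v : c u / c + u}.
Proof. by move=> c u; apply/ffunP=> t; rewrite !ffunE; case: ifP; rewrite ?addr0. Qed.
Lemma chain_delD v : {morph chain_del v : c u / c + u}.
Proof. by move=> c u; apply/ffunP=> t; rewrite !ffunE; case: ifP; rewrite ?addr0. Qed.
Lemma coneD v : {morph cone v : c u / c + u}.
Proof. by move=> c u; apply/ffunP=> t; rewrite !ffunE; case: ifP; rewrite ?addr0. Qed.
Lemma cone0 v : cone v 0 = 0.
Proof. by apply/ffunP=> t; rewrite !ffunE if_same. Qed.
Lemma chain_link0 v : chain_link v 0 = 0.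
Proof. by apply/ffunP=> t; rewrite !ffunE if_same. Qed.
Lemma chain_del0 v : chain_del v 0 = 0.
Proof. by apply/ffunP=> t; rewrite !ffunE if_same. Qed.

(** The link records the faces through v and the deletion those avoiding it. Identities involving
    cones are checked on these two components. *)
Lemma chain_split v c u :
  chain_link v c = chain_link v u -> chain_del v c = chain_del v u -> c = u.
Proof.
move=> /ffunP El /ffunP Ed; apply/ffunP => t.
case: (boolP (v \in t)) => vt.
  by have := El (t :\ v)%SET; rewrite !ffunE !inE eqxx /= setD1K.
by have := Ed t; rewrite !ffunE (negbTE vt).
Qed.

Lemma chain_link_bd v c : chain_link v (bd c) = bd (chain_link v c).
Proof.
apply/ffunP => t; rewrite !ffunE; case: ifPn => vt.
  by rewrite big1 // => x xt; rewrite ffunE inE vt orbT.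
rewrite [RHS](bigD1 v) //= ffunE setU11 add0r.
apply: eq_big => [x|x]; first by rewrite in_setU1 negb_or andbC.
rewrite in_setU1 negb_or => /andP[xv xt].
by rewrite ffunE in_setU1 eq_sym (negbTE xv) (negbTE vt) setUCA.
Qed.

(** A face avoiding v arises in the boundary either by dropping v, which gives the link term, or
    from a face that already avoids v. *)
Lemma chain_del_bd v c :
  chain_del v (bd c) = chain_link v c + bd (chain_del v c).
Proof.
apply/ffunP => t; rewrite !ffunE; case: ifPn => vt.
  by rewrite big1 ?addr0 // => x xt; rewrite ffunE inE vt orbT.
rewrite [LHS](bigD1 v) //= [in RHS](bigD1 v) //= [in RHS]ffunE setU11 add0r.
congr (_ + _); apply: eq_bigr => x /andP[xt xv].
by rewrite ffunE in_setU1 eq_sym (negbTE xv) (negbTE vt).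
Qed.

Lemma chain_link_cone v c : chain_link v (cone v c) = chain_del v c.
Proof.
apply/ffunP => t; rewrite !ffunE setU11; case: ifPn => // vt.
by rewrite setU1K.
Qed.

Lemma chain_del_cone v c : chain_del v (cone v c) = 0.
Proof. by apply/ffunP => t; rewrite !ffunE; case: ifP => // ->. Qed.

Lemma chain_link_del v c : chain_link v (chain_del v c) = 0.
Proof. by apply/ffunP => t; rewrite !ffunE setU11 if_same. Qed.

Lemma chain_del_id v c : chain_del v (chain_del v c) = chain_del v c.
Proof. by apply/ffunP => t; rewrite !ffunE; case: (v \in t). Qed.

Lemma chain_decomp v c : c = cone v (chain_link v c) + chain_del v c.
Proof.
apply: (@chain_split v).
  rewrite chain_linkD chain_link_cone chain_link_del addr0.
  by apply/ffunP => t; rewrite !ffunE; case: (v \in t).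
by rewrite chain_delD chain_del_cone add0r chain_del_id.
Qed.

Lemma bd_cone v c : chain_del v c = c -> bd (cone v c) = c + cone v (bd c).
Proof.
move=> vc; have vbc : chain_link v c = 0 by rewrite -vc chain_link_del.
apply: (@chain_split v).
  rewrite chain_link_bd chain_linkD !chain_link_cone vc vbc add0r.
  by rewrite chain_del_bd vbc add0r vc.
by rewrite chain_del_bd chain_link_cone chain_del_cone chain_delD chain_del_cone linear0.
Qed.

Lemma cone_cell v s : v \notin s -> cone v (cell s) = cell (v |: s)%SET.
Proof.
move=> vs; apply/ffunP => t; rewrite !ffunE; case: ifPn => vt.
  congr ((nat_of_bool _)%:R); apply/eqP/eqP => [<-|->]; [by rewrite setD1K | by rewrite setU1K].
by case: eqP => // tE; rewrite tE setU11 in vt.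
Qed.

Lemma supported_chain_link v c D : supported c D -> supported (chain_link v c) (link D v).
Proof.
by move=> cD t; rewrite inE negb_and negbK ffunE; case: ifP => //= _ /cD.
Qed.

Lemma supported_chain_del v c D : supported c D -> supported (chain_del v c) (deletion D v).
Proof.
move=> cD t; rewrite inE negb_and negbK ffunE; case: ifP => //= _.
by rewrite orbF => /cD.
Qed.

Lemma supported_cone v c D : supported c (link D v) -> supported (cone v c) D.
Proof.
move=> cD t tD; rewrite ffunE; case: ifP => // vt; apply: cD.
by rewrite inE !inE eqxx /= setD1K.
Qed.

Lemma chain_del_supported v c D : supported c D ->
  (forall s, s \in D -> v \notin s) -> chain_del v c = c.
Proof.
move=> cD vD; apply/ffunP => t; rewrite ffunE; case: ifPn => // vt.
by rewrite cD //; apply: contraL vt => /vD.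
Qed.

(** * Boundaries and acyclicity *)

Definition bounds D z : Prop := exists2 u, supported u D & bd u = z.
(** All degrees are treated at once. As [cell set0] is a cycle, an acyclic complex with an empty
    face must have a vertex. *)
Definition acyclic D : Prop := forall z, supported z D -> bd z = 0 -> bounds D z.

Lemma boundsD D z w : bounds D z -> bounds D w -> bounds D (z + w).
Proof.
move=> [u uD <-] [c cD <-]; exists (u + c); first exact: supportedD.
by rewrite linearD.
Qed.

Lemma bounds0 D : bounds D 0.
Proof. by exists 0; [exact: supported0|rewrite linear0]. Qed.

Lemma boundsS D K z : D \subset K -> bounds D z -> bounds K z.
Proof. by move=> DK [u uD <-]; exists u => //; exact: supportedS uD. Qed.

Lemma bounds_sum (I : Type) (r : seq I) (P : pred I) (F : I -> simplicial_chain V) D :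
  (forall i, P i -> bounds D (F i)) -> bounds D (\sum_(i <- r | P i) F i).
Proof.
by move=> FD; elim/big_ind : _ => //; [exact: bounds0 | move=> *; exact: boundsD].
Qed.

End Chains.

(** * Complexes cut by successive height functions *)

Section Layered.
Variables (R : realDomainType) (V : finType).
Implicit Types (v w x y : V) (s t : {set V}) (c z : simplicial_chain V).
Implicit Types (D K L : {set {set V}}) (h : V -> R).

Definition upper_link h D v : {set {set V}} :=
  [set t in link D v | [forall u in t, h v < h u]]%SET.

(* What is used of a linear embedding of [D] in R^d: seen from [v], the faces
   above (or below) [v] project to a hyperplane, see [embedding_layered]. *)
Fixpoint layered d D : Prop :=
  if d is d'.+1 then
    exists h : V -> R, {in vertices D &, injective h} /\
      {in vertices D, forall v, layered d' (upper_link h D v) /\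
                                layered d' (upper_link (fun u => - h u) D v)}
  else (#|vertices D| <= 1)%N.

Lemma upper_linkP h D v t :
  reflect [/\ v \notin t, (v |: t)%SET \in D & {in t, forall u, h v < h u}]
          (t \in upper_link h D v).
Proof.
rewrite !inE; apply: (iffP andP) => [[/andP[vt tD] /'forall_implyP ht]|[vt tD ht]].
  by split.
by rewrite vt tD; split => //; apply/'forall_implyP.
Qed.

Lemma upper_linkS h D K v : D \subset K -> upper_link h D v \subset upper_link h K v.
Proof.
by move=> /subsetP DK; apply/subsetP => t /upper_linkP[? /DK ? ?]; apply/upper_linkP.
Qed.

Lemma verticesS D K : D \subset K -> vertices D \subset vertices K.
Proof. by move=> /subsetP DK; apply/subsetP => v; rewrite !inE => /DK. Qed.

Lemma layeredS d D K : D \subset K -> layered d K -> layered d D.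
Proof.
elim: d D K => [|d IH] D K DK /=; first exact/leq_trans/subset_leq_card/verticesS.
have VDK := subsetP (verticesS DK).
move=> [h [hinj hK]]; exists h; split.
  by move=> v w /VDK vK /VDK wK; exact: hinj.
move=> v /VDK /hK [up low]; split.
  exact: IH (upper_linkS _ _ DK) up.
exact: IH (upper_linkS _ _ DK) low.
Qed.

Lemma down_closed_link D v : down_closed D -> down_closed (link D v).
Proof.
move=> Dcl s t; rewrite !inE => /andP[vs sD] ts; apply/andP; split.
  by apply: contra vs; exact: (subsetP ts).
by apply: Dcl sD _; exact: setUS.
Qed.

Lemma down_closed_del D v : down_closed D -> down_closed (deletion D v).
Proof.
move=> Dcl s t; rewrite !inE => /andP[sD vs] ts.
by rewrite (Dcl _ _ sD ts); apply: contra vs; exact: (subsetP ts).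
Qed.

Lemma down_closed_upper_link h D v : down_closed D -> down_closed (upper_link h D v).
Proof.
move=> Dcl s t /upper_linkP[vs sD hs] ts; apply/upper_linkP; split.
- by apply: contra vs; exact: (subsetP ts).
- by apply: Dcl sD _; exact: setUS.
- by move=> u /(subsetP ts) /hs.
Qed.

Lemma mem_vertices D s v : down_closed D -> s \in D -> v \in s -> v \in vertices D.
Proof. by move=> Dcl sD vs; rewrite inE; apply: Dcl sD _; rewrite sub1set. Qed.

Lemma exists_min h (A : {set V}) : {in A &, injective h} -> A != set0 ->
  exists2 v, v \in A & {in A, forall u, u != v -> h v < h u}.
Proof.
move=> hinj /set0Pn[v0 v0A].
case: (@Order.TotalTheory.arg_minP _ _ _ v0 (mem A) h v0A) => v vA vmin.
exists v => // u uA uv; rewrite lt_neqAle vmin // andbT.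
by apply: contra uv => /eqP /hinj ->.
Qed.

Lemma supported_upper_link h D v c : supported c D ->
  (forall s u, c s != 0 -> v \in s -> u \in s -> u != v -> h v < h u) ->
  supported (chain_link v c) (upper_link h D v).
Proof.
move=> cD hv t; apply: contraNeq; rewrite ffunE.
case: ifPn => [_|vt ct]; first by rewrite eqxx.
apply/upper_linkP; split => //; first exact: supported_mem ct.
move=> u ut; apply: (hv _ _ ct); rewrite ?setU11 //; first by rewrite setU1r.
by apply: contraNneq vt => <-.
Qed.

(** The analogue of the absence of nonzero d-cycles in R^d. At the lowest vertex v on a face of c,
    the link of c is a cycle of the upper link, one dimension lower, so it vanishes by induction and
    v is on no face of c after all. *)
Lemma layered_top_cycle d D c : layered d D -> down_closed D -> supported c D ->
  bd c = 0 -> (forall s, c s != 0 -> (d < #|s|)%N) -> c = 0.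
Proof.
elim: d D c => [|d IH] D c /= Dd Dcl cD bc cd.
  apply/ffunP => s; rewrite ffunE; apply/eqP; apply: contraT => cs.
  have sD := supported_mem cD cs.
  have sV : s \subset vertices D by apply/subsetP => x; exact: mem_vertices.
  have s1 : #|s| == 1%N by rewrite eqn_leq cd // (leq_trans (subset_leq_card sV)).
  have [x sx] := cards1P s1.
  (* With at most one vertex available, s is that vertex, and the reduced boundary shows its
     coefficient at the empty face. *)
  have := congr1 (fun b : simplicial_chain V => b set0) bc; rewrite !ffunE.
  rewrite (bigD1 x) ?inE //= big1 => [|y /andP[_ yx]].
    by rewrite addr0 setU0 -sx => E; rewrite E eqxx in cs.
  rewrite setU0; apply: cD; apply: contra yx => yD.
  have: [set x; y]%SET \subset vertices D.
    by apply/subsetP => z; rewrite !inE => /orP[/eqP->|/eqP->] //; rewrite -sx.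
  move=> /subset_leq_card /leq_trans /(_ Dd); rewrite cards2 eq_sym.
  by case: eqP.
move: Dd => [h [hinj hD]]; apply/eqP; apply: contraT => c0.
pose A := [set v | [exists s, (c s != 0) && (v \in s)]]%SET.
have AP s v : c s != 0 -> v \in s -> v \in A.
  by move=> cs vs; rewrite inE; apply/existsP; exists s; rewrite cs.
have AV : {subset A <= vertices D}.
  move=> v; rewrite inE => /existsP[s /andP[/(supported_mem cD) sD vs]].
  exact: mem_vertices sD vs.
have A0 : A != set0.
  apply: contra c0 => /eqP A0; apply/eqP/ffunP => s; rewrite ffunE.
  apply/eqP; apply: contraT => cs; have := cd _ cs.
  move/(leq_ltn_trans (leq0n _)); rewrite card_gt0 => /set0Pn[v vs].
  by have := AP _ _ cs vs; rewrite A0 inE.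
have [v vA vmin] := exists_min (sub_in2 AV hinj) A0.
have [up _] := hD v (AV _ vA).
have lk0 : chain_link v c = 0.
  apply: (IH _ _ up (down_closed_upper_link Dcl)).
  - apply: supported_upper_link => // s u cs _ us uv.
    by apply: vmin => //; exact: AP us.
  - by rewrite -chain_link_bd bc chain_link0.
  - move=> t; rewrite ffunE; case: ifPn => [|vt /cd]; first by rewrite eqxx.
    by rewrite cardsU1 vt.
move: vA; rewrite inE => /existsP[s /andP[cs vs]].
have := congr1 (fun b : simplicial_chain V => b (s :\ v)%SET) lk0.
by rewrite !ffunE !inE eqxx /= setD1K // => E; rewrite E eqxx in cs.
Qed.

Lemma layered_card d D s : layered d D -> down_closed D -> s \in D -> (#|s| <= d.+1)%N.
Proof.
elim: d D s => [|d IH] D s /= Dd Dcl sD.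
  by apply: leq_trans Dd; apply: subset_leq_card; apply/subsetP => x; exact: mem_vertices.
have [->|s0] := eqVneq s set0; first by rewrite cards0.
move: Dd => [h [hinj hD]].
have sV : {subset s <= vertices D} by move=> x; exact: mem_vertices.
have [v vs vmin] := exists_min (sub_in2 sV hinj) s0.
have [up _] := hD v (sV _ vs).
rewrite (cardsD1 v) vs add1n ltnS; apply: IH up (down_closed_upper_link Dcl) _.
apply/upper_linkP; split; rewrite ?setD1K ?inE ?eqxx //.
by move=> u; rewrite !inE => /andP[uv us]; exact: vmin.
Qed.

(** Take v lowest among the vertices of faces of maximal size. All such faces through v lie above v,
    so they are cones over faces of maximal size in an upper link, and a free pair found there by
    induction is coned back with v. *)
Lemma layered_free_face d D : layered d D -> down_closed D ->
    (exists2 s, s \in D & #|s| = d.+1) ->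
  exists e t : {set V}, [/\ t \in D, #|t| = d.+1, e \subset t, #|e| = d &
    forall s, s \in D -> e \subset s -> s = e \/ s = t].
Proof.
elim: d D => [|d IH] D /= Dd Dcl [s0 s0D s0d].
  exists set0, s0; split; rewrite ?sub0set ?cards0 // => s sD _.
  have VD q : q \in D -> q \subset vertices D.
    by move=> qD; apply/subsetP => x; exact: mem_vertices.
  have [->|sn0] := eqVneq s set0; [by left|right].
  have VE q : q \in D -> q != set0 -> q = vertices D.
    move=> qD q0; apply/eqP; rewrite eqEcard VD //=.
    by rewrite (leq_trans Dd) // card_gt0.
  have s0n : s0 != set0 by rewrite -card_gt0 s0d.
  exact: etrans (VE s sD sn0) (esym (VE s0 s0D s0n)).
move: (Dd) => [h [hinj hD]].
pose A := [set v | [exists s in D, (#|s| == d.+2) && (v \in s)]]%SET.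
have AP s v : s \in D -> #|s| = d.+2 -> v \in s -> v \in A.
  by move=> sD sd vs; rewrite inE; apply/existsP; exists s; rewrite sD sd eqxx.
have AV : {subset A <= vertices D}.
  move=> v; rewrite inE => /existsP[s /and3P[sD _ vs]].
  exact: mem_vertices sD vs.
have A0 : A != set0.
  have: (0 < #|s0|)%N by rewrite s0d.
  rewrite card_gt0 => /set0Pn[v vs].
  by apply/set0Pn; exists v; exact: AP vs.
have [v vA vmin] := exists_min (sub_in2 AV hinj) A0.
pose L := upper_link h [set s in D | s \subset A]%SET v.
have AD : [set s in D | s \subset A]%SET \subset D.
  by apply/subsetP => s; rewrite inE => /andP[].
have Acl : down_closed [set s in D | s \subset A]%SET.
  move=> s t; rewrite !inE => /andP[sD sA] ts.
  by rewrite (Dcl _ _ sD ts) (subset_trans ts).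
have Ld : layered d L by have [+ _] := hD v (AV _ vA); exact/layeredS/upper_linkS.
have LP s : s \in D -> #|s| = d.+2 -> v \in s -> (s :\ v)%SET \in L.
  move=> sD sd vs.
  have sA : s \subset A by apply/subsetP => x xs; exact: AP xs.
  apply/upper_linkP; split; rewrite ?setD1K ?inE ?eqxx ?sD //.
  move=> u; rewrite !inE => /andP[uv us]; apply: vmin => //.
  exact: (subsetP sA).
have Ltop : exists2 s, s \in L & #|s| = d.+1.
  move: vA; rewrite inE => /existsP[s /and3P[sD /eqP sd vs]].
  by exists (s :\ v)%SET; [exact: LP|move: sd; rewrite (cardsD1 v) vs => -[]].
have [e [t [/upper_linkP[vt tD _] td et ed free]]] :=
  IH L Ld (down_closed_upper_link Acl) Ltop.
have ve : v \notin e by apply: contra vt; exact: (subsetP et).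
have vtD : (v |: t)%SET \in D by exact: (subsetP AD).
exists (v |: e)%SET, (v |: t)%SET; split => //.
- by rewrite cardsU1 vt td.
- exact: setUS.
- by rewrite cardsU1 ve ed.
move=> s sD es; have vs : v \in s by apply: (subsetP es); rewrite setU11.
have se : #|(v |: e)%SET| = d.+1 by rewrite cardsU1 ve ed.
(* A face containing the coned e either has maximal size, and then comes from the link, or by
   [layered_card] has no more vertices than the coned e itself. *)
have [sd|sd] := eqVneq #|s| d.+2.
  have e1 : e \subset (s :\ v)%SET.
    apply/subsetP => x xe; rewrite !inE; apply/andP; split.
      by apply: contraNneq ve => <-.
    by apply: (subsetP es); rewrite setU1r.
  by case: (free _ (LP s sD sd vs) e1) => <-; [left|right]; rewrite setD1K.
left; apply/esym/eqP; rewrite eqEcard es se.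
by rewrite -ltnS ltn_neqAle sd; exact: (@layered_card d.+1 D s Dd Dcl sD).
Qed.

End Layered.

(** * Building a complex by critical faces and pairs *)

Section Buildable.
Variable (V : finType).
Implicit Types (v w x y : V) (s t : {set V}) (c z : simplicial_chain V).
Implicit Types (D K L G M : {set {set V}}).

(** This tolerates both conventions: links are built with their empty face, whereas C is built
    through [nonempty_faces]. *)
Definition face_closed D : Prop :=
  forall s t : {set V}, s \in D -> t \subset s -> t != set0 -> t \in D.

(** Reversed collapses together with the attachment of critical faces. It is used with [ok_graph]
    from a point, for planar links, and with [ok_perfect] from the empty set, for C. *)
Inductive buildable (ok : {set {set V}} -> {set V} -> Prop) D0 : {set {set V}} -> Prop :=
| Build_base : buildable ok D0 D0
| Build_critical D s : buildable ok D0 D -> s \notin D ->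
    face_closed (s |: D)%SET -> ok D s -> buildable ok D0 (s |: D)%SET
| Build_pair D s t : buildable ok D0 D -> s \notin D -> t \notin D ->
    s \subset t -> #|t| = #|s|.+1 -> face_closed (s |: (t |: D))%SET ->
    buildable ok D0 (s |: (t |: D))%SET.

Lemma buildable_base ok D0 D : buildable ok D0 D -> D0 \subset D.
Proof.
elim=> {D} [|D s _ IH _ _ _|D s t _ IH _ _ _ _ _] //.
  exact: subset_trans IH (subsetUr _ _).
exact: subset_trans IH (subset_trans (subsetUr _ _) (subsetUr _ _)).
Qed.

Lemma buildable_closed ok D0 D : face_closed D0 -> buildable ok D0 D -> face_closed D.
Proof. by move=> D0cl [|? ? ? ? ? ?|? ? ? ? ? ? ? ?]. Qed.

Lemma face_closedW D : down_closed D -> face_closed D.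
Proof. by move=> Dcl s t sD ts _; exact: Dcl sD ts. Qed.

Lemma face_closedU D s : face_closed D ->
  (forall t, t \proper s -> t != set0 -> t \in D) -> face_closed (s |: D)%SET.
Proof.
move=> Dcl sD q t; rewrite !in_setU1 => /orP[/eqP ->|qD] ts t0.
  have [//|ne] := eqVneq t s.
  by rewrite sD // properEneq ne ts.
by rewrite (Dcl q t qD ts t0) orbT.
Qed.

(** The bound 2 keeps the cycle closed by s in degree at most 1, where tightness will be applied. *)
Definition ok_graph D s : Prop := (#|s| <= 2)%N /\ bounds D (bd (cell s)).

Definition point w : {set {set V}} := [set set0; [set w]]%SET.

Lemma proper1 x s : s \proper [set x]%SET -> s = set0.
Proof. by rewrite properE subset1 => /andP[/orP[/eqP->|/eqP->]]; rewrite ?subxx. Qed.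

Lemma proper2 x y s : s \proper [set x; y]%SET -> s != set0 ->
  s = [set x]%SET \/ s = [set y]%SET.
Proof.
move=> /properP[/subsetP sxy [z zxy zs]] /set0Pn[q qs].
have E a b : (forall i, i \in s -> (i == a) || (i == b)) -> b \notin s -> a \in s ->
    s = [set a]%SET.
  move=> sab bs as_; apply/setP => i; rewrite inE; apply/idP/eqP => [is_|->//].
  by case/orP: (sab _ is_) => /eqP // E; rewrite -E is_ in bs.
have sxy' i : i \in s -> (i == x) || (i == y) by move=> /sxy; rewrite !inE.
move: zxy zs; rewrite !inE => /orP[]/eqP -> zs.
  right; apply: (E y x) => //; first by move=> i /sxy'; rewrite orbC.
  by case/orP: (sxy' _ qs) => /eqP Eq; rewrite Eq ?(negbTE zs) // in qs *.
left; apply: (E x y) => //.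
by case/orP: (sxy' _ qs) => /eqP Eq; rewrite Eq ?(negbTE zs) // in qs *.
Qed.

(** Two vertices whose sum bounds are in the same component. The growing graph K may miss components
    of G, but must not split one in two. *)
Definition components_match G K : Prop := forall a b,
  a \in vertices K -> b \in vertices K ->
  bounds G (cell [set a]%SET + cell [set b]%SET) ->
  bounds K (cell [set a]%SET + cell [set b]%SET).

Lemma addFF_mid (a b c : simplicial_chain V) : a + c = (a + b) + (b + c).
Proof. by rewrite addrA -(addrA a) addFF addr0. Qed.

Lemma components_matchS G K K' : components_match G K -> K \subset K' -> K' \subset G ->
  (forall a, a \in vertices K' ->
     exists2 b, b \in vertices K & bounds K' (cell [set a]%SET + cell [set b]%SET)) ->
  components_match G K'.
Proof.
move=> KG KK' K'G K'K a b /K'K[a' a'K aa'] /K'K[b' b'K bb'] abG.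
have a'b' : bounds K (cell [set a']%SET + cell [set b']%SET).
  apply: KG => //; rewrite (addFF_mid _ (cell [set a]%SET)); apply: boundsD.
    by rewrite addrC; exact: boundsS aa'.
  rewrite (addFF_mid _ (cell [set b]%SET)); apply: boundsD => //.
  exact: boundsS bb'.
rewrite (addFF_mid _ (cell [set a']%SET)); apply: boundsD => //.
rewrite (addFF_mid _ (cell [set b']%SET)) (addrC _ (cell [set b]%SET)); apply: boundsD => //.
exact: boundsS a'b'.
Qed.

(* A boundary of [G] meets a union of connected components in an even number
   of vertices. *)
Lemma not_bounds_separated G (A : {set V}) a b : a \notin A -> b \in A ->
  (forall x y, x \in A -> y \notin A -> [set x; y]%SET \notin G) ->
  ~ bounds G (cell [set a]%SET + cell [set b]%SET).
Proof.
move=> aA bA sep [c cG bc].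
(* As no edge leaves A, the part of c inside A has b as its only boundary vertex; applying the
   boundary once more gives 1 at the empty face, against [bdbd]. *)
pose c' := restrict (fun s => s \subset A) c.
have := congr1 (fun b : simplicial_chain V => b set0) (bdbd c').
rewrite [LHS]ffunE (eq_bigl xpredT); last by move=> x; rewrite inE.
have bc' x : bd c' (x |: set0)%SET = (x == b)%:R.
  rewrite setU0; case: (boolP (x \in A)) => xA.
    transitivity (bd c [set x]%SET).
      rewrite !ffunE; apply: eq_bigr => y _; rewrite ffunE subUset !sub1set xA andbT.
      by case: ifPn => // yA; rewrite cG // setUC sep.
    rewrite bc !ffunE !(inj_eq set1_inj).
    by case: (eqVneq x a) xA aA => [->->|] //; rewrite add0r.
  rewrite ffunE big1.
    by case: eqP xA bA => // -> /negbTE ->.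
  by move=> y _; rewrite ffunE subUset !sub1set (negbTE xA) andbF.
rewrite (eq_bigr (fun x => (x == b)%:R)) => [|x _]; last exact: bc'.
by rewrite (bigD1 b) //= eqxx big1 => [|i /negbTE ->] //; rewrite addr0 ffunE => /eqP.
Qed.

(** The order of preference preserves [components_match]: an edge leaving K is paired with its new
    endpoint; a vertex becomes critical only if no edge leaves K; an edge becomes critical only once
    all vertices are present, and then its endpoints are already joined in K. *)
Lemma graph_buildable G w : down_closed G -> [set w]%SET \in G ->
  (forall s, s \in G -> (#|s| <= 2)%N) -> buildable ok_graph (point w) G.
Proof.
move=> Gcl wG G2.
have edgeG x y : [set x; y]%SET \in G -> bounds G (cell [set x]%SET + cell [set y]%SET).
  move=> xyG; have [->|xy] := eqVneq x y; first by rewrite addFF; exact: bounds0.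
  by rewrite -bd_cell2 //; exists (cell [set x; y]%SET) => //; exact: supported_cell.
have pwG : point w \subset G.
  by rewrite subUset !sub1set wG (Gcl _ _ wG (sub0set _)).
have pwcl : face_closed (point w).
  move=> s t; rewrite !inE => /orP[]/eqP->; first by rewrite subset0 => ->.
  by rewrite subset1 orbC.
have base : components_match G (point w).
  move=> a b; rewrite !inE !(inj_eq set1_inj) => /orP[/eqP E|/eqP->].
    by have := set11 a; rewrite E inE.
  case/orP => [/eqP E|/eqP->]; first by have := set11 b; rewrite E inE.
  by rewrite addFF => _; exact: bounds0.
suff H n K : (#|G :\: K| <= n)%N -> buildable ok_graph (point w) K -> K \subset G ->
    components_match G K -> buildable ok_graph (point w) G.
  by apply: (H _ (point w)) => //; exact: Build_base.
elim: n K => [|n IH] K.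
  rewrite leqn0 cards_eq0 setD_eq0 => GK bK KG _.
  by have -> : G = K by apply/eqP; rewrite eqEsubset GK.
move=> Kn bK KG Kmatch.
have Kcl := buildable_closed pwcl bK.
have pK := subsetP (buildable_base bK).
have wK : w \in vertices K by rewrite inE; apply: pK; rewrite !inE eqxx orbT.
have dec K' s : s \in G -> s \notin K -> K \subset K' -> s \in K' -> (#|G :\: K'| <= n)%N.
  move=> sG sK KK' sK'; rewrite -ltnS; apply: leq_trans Kn; apply: proper_card.
  apply/properP; split; first exact: setDS.
  by exists s; rewrite !inE ?sK ?sK' // sG.
have [/existsP[x /existsP[y /and3P[xK yK xyG]]]|noedge] := boolP
    [exists x, exists y, [&& x \in vertices K, y \notin vertices K & [set x; y]%SET \in G]].
  have xy : x != y by apply: contraNneq yK => <-.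
  have yK' : [set y]%SET \notin K by rewrite inE in yK.
  have xK' : [set x]%SET \in K by rewrite inE in xK.
  pose K' := ([set y]%SET |: ([set x; y]%SET |: K))%SET.
  have KK' : K \subset K' by apply: subset_trans (subsetUr _ _); exact: subsetUr.
  have yG : [set y]%SET \in G by apply: Gcl xyG _; rewrite sub1set !inE eqxx orbT.
  have xyK' : [set x; y]%SET \in K' by rewrite !inE eqxx ?orbT.
  have K'G : K' \subset G by rewrite !subUset !sub1set yG xyG.
  apply: (IH K'); rewrite ?K'G //.
  - by apply: (dec _ [set y]%SET) => //; rewrite !inE eqxx.
  - apply: Build_pair => //.
    + apply: contra yK' => xyK; apply: Kcl xyK _ _; first by rewrite sub1set !inE eqxx orbT.
      by apply/set0Pn; exists y; rewrite inE.
    + by rewrite sub1set !inE eqxx orbT.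
    + by rewrite cards1 cards2 xy.
    + rewrite setUCA; apply: face_closedU.
        by apply: face_closedU => // t /proper1 ->; rewrite eqxx.
      by move=> t /proper2 H /H[]->; rewrite !inE ?xK' ?eqxx ?orbT.
  - apply: components_matchS Kmatch KK' K'G _ => a.
    rewrite inE /K' !in_setU1 (inj_eq set1_inj) => /or3P[/eqP->|/eqP E|aK].
    + exists x => //; exists (cell [set x; y]%SET); first exact: supported_cell.
      by rewrite bd_cell2 // addrC.
    + by move/(congr1 (fun A : {set V} => #|A|)): E; rewrite cards1 cards2 xy.
    + by exists a; rewrite ?inE // addFF; exact: bounds0.
have sep x y : x \in vertices K -> y \notin vertices K -> [set x; y]%SET \notin G.
  move=> xK yK; apply: contra noedge => xyG.
  by apply/existsP; exists x; apply/existsP; exists y; rewrite xK yK.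
have [/existsP[y /andP[yG yK]]|allv] := boolP [exists y, (y \in vertices G) && (y \notin vertices K)].
  rewrite inE in yG; have yK' : [set y]%SET \notin K by rewrite inE in yK.
  pose K' := ([set y]%SET |: K)%SET.
  have KK' : K \subset K' by exact: subsetUr.
  have K'G : K' \subset G by rewrite subUset !sub1set yG.
  (* No edge of G leaves the vertex set of K, so y opens a component of G disjoint from K. *)
  have nb b : b \in vertices K -> ~ bounds G (cell [set y]%SET + cell [set b]%SET).
    by move=> bK'; apply: (not_bounds_separated yK).
  apply: (IH K') => //.
  - by apply: (dec _ [set y]%SET) => //; rewrite !inE eqxx.
  - apply: Build_critical => //.
      by apply: face_closedU => // t /proper1 ->; rewrite eqxx.
    split; first by rewrite cards1.
    rewrite bd_cell1 -(bd_cell1 w); exists (cell [set w]%SET) => //.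
    by apply: supported_cell; rewrite inE in wK.
  - move=> a b; rewrite inE [b \in _]inE /K' !in_setU1 !(inj_eq set1_inj).
    move=> /orP[/eqP->|aK] /orP[/eqP->|bK'] abG.
    + by rewrite addFF; exact: bounds0.
    + by case: (@nb b); rewrite ?inE.
    + by case: (@nb a); rewrite ?inE // addrC.
    + by apply: boundsS KK' _; apply: Kmatch; rewrite ?inE.
have VK x : x \in vertices G -> x \in vertices K.
  by move=> xG; apply: contraR allv => xK; apply/existsP; exists x; rewrite xG.
have [/eqP|/set0Pn[s]] := boolP ((G :\: K)%SET == set0).
  by move/eqP; rewrite setD_eq0 => GK; have -> : G = K by apply/eqP; rewrite eqEsubset GK.
rewrite inE => /andP[sK sG].
have s2 : #|s| == 2%N.
  rewrite eqn_leq G2 //= ltnNge; apply: contra sK.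
  rewrite leq_eqVlt ltnS leqn0 cards_eq0 => /orP[|/eqP->]; last first.
    by apply: pK; rewrite !inE eqxx.
  case/cards1P => x sx; rewrite sx in sG *.
  by have := VK x; rewrite !inE; exact.
have [x [y xy sxy]] : exists x, exists2 y, x != y & s = [set x; y]%SET.
  by case/cards2P: s2 => x [y [xy ->]]; exists x, y.
have xG : x \in vertices G by apply: mem_vertices sG _ => //; rewrite sxy !inE eqxx.
have yG : y \in vertices G by apply: mem_vertices sG _ => //; rewrite sxy !inE eqxx orbT.
pose K' := (s |: K)%SET.
have KK' : K \subset K' by exact: subsetUr.
have K'G : K' \subset G by rewrite subUset sub1set sG.
have VK' a : a \in vertices K' -> a \in vertices K.
  by move=> aK'; apply: VK; exact: (subsetP (verticesS K'G)).
apply: (IH K') => //.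
- by apply: (dec _ s) => //; rewrite !inE eqxx.
- apply: Build_critical => //.
    apply: face_closedU => // t; rewrite sxy => /proper2 H /H[]->.
      by have := VK _ xG; rewrite inE.
    by have := VK _ yG; rewrite inE.
  split; first by rewrite (eqP s2).
  rewrite sxy bd_cell2 //; apply: Kmatch; [exact: VK|exact: VK|].
  by apply: edgeG; rewrite -sxy.
- move=> a b aK' bK' abG; apply: boundsS KK' _.
  by apply: Kmatch => //; exact: VK'.
Qed.

Lemma planar_buildable (R : realDomainType) L w : layered R 2 L -> down_closed L ->
  [set w]%SET \in L -> buildable ok_graph (point w) L.
Proof.
have [n] := ubnP #|L|; elim: n L => // n IH L; rewrite ltnS => Ln L2 Lcl wL.
have [/existsP[s0 /andP[s0L /eqP s03]]|no3] := boolP [exists s in L, #|s| == 3%N]; last first.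
  apply: graph_buildable => // s sL.
  rewrite -ltnS ltn_neqAle (layered_card L2 Lcl sL) andbT.
  by apply: contra no3 => s3; apply/existsP; exists s; rewrite sL.
have [|e [t [tL t3 et e2 free]]] := layered_free_face L2 Lcl; first by exists s0.
pose L' := (L :\ e :\ t)%SET.
have eL : e \in L by exact: Lcl tL et.
have ne_et : e != t by apply: contra_eq_neq e2 => ->; rewrite t3.
have LE : L = (e |: (t |: L'))%SET.
  by rewrite /L' setD1K ?inE ?tL ?andbT ?setD1K // eq_sym.
have L'cl : down_closed L'.
  move=> r q; rewrite !inE => /and3P[rt re rL] qr; have qL := Lcl _ _ rL qr.
  rewrite qL andbT; apply/andP; split.
    apply: contraNneq rt => qt; case: (free r rL) => [|rE|->//].
      by apply: subset_trans et _; rewrite -qt.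
    by rewrite rE eqxx in re.
  apply: contraNneq re => qe; case: (free r rL) => [|->//|rE].
    by rewrite -qe.
  by rewrite rE eqxx in rt.
have L'L : L' \subset L by apply: subset_trans (subsetDl _ _) (subsetDl _ _).
have : buildable ok_graph (point w) L'.
  apply: IH => //; last 2 first.
  - exact: layeredS L'L L2.
  - rewrite !inE wL andbT; apply/andP; split.
      by apply: contra_eq_neq t3 => <-; rewrite cards1.
    by apply: contra_eq_neq e2 => <-; rewrite cards1.
  apply: leq_trans Ln; apply: proper_card; apply/properP; split => //.
  by exists t; rewrite // !inE eqxx.
move=> bL'; rewrite LE; apply: Build_pair => //.
- by rewrite !inE eqxx andbF.
- by rewrite !inE eqxx.
- by rewrite t3 e2.
- by rewrite -LE; exact: face_closedW.
Qed.

End Buildable.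

(** * Non-evasiveness of acyclic planar complexes *)

Section NonEvasive.
Variables (R : realDomainType) (V : finType).
Implicit Types (v w x y : V) (s t : {set V}) (c z : simplicial_chain V).
Implicit Types (C D K L G M : {set {set V}}) (h : V -> R).

Lemma link_sub_del D v : down_closed D -> link D v \subset deletion D v.
Proof.
move=> Dcl; apply/subsetP => s; rewrite !inE => /andP[-> sD]; rewrite andbT.
exact: Dcl sD (subsetUr _ _).
Qed.

Lemma del_sub D v : deletion D v \subset D.
Proof. by apply/subsetP => s; rewrite inE => /andP[]. Qed.

Lemma chain_del_link v c D : supported c (link D v) -> chain_del v c = c.
Proof. by move/chain_del_supported; apply=> s; rewrite inE => /andP[]. Qed.

Lemma chain_del_del v c D : supported c (deletion D v) -> chain_del v c = c.
Proof. by move/chain_del_supported; apply=> s; rewrite inE => /andP[]. Qed.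

(* Mayer-Vietoris for [D = deletion D v \cup star v]: as [D] is acyclic, the
   homology of the link injects into that of the deletion. *)
Lemma bounds_link_of_del D v z : down_closed D -> acyclic D ->
  supported z (link D v) -> bd z = 0 -> bounds (deletion D v) z -> bounds (link D v) z.
Proof.
move=> Dcl Dac zL bz [y yD byz].
have vz := chain_del_link zL; have vy := chain_del_del yD.
have [||u uD bu] := Dac (cone v z + y).
- apply: supportedD; first exact: supported_cone.
  exact: supportedS (del_sub _ _) yD.
- by rewrite linearD /= bd_cone // bz cone0 addr0 byz addFF.
exists (chain_link v u); first exact: supported_chain_link.
by rewrite -chain_link_bd bu chain_linkD chain_link_cone vz -vy chain_link_del addr0.
Qed.

Lemma acyclic_link D v : down_closed D -> acyclic D -> acyclic (deletion D v) ->
  acyclic (link D v).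
Proof.
move=> Dcl Dac delac z zL bz; apply: bounds_link_of_del => //.
by apply: delac => //; apply: supportedS zL; exact: link_sub_del.
Qed.

(** Fill z by u in D. Since z avoids v, the link of u at v is a cycle; a filling of it inside the
    link replaces the part of u through v. *)
Lemma acyclic_del D v : down_closed D -> acyclic D -> acyclic (link D v) ->
  acyclic (deletion D v).
Proof.
move=> Dcl Dac lac z zD bz.
have [|u uD bu] := Dac z _ bz; first exact: supportedS (del_sub _ _) zD.
have vz := chain_del_del zD.
have [||w wL bw] := lac (chain_link v u); first exact: supported_chain_link.
  by rewrite -chain_link_bd bu -vz chain_link_del.
exists (w + chain_del v u).
  apply: supportedD; last exact: supported_chain_del.
  by apply: supportedS wL; exact: link_sub_del.
by rewrite linearD /= bw -chain_del_bd bu.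
Qed.

Lemma acyclic_cone D w : (forall s, s \in D -> (w |: s)%SET \in D) -> acyclic D.
Proof.
move=> Dw z zD bz; exists (cone w (chain_del w z)).
  move=> s sD; rewrite !ffunE; case: ifP => // ws; rewrite !inE eqxx /=.
  by apply: zD; apply: contra sD => /Dw; rewrite setD1K.
rewrite bd_cone ?chain_del_id //.
have := chain_del_bd w z; rewrite bz chain_del0 => /esym/eqP.
rewrite addr_eq0 oppFF => /eqP <-.
by rewrite addrC -chain_decomp.
Qed.

Lemma acyclic_point w : acyclic (point w).
Proof.
apply: (@acyclic_cone _ w) => s; rewrite !in_set2 => /orP[]/eqP->.
  by rewrite setU0 eqxx orbT.
by rewrite setUid eqxx orbT.
Qed.

Lemma bounds_homog0 D w z : down_closed D -> [set w]%SET \in D -> bounds D (homog 0 z).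
Proof.
move=> Dcl wD; apply: (@boundsS _ (point w)).
  by rewrite subUset !sub1set wD (Dcl _ _ wD (sub0set _)).
apply: acyclic_point; last exact: bd_homog0.
move=> s sp; rewrite ffunE cards_eq0; case: eqP => // s0.
by move: sp; rewrite s0 !inE eqxx.
Qed.

Lemma supported_homog j c D : supported c D -> supported (homog j c) D.
Proof. by move=> cD s sD; rewrite ffunE cD // if_same. Qed.

Lemma homog_cycle j z : bd z = 0 -> bd (homog j z) = 0.
Proof.
case: j => [_|j bz]; first exact: bd_homog0.
by rewrite bd_homog bz; apply/ffunP => t; rewrite !ffunE if_same.
Qed.

Lemma homogK j c : homog j (homog j c) = homog j c.
Proof. by apply/ffunP => t; rewrite !ffunE; case: (_ == j). Qed.

Lemma homog_card j c s : homog j c s != 0 -> #|s| = j.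
Proof. by rewrite ffunE; case: ifP => [/eqP|]; rewrite ?eqxx. Qed.

Lemma bounds_homog D z : (forall j, bounds D (homog j z)) -> bounds D z.
Proof. by move=> Dz; rewrite (homog_sum z); apply: bounds_sum => i _. Qed.

Lemma acyclic_vertex D : set0 \in D -> acyclic D -> exists v, v \in vertices D.
Proof.
move=> D0 Dac; have [||u uD bu] := Dac (cell set0); first exact: supported_cell.
  by rewrite bd_cell big_set0.
have := congr1 (fun b : simplicial_chain V => b set0) bu; rewrite !ffunE eqxx => E.
have [/existsP[v vD]|noD] := boolP [exists v, v \in vertices D]; first by exists v.
move: E; rewrite big1 => [/eqP|x _]; first by rewrite eq_sym oner_eq0.
by rewrite setU0 uD //; apply: contra noD => xD; apply/existsP; exists x; rewrite inE.
Qed.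

(** Connectedness: an isolated v could not be joined to another vertex y. *)
Lemma acyclic_neighbor D v : acyclic D -> v \in vertices D -> (1 < #|vertices D|)%N ->
  exists w, [set w]%SET \in link D v.
Proof.
move=> Dac vD; rewrite (cardsD1 v) vD ltnS card_gt0 => /set0Pn[y].
rewrite !inE => /andP[yv yD].
have [/existsP[w wL]|now] := boolP [exists w, [set w]%SET \in link D v]; first by exists w.
rewrite inE in vD.
case: (@not_bounds_separated _ D [set v]%SET y v) => //.
- by rewrite inE.
- by rewrite inE.
- move=> x q; rewrite inE => /eqP -> qv; apply: contra now => vqD.
  by apply/existsP; exists q; rewrite !inE vqD andbT eq_sym -in_set1.
apply: Dac; first by apply: supportedD; exact: supported_cell.
by rewrite linearD /= !bd_cell1 addFF.
Qed.

Lemma face_sub_vertices D s : down_closed D -> s \in D -> s \subset vertices D.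
Proof. by move=> Dcl sD; apply/subsetP => x; exact: mem_vertices. Qed.

Lemma non_evasive1 D : down_closed D -> #|vertices D| = 1%N -> non_evasive D.
Proof.
move=> Dcl D1; apply: NonEvasive_point => //; apply/eqP; rewrite eqn_leq; apply/andP; split.
  apply/bigmax_leqP => s sD; rewrite -D1; apply: subset_leq_card.
  exact: face_sub_vertices.
have /eqP/cards1P[v vE] := D1.
have vD : v \in vertices D by rewrite vE set11.
rewrite inE in vD.
by apply: leq_trans (leq_bigmax_cond _ vD); rewrite cards1.
Qed.

Lemma non_evasive_step D v : acyclic D -> (1 < #|vertices D|)%N ->
  v \in vertices D -> non_evasive (link D v) -> non_evasive (deletion D v) -> non_evasive D.
Proof.
move=> Dac D1 vD lne dne; apply: (@NonEvasive_step _ D v _ vD lne dne).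
have [w] := acyclic_neighbor Dac vD D1; rewrite inE => /andP[vw vwD].
by apply: leq_trans (leq_bigmax_cond _ vwD); rewrite cardsU1 vw cards1.
Qed.

Lemma acyclic_single_or D : set0 \in D -> acyclic D ->
  #|vertices D| = 1%N \/ (1 < #|vertices D|)%N.
Proof.
move=> D0 Dac; have [v vD] := acyclic_vertex D0 Dac.
have: (0 < #|vertices D|)%N by apply/card_gt0P; exists v.
by rewrite leq_eqVlt => /orP[/eqP <-|]; [left|right].
Qed.

Lemma link_upper h D v : down_closed D -> {in vertices D, forall u, u != v -> h v < h u} ->
  link D v = upper_link h D v.
Proof.
move=> Dcl hv; apply/eqP; rewrite eqEsubset andbC; apply/andP; split.
  by apply/subsetP => s; rewrite inE => /andP[].
apply/subsetP => s; rewrite inE => /andP[vs sD]; apply/upper_linkP; split => // u us.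
apply: hv; first by apply: mem_vertices sD _ => //; rewrite setU1r.
by apply: contraNneq vs => <-.
Qed.

Lemma vertices_del D v : vertices (deletion D v) = (vertices D :\ v)%SET.
Proof. by apply/setP => x; rewrite !inE andbC eq_sym. Qed.

Lemma link0 D v : v \in vertices D -> set0 \in link D v.
Proof. by rewrite !inE setU0. Qed.

(** Such a D is a path. The lowest vertex has at most one neighbour because its upper link is
    layered in dimension 0, and at least one by connectedness, so it is a leaf. *)
Lemma layered1_non_evasive D : layered R 1 D -> down_closed D -> set0 \in D ->
  acyclic D -> non_evasive D.
Proof.
have [n] := ubnP #|vertices D|; elim: n D => // n IH D; rewrite ltnS => Dn D1 Dcl D0 Dac.
case: (acyclic_single_or D0 Dac) => [|V1]; first exact: non_evasive1.
have [h [hinj hD]] := D1.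
have VD0 : vertices D != set0 by rewrite -card_gt0 ltnW.
have [v vD vmin] := exists_min hinj VD0.
have [up _] := hD v vD; rewrite -link_upper // in up.
have [w wL] := acyclic_neighbor Dac vD V1.
have lcl := @down_closed_link _ _ v Dcl.
have VL : vertices (link D v) = [set w]%SET.
  apply/esym/eqP; rewrite eqEcard sub1set inE wL /= cards1.
  exact: up.
have lac : acyclic (link D v).
  apply: (@acyclic_cone _ w) => s sL.
  have := face_sub_vertices lcl sL; rewrite VL subset1 => /orP[]/eqP->.
    by rewrite setUid.
  by rewrite setU0.
apply: (non_evasive_step Dac V1 vD).
  by apply: non_evasive1; rewrite ?VL ?cards1.
apply: IH.
- by apply: leq_trans Dn; rewrite vertices_del [X in (_ < X)%N](cardsD1 v) vD.
- exact: layeredS (del_sub _ _) D1.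
- exact: down_closed_del.
- by rewrite !inE D0.
- exact: acyclic_del.
Qed.

(** * Induced subcomplexes and cut vertices *)

Definition induced D (A : {set V}) : {set {set V}} := [set s in D | s \subset A]%SET.

Lemma induced_sub D A : induced D A \subset D.
Proof. by apply/subsetP => s; rewrite inE => /andP[]. Qed.

Lemma down_closed_induced D A : down_closed D -> down_closed (induced D A).
Proof.
move=> Dcl s t; rewrite !inE => /andP[sD sA] ts.
by rewrite (Dcl _ _ sD ts) (subset_trans ts).
Qed.

(* If removing [v] separates [B] from the other vertices, then collapsing
   those onto [v] retracts [D] onto the subcomplex induced on [v |: B]. *)
Lemma acyclic_induced_separated D v (B : {set V}) : down_closed D -> acyclic D ->
  v \in vertices D ->
  (forall s, s \in D -> s \subset (v |: B)%SET \/ s :&: B = set0) ->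
  acyclic (induced D (v |: B)).
Proof.
move=> Dcl Dac vD sep z zB bz.
have [|u uD bu] := Dac z _ bz; first exact: supportedS (induced_sub _ _) zB.
pose uB := restrict (fun s => s \subset (v |: B)%SET) u.
have uBB : supported uB (induced D (v |: B)) by exact: supported_restrict.
have pB : point v \subset induced D (v |: B).
  rewrite inE in vD; rewrite subUset !sub1set !inE vD sub0set (Dcl _ _ vD (sub0set _)).
  by rewrite sub1set setU11.
(* What [uB] fails to fill is the boundary of the rest of u. That boundary lives on faces common to
   both sides, hence on v and the empty face, and a cycle there bounds. *)
suff: bounds (induced D (v |: B)) (bd (u + uB)).
  move=> /boundsD /(_ (ex_intro2 _ _ uB uBB erefl)).
  by rewrite linearD /= -addrA addFF addr0 bu.
apply: boundsS pB _; apply: acyclic_point; last exact: bdbd.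
move=> t; apply: contraNeq => bt.
have tB : t \subset (v |: B)%SET.
  apply: contraNT bt => tB; rewrite linearD /= bu ffunE zB ?inE ?(negbTE tB) ?andbF //.
  by rewrite (supported_bd (down_closed_induced Dcl) uBB) ?addr0 // inE (negbTE tB) andbF.
have [x [xt xD xB]] : exists x, [/\ x \notin t, (x |: t)%SET \in D &
    ~~ ((x |: t)%SET \subset (v |: B)%SET)].
  have [/existsP[x /and3P[? ? ?]]|none] := boolP [exists x, [&& x \notin t,
    (x |: t)%SET \in D & ~~ ((x |: t)%SET \subset (v |: B)%SET)]]; first by exists x.
  case/eqP: bt; rewrite ffunE big1 // => x xt; rewrite !ffunE.
  case: ifPn => [_|xB]; first by rewrite addFF.
  rewrite addr0; apply: uD; apply: contra none => xD.
  by apply/existsP; exists x; rewrite xt xD xB.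
case: (sep _ xD) => [E|E]; first by rewrite E in xB.
suff : t \subset [set v]%SET by rewrite subset1 !inE orbC.
apply/subsetP => y yt; have := subsetP tB y yt; rewrite !inE => /orP[//|yB].
by have := in_set0 y; rewrite -E !inE yt yB orbT.
Qed.

(** In dimension one [layered_top_cycle] leaves only connectedness to be checked. *)
Lemma acyclic_graph_link L w : layered R 1 L -> down_closed L -> [set w]%SET \in L ->
  (forall x, [set x]%SET \in L -> bounds L (cell [set x]%SET + cell [set w]%SET)) ->
  acyclic L.
Proof.
move=> L1 Lcl wL conn z zL bz; apply: bounds_homog => -[|[|j]].
- exact: bounds_homog0 wL.
(* The coefficients of a reduced 0-cycle sum to zero, so w may be added to each vertex for free. *)
- have zE : homog 1 z = \sum_(t : V) z [set t]%SET *: (cell [set t]%SET + cell [set w]%SET).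
    rewrite (eq_bigr (fun t : V => z [set t]%SET *: cell [set t]%SET
                             + z [set t]%SET *: cell [set w]%SET)); last first.
      by move=> t _; rewrite scalerDr.
    rewrite big_split /= -scaler_suml.
    have -> : \sum_(t : V) z [set t]%SET = 0.
      have := congr1 (fun b : simplicial_chain V => b set0) bz; rewrite !ffunE => E; rewrite -[RHS]E.
      by apply: eq_big => [x|x _]; rewrite ?inE // setU0.
    rewrite scale0r addr0; apply/ffunP => s; rewrite sum_ffunE ffunE.
    case: ifPn => [/cards1P[x ->]|s1].
      rewrite (bigD1 x) //= !ffunE eqxx big1 ?addr0 => [|y yx]; first by rewrite /GRing.scale /= mulr1.
      by rewrite !ffunE (inj_eq set1_inj) eq_sym (negbTE yx) scaler0.
    rewrite big1 // => y _; rewrite !ffunE; case: eqP => [sE|]; last by rewrite scaler0.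
    by rewrite sE cards1 in s1.
  rewrite zE; apply: bounds_sum => t _.
  have [tL|tL] := boolP ([set t]%SET \in L); last by rewrite zL // scale0r; exact: bounds0.
  have [u uL bu] := conn _ tL; exists (z [set t]%SET *: u); last by rewrite linearZ /= bu.
  by move=> s sL; rewrite ffunE uL // scaler0.
- rewrite (_ : homog _ z = 0); first exact: bounds0.
  apply: (layered_top_cycle L1 Lcl); first exact: supported_homog.
    exact: homog_cycle.
  by move=> s /homog_card ->.
Qed.

(** The forbidden vertex x makes the recursion work. In the part cut off by a cut vertex v, links
    agree with those of D except at v, so v is the vertex forbidden there. Two extreme vertices are
    needed because one of them may be x. *)
Lemma exists_good_vertex D x : layered R 2 D -> down_closed D -> set0 \in D ->
  acyclic D -> (1 < #|vertices D|)%N ->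
  exists v, [/\ v \in vertices D, v != x, acyclic (link D v) & layered R 1 (link D v)].
Proof.
have [n] := ubnP #|vertices D|; elim: n D x => // n IH D x.
rewrite ltnS => Dn D2 Dcl D0 Dac V1.
have [h [hinj hD]] := D2.
have VD0 : vertices D != set0 by rewrite -card_gt0 ltnW.
have [a aD amin] := exists_min hinj VD0.
have hinjN : {in vertices D &, injective (fun u => - h u)}.
  by move=> p q pD qD /oppr_inj; exact: hinj.
have [b bD bmax] := exists_min hinjN VD0.
have ab : a != b.
  move: V1; rewrite (cardsD1 a) aD ltnS card_gt0 => /set0Pn[y].
  rewrite !inE => /andP[ya yD]; apply: contraNneq ya => E; apply: contraT => ya.
  have := amin y; rewrite inE => /(_ yD ya) => /lt_trans.
  have := bmax y; rewrite inE -E => /(_ yD ya); rewrite ltrN2 => yh /(_ _ yh).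
  by rewrite ltxx.
have [v [vD vx L1]] : exists v, [/\ v \in vertices D, v != x & layered R 1 (link D v)].
  have [ax|ax] := eqVneq a x.
    exists b; split; rewrite // -?ax 1?eq_sym //.
    by rewrite (link_upper Dcl bmax); have [] := hD b bD.
  by exists a; split; rewrite // (link_upper Dcl amin); have [] := hD a aD.
have [lac|nlac] := pselect (acyclic (link D v)); first by exists v.
have lcl := @down_closed_link _ _ v Dcl.
have dcl := @down_closed_del _ _ v Dcl.
have [w wL] := acyclic_neighbor Dac vD V1.
(* If all neighbours of v stayed connected after deleting v, then [bounds_link_of_del] would connect
   them inside the link and make it acyclic. *)
have [t tL tw] : exists2 t : V, [set t]%SET \in link D v &
    ~ bounds (deletion D v) (cell [set t]%SET + cell [set w]%SET).
  apply: contrapT => none; apply: nlac; apply: (acyclic_graph_link L1 lcl wL) => t tL.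
  apply: bounds_link_of_del => //.
  - by apply: supportedD; exact: supported_cell.
  - by rewrite linearD /= !bd_cell1 addFF.
  - by apply: contrapT => tw; apply: none; exists t.
set E := deletion D v in dcl tw *.
(* This base point ensures that B, the vertices not joined to q in the deletion, does not contain
   x. *)
pose q := if x \in vertices E then x else w.
have lE y : [set y]%SET \in link D v -> y \in vertices E.
  by move=> yL; rewrite inE; apply: (subsetP (link_sub_del v Dcl)).
have qE : q \in vertices E by rewrite /q; case: ifP => // _; exact: lE.
pose conn y := `[< bounds E (cell [set y]%SET + cell [set q]%SET) >].
pose B := [set y in vertices E | ~~ conn y]%SET.
have adj y y' : conn y -> y \in vertices E -> [set y; y']%SET \in E -> conn y'.
  move=> /asboolP yq yE yyE; apply/asboolP.
  rewrite (addFF_mid _ (cell [set y]%SET)); apply: boundsD => //.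
  have [->|ne] := eqVneq y y'; first by rewrite addFF; exact: bounds0.
  by rewrite addrC -bd_cell2 //; exists (cell [set y; y']%SET) => //; exact: supported_cell.
have qB : q \notin B.
  by rewrite inE qE negbK; apply/asboolP; rewrite addFF; exact: bounds0.
have xB : x \notin B.
  by have [xE|xE] := boolP (x \in vertices E); [move: qB; rewrite /q xE|rewrite inE (negbTE xE)].
have B0 : exists y, y \in B.
  apply: contrapT => noB; apply: tw.
  have cE y : y \in vertices E -> bounds E (cell [set y]%SET + cell [set q]%SET).
    move=> yE; apply: contrapT => ny; apply: noB; exists y; rewrite inE yE.
    by apply/negP => /asboolP.
  rewrite (addFF_mid _ (cell [set q]%SET)); apply: boundsD; first exact/cE/lE.
  by rewrite addrC; exact/cE/lE.
have vB : v \notin B by rewrite inE vertices_del !inE eqxx.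
have sepB s y : s \in D -> y \in s -> y \in B -> s \subset (v |: B)%SET.
  move=> sD ys yB; apply/subsetP => u us; rewrite in_setU1.
  have [//|uv] := eqVneq u v; rewrite /=.
  have uE : u \in vertices E by rewrite vertices_del !inE uv (Dcl _ _ sD) // sub1set.
  rewrite inE uE /=; apply/negP => /adj /(_ uE) => /(_ y).
  have -> : [set u; y]%SET \in E.
    rewrite inE (Dcl _ _ sD) ?subUset ?sub1set ?us ?ys //= !inE negb_or eq_sym uv.
    by apply: contraNneq vB => ->.
  by move=> /(_ isT); apply/negP; move: yB; rewrite inE => /andP[].
pose D' := induced D (v |: B).
have D'cl : down_closed D' by exact: down_closed_induced.
have VD' : vertices D' = (v |: B)%SET.
  apply/setP => y; rewrite inE inE sub1set; case: (boolP (y \in (v |: B)%SET)) => [|_]; last by rewrite andbF.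
  rewrite andbT in_setU1 => /orP[/eqP->|]; first by rewrite inE in vD.
  by rewrite inE vertices_del => /andP[]; rewrite !inE => /andP[].
have D'ac : acyclic D'.
  apply: acyclic_induced_separated => // s sD.
  have [|/set0Pn[y]] := eqVneq (s :&: B)%SET set0; first by right.
  by rewrite inE => /andP[ys yB]; left; exact: sepB ys yB.
have [||||||u [uD' uv ulac ul1]] := IH D' v.
- apply: leq_trans Dn; apply: proper_card; apply/properP; split.
    exact: verticesS (induced_sub _ _).
  have qv : q != v by move: qE; rewrite vertices_del !inE => /andP[].
  exists q; first by move: qE; rewrite vertices_del => /setD1P[].
  by rewrite VD' in_setU1 negb_or qv.
- exact: layeredS (induced_sub _ _) D2.
- exact: D'cl.
- by rewrite inE D0 sub0set.
- exact: D'ac.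
- by rewrite VD' cardsU1 vB; apply/card_gt0P.
have uB : u \in B by move: uD'; rewrite VD' in_setU1 (negbTE uv).
have luE : link D' u = link D u.
  apply/setP => s; rewrite !inE; case: (boolP (u \in s)) => //= us.
  have [sD|//] := boolP ((u |: s)%SET \in D).
  by apply: sepB sD _ uB; rewrite setU11.
exists u; split; rewrite -?luE //.
  by move: uD'; apply: (subsetP (verticesS (induced_sub _ _))).
by apply: contraNneq xB => <-.
Qed.

Lemma layered2_non_evasive D : layered R 2 D -> down_closed D -> set0 \in D ->
  acyclic D -> non_evasive D.
Proof.
have [n] := ubnP #|vertices D|; elim: n D => // n IH D; rewrite ltnS => Dn D2 Dcl D0 Dac.
case: (acyclic_single_or D0 Dac) => [|V1]; first exact: non_evasive1.
have [x _] := acyclic_vertex D0 Dac.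
have [v [vD _ lac l1]] := exists_good_vertex x D2 Dcl D0 Dac V1.
apply: (non_evasive_step Dac V1 vD).
  apply: layered1_non_evasive => //; first exact: down_closed_link.
  exact: link0.
apply: IH.
- by apply: leq_trans Dn; rewrite vertices_del [X in (_ < X)%N](cardsD1 v) vD.
- exact: layeredS (del_sub _ _) D2.
- exact: down_closed_del.
- by rewrite !inE D0.
- exact: acyclic_del.
Qed.

End NonEvasive.

(** * Sweeping a complex by a height function *)

Section MorseHeight.
Variables (R : realDomainType) (V : finType).
Implicit Types (v w x y : V) (s t : {set V}) (c z : simplicial_chain V).
Implicit Types (C D K L G M : {set {set V}}) (A B : {set V}) (h : V -> R).

(* A face whose boundary already bounds creates a homology class; vertices are
   apart because the empty face is not in [D]. *)
Definition ok_perfect D s : Prop := #|s| = 1%N \/ bounds D (bd (cell s)).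

(** Each step building the link is coned with v, on top of the deletion. The starting point w, with
    its empty face, becomes the pair made of v and the edge from v to w. Tightness will enter
    through the hypothesis on cycles of the link. *)
Lemma cone_buildable C v w : down_closed C -> [set w]%SET \in link C v ->
  buildable (@ok_graph V) (point w) (link C v) ->
  (forall j z, (0 < j <= 2)%N -> supported z (link C v) -> homog j z = z -> bd z = 0 ->
     bounds (deletion C v) z) ->
  buildable ok_perfect set0 (nonempty_faces (deletion C v)) ->
  buildable ok_perfect set0 (nonempty_faces C).
Proof.
move=> Ccl wL Lbuild fill Kbuild.
set K := nonempty_faces (deletion C v) in Kbuild.
pose lift M := (K :|: [set v |: s | s in M])%SET.
have vw : v \notin [set w]%SET by have := wL; rewrite [_ \in link _ _]inE; case/andP.
have vL s : s \in link C v -> v \notin s by rewrite inE => /andP[].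
have vC s : s \in link C v -> (v |: s)%SET \in C by rewrite inE => /andP[].
have lcl := @down_closed_link _ _ v Ccl.
have l0 : set0 \in link C v by exact: lcl wL (sub0set _).
have liftC : lift (link C v) = nonempty_faces C.
  apply/setP => t; rewrite !inE; apply/idP/idP.
    case/orP => [/and3P[-> -> _] //|/imsetP[s /vC sC ->]].
    by rewrite sC andbT; apply/set0Pn; exists v; rewrite setU11.
  case/andP => -> tC; rewrite tC /=; case: (boolP (v \in t)) => //= vt.
  by apply/imsetP; exists (t :\ v)%SET; rewrite ?setD1K // !inE eqxx /= setD1K.
have liftU s M : lift (s |: M)%SET = ((v |: s)%SET |: lift M)%SET.
  by rewrite /lift imsetU1 setUCA.
have liftN s M : s \in link C v -> M \subset link C v -> s \notin M ->
    (v |: s)%SET \notin lift M.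
  move=> sL /subsetP ML sM; rewrite !inE eqxx /= !andbF /=.
  apply: contra sM => /imsetP[q qM E]; suff -> : s = q by [].
  by rewrite -(setU1K (vL _ sL)) E setU1K // vL // ML.
have liftcl M : M \subset link C v -> face_closed M -> set0 \in M -> face_closed (lift M).
  move=> /subsetP ML Mcl M0 s t; rewrite !inE => /orP[/and3P[_ sC vs]|/imsetP[q qM ->]] ts t0.
    rewrite t0 (Ccl _ _ sC ts) /= (contra (subsetP ts v)) //.
  have qL := ML _ qM.
  rewrite t0 (Ccl _ _ (vC _ qL) ts) /=; case: (boolP (v \in t)) => //= vt.
  apply/imsetP; exists (t :\ v)%SET; last by rewrite setD1K.
  have tq : (t :\ v)%SET \subset q.
    by rewrite subDset.
  have [->//|tn0] := eqVneq (t :\ v)%SET set0.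
  exact: Mcl qM tq tn0.
suff H M : buildable (@ok_graph V) (point w) M -> M \subset link C v ->
    buildable ok_perfect set0 (lift M).
  by rewrite -liftC; exact: H.
have pcl : face_closed (point w).
  move=> s t; rewrite !inE => /orP[]/eqP->; first by rewrite subset0 => ->.
  by rewrite subset1 orbC.
elim=> {M} [|M s bM IH sM Mcl [s2 oks]|M s t bM IH sM tM st ts Mcl] ML.
- have -> : lift (point w) = ((v |: set0)%SET |: ((v |: [set w])%SET |: K))%SET.
    by rewrite /lift imsetU1 imset_set1 setUC -setUA.
  apply: Build_pair => //.
  + by rewrite !inE eqxx /= ?orbT /= !andbF.
  + by rewrite !inE eqxx /= ?orbT /= !andbF.
  + exact/setUS/sub0set.
  + by rewrite setU0 cards1 cardsU1 vw cards1.
  + have <- : lift (point w) = ((v |: set0)%SET |: ((v |: [set w])%SET |: K))%SET.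
      by rewrite /lift imsetU1 imset_set1 setUC -setUA.
    by apply: liftcl => //; rewrite !inE eqxx.
- have sML : s \in link C v by apply: (subsetP ML); rewrite setU11.
  have ML' : M \subset link C v by apply: subset_trans ML; exact: subsetUr.
  have M0 : set0 \in M.
    by apply: (subsetP (buildable_base bM)); rewrite !inE eqxx.
  have vs := vL _ sML.
  have s0 : s != set0 by apply: contraNneq sM => ->.
  rewrite liftU; apply: Build_critical; [exact: IH|exact: liftN| |].
    rewrite -liftU; apply: liftcl => //.
    by rewrite in_setU1 M0 orbT.
  right; case: oks => u uM bu.
  case sj: #|s| => [|j]; first by move/eqP: sj; rewrite cards_eq0 (negbTE s0).
  (* The filling u need not be homogeneous, while tightness is available one degree at a time. *)
  pose z := homog j.+1 (cell s + u).
  have cs : homog j.+1 (cell s) = cell s.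
    by apply/ffunP => t; rewrite !ffunE; case: (eqVneq t s) => [->|_]; rewrite ?sj ?eqxx // if_same.
  have zE : z = cell s + homog j.+1 u.
    by rewrite -[in RHS]cs /z; apply/ffunP => t; rewrite !ffunE; case: (_ == j.+1); rewrite ?addr0.
  have uL : supported u (link C v) := supportedS ML' uM.
  have zL : supported z (link C v).
    by apply: supported_homog; apply: supportedD => //; exact: supported_cell.
  have bz : bd z = 0 by apply: homog_cycle; rewrite linearD /= bu addFF.
  have [||y yD by_] := fill j.+1 z _ zL _ bz; first by rewrite /= -sj.
    exact: homogK.
  have zv : chain_del v z = z by exact: chain_del_link zL.
  (* Write u' for the component of u used in z. The cone over s is v * z + v * u', and z is the
     boundary of both v * z and y, so v * u' + y has the same boundary as the cone over s and avoids
     that face. *)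
  exists (cone v (homog j.+1 u) + homog j.+2 y).
    apply: supportedD.
      move=> t; rewrite !inE negb_or => /andP[_ tM].
      rewrite !ffunE; case: ifP => // vt; case: ifP => // _; apply: uM.
      by apply: contra tM => tM; apply/imsetP; exists (t :\ v)%SET; rewrite ?setD1K.
    move=> t; rewrite 2!inE negb_or => /andP[tK _]; rewrite ffunE.
    case: ifP => // tj; apply: yD; apply: contra tK => tD.
    by rewrite in_set1 tD andbT -card_gt0 (eqP tj).
  have zz : homog j.+1 z = z by exact: homogK.
  rewrite linearD /= bd_homog by_ zz -(cone_cell vs).
  have -> : cell s = z + homog j.+1 u by rewrite zE -addrA addFF addr0.
  by rewrite coneD [in RHS]linearD /= (bd_cone zv) bz cone0 addr0 addrC.
- have stL q : q \in (s |: (t |: M))%SET -> q \in link C v by move/(subsetP ML).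
  have sL : s \in link C v by apply: stL; rewrite setU11.
  have tL : t \in link C v by apply: stL; rewrite setU1r // setU11.
  have ML' : M \subset link C v by apply/subsetP => q qM; apply: stL; rewrite !setU1r.
  have M0 : set0 \in M.
    by apply: (subsetP (buildable_base bM)); rewrite !inE eqxx.
  rewrite !liftU; apply: Build_pair; [exact: IH|exact: liftN|exact: liftN| | |].
  + exact: setUS.
  + by rewrite !cardsU1 (vL _ sL) (vL _ tL) ts.
  + rewrite -!liftU; apply: liftcl => //.
    by rewrite !setU1r.
Qed.

(** * Tightness and the part above a level *)

Definition above h C (a : R) : {set {set V}} :=
  [set s in C | [forall u in s, a < h u]]%SET.

Lemma aboveP h C a s : reflect (s \in C /\ {in s, forall u, a < h u}) (s \in above h C a).
Proof.
by rewrite inE; apply: (iffP andP) => -[sC /'forall_implyP sa].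
Qed.

(** All that the combinatorial argument retains of tightness. The cardinalities 1 and 2 are the
    degrees 0 and 1, and z is a cycle because it bounds in C. *)
Definition height_tight h C : Prop := forall a j z, (0 < j <= 2)%N ->
  supported z (above h C a) -> homog j z = z -> bounds C z -> bounds (above h C a) z.

Definition links_planar h C : Prop :=
  {in vertices C, forall v, layered R 2 (upper_link h C v)}.

Definition up_closed h C (A : {set V}) : Prop :=
  {in vertices C & A, forall u v, h v < h u -> u \in A}.

(** The level is the height of the highest vertex outside A, if there is one. *)
Lemma up_closed_above h C A : down_closed C -> {in vertices C &, injective h} ->
  A \subset vertices C -> up_closed h C A ->
  induced C A = C \/ exists a, induced C A = above h C a.
Proof.
move=> Ccl hinj /subsetP AV Aup.
have [VA|/set0Pn[x xVA]] := eqVneq (vertices C :\: A)%SET set0.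
  left; apply/eqP; rewrite eqEsubset induced_sub; apply/subsetP => s sC.
  rewrite inE sC; apply: subset_trans (face_sub_vertices Ccl sC) _.
  by rewrite -setD_eq0 VA.
right; have hN : {in (vertices C :\: A)%SET &, injective (fun u => - h u)}.
  by move=> p q; rewrite !inE => /andP[_ pC] /andP[_ qC] /oppr_inj /hinj; apply; rewrite inE.
have [|b] := exists_min hN; first by apply/set0Pn; exists x.
rewrite inE => /andP[bA bV] bmax; exists (h b).
apply/setP => s; rewrite inE; apply/andP/aboveP => -[sC sA]; split=> //.
  move=> u us; have uA := subsetP sA u us; rewrite ltNge; apply: contra (bA) => ub.
  apply: (Aup b u) => //; rewrite lt_neqAle ub andbT.
  by apply: contraNneq bA => E; rewrite (hinj _ _ bV (AV _ uA) (esym E)).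
apply/subsetP => u us; apply: contraT => uA.
have uV : u \in vertices C by exact: mem_vertices us.
have ub := sA u us.
have: u != b by apply: contraTneq ub => ->; rewrite ltxx.
have uVA : u \in (vertices C :\: A)%SET by rewrite inE uA.
by move=> /(bmax u uVA); rewrite ltrN2 => /(lt_trans ub); rewrite ltxx.
Qed.

(** A chain of tetrahedra or larger faces cannot reach below its boundary. If its lowest vertex v
    were not above the level, no boundary face would contain v, so the link of u at v would be a
    cycle of faces with more than two vertices in a planar complex, hence zero. *)
Lemma supported_above h C a u : down_closed C -> {in vertices C &, injective h} ->
  links_planar h C -> supported u C -> supported (bd u) (above h C a) ->
  (forall s, u s != 0 -> (3 < #|s|)%N) -> supported u (above h C a).
Proof.
move=> Ccl hinj hpl uC buA u3 s0 s0A; apply/eqP; apply: contraT => us0.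
have s0C := supported_mem uC us0.
have [x xs0 xa] : exists2 x, x \in s0 & h x <= a.
  have [/existsP[x /andP[xs xa]]|nox] := boolP [exists x, (x \in s0) && (h x <= a)]; first by exists x.
  case/aboveP: s0A; split => // y ys; rewrite ltNge; apply: contra nox => ya.
  by apply/existsP; exists y; rewrite ys ya.
pose A := [set v | [exists s, (u s != 0) && (v \in s)]]%SET.
have AP s v : u s != 0 -> v \in s -> v \in A.
  by move=> cs vs; rewrite inE; apply/existsP; exists s; rewrite cs.
have AV : {subset A <= vertices C}.
  move=> v; rewrite inE => /existsP[s /andP[/(supported_mem uC) sD vs]].
  exact: mem_vertices sD vs.
have xA := AP _ _ us0 xs0.
have A0 : A != set0 by apply/set0Pn; exists x.
have [v vA vmin] := exists_min (sub_in2 AV hinj) A0.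
have va : h v <= a.
  apply: le_trans xa; have [->//|xv] := eqVneq x v.
  exact/ltW/vmin.
have lk0 : chain_link v u = 0.
  apply: (layered_top_cycle (hpl v (AV _ vA)) (down_closed_upper_link Ccl)).
  - apply: supported_upper_link => // s y cs _ ys yv.
    by apply: vmin => //; exact: AP ys.
  - rewrite -chain_link_bd; apply/ffunP => t; rewrite !ffunE; case: ifP => // vt.
    have := buA (v |: t)%SET; rewrite ffunE; apply; apply/negP => /aboveP[_ /(_ v)].
    by rewrite setU11 ltNge va => /(_ isT).
  - move=> t; rewrite ffunE; case: ifPn => [|vt /u3]; first by rewrite eqxx.
    by rewrite cardsU1 vt.
move: vA; rewrite inE => /existsP[s /andP[cs vs]].
have := congr1 (fun b : simplicial_chain V => b (s :\ v)%SET) lk0.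
by rewrite !ffunE !inE eqxx /= setD1K // => E; rewrite E eqxx in cs.
Qed.

(** Three ranges of j: the empty face bounds v; sizes 1 and 2 are handled by tightness; from size 3
    on, a filling in C already lies above the level. *)
Lemma acyclic_above h C a v : down_closed C -> {in vertices C &, injective h} ->
  links_planar h C -> height_tight h C -> acyclic C -> v \in vertices (above h C a) ->
  acyclic (above h C a).
Proof.
move=> Ccl hinj hpl htight Cac vA z zA bz; apply: bounds_homog => j.
have Acl : down_closed (above h C a).
  move=> s t /aboveP[sC sa] ts; apply/aboveP; split; first exact: Ccl ts.
  by move=> u /(subsetP ts) /sa.
have AC : above h C a \subset C by apply/subsetP => s /aboveP[].
have hzA : supported (homog j z) (above h C a) by exact: supported_homog.
have hbz := homog_cycle j bz.
have hzC : bounds C (homog j z) by apply: Cac => //; exact: supportedS hzA.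
have [->|j0] := eqVneq j 0%N; first by apply: (@bounds_homog0 _ _ v) => //; rewrite inE in vA.
have [j2|j3] := leqP j 2; first by apply: (htight a j) => //; [rewrite lt0n j0|exact: homogK].
case: hzC => u uC bu; exists (homog j.+1 u); last by rewrite bd_homog bu homogK.
apply: supported_above => //; first exact: supported_homog.
- by rewrite bd_homog bu homogK.
- by move=> s /homog_card ->.
Qed.

Lemma induced_del C A v : deletion (induced C A) v = induced C (A :\ v).
Proof. by apply/setP => s; rewrite !inE subsetD1 andbA. Qed.

Lemma vertices_induced C A : A \subset vertices C -> vertices (induced C A) = A.
Proof.
move=> /subsetP AV; apply/setP => x; rewrite inE inE sub1set.
by apply/andP/idP => [[]//|xA]; split => //; have := AV x xA; rewrite inE.
Qed.

Lemma up_closed_del_min h C A v : {in vertices C &, injective h} ->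
  A \subset vertices C -> up_closed h C A ->
  v \in A -> {in A, forall u, u != v -> h v < h u} -> up_closed h C (A :\ v).
Proof.
move=> hinj AV Aup vA vmin x y xC; rewrite !inE => /andP[yv yA] yx.
rewrite (Aup x y) // andbT; apply: contraTneq yx => ->.
by rewrite -leNgt ltW // vmin.
Qed.

Lemma induced_link_upper h C A v : down_closed C -> A \subset vertices C ->
  v \in A -> {in A, forall u, u != v -> h v < h u} ->
  link (induced C A) v \subset upper_link h C v.
Proof.
move=> Ccl AV vA vmin; rewrite (@link_upper _ _ h).
- exact/upper_linkS/induced_sub.
- exact: down_closed_induced.
- by rewrite vertices_induced.
Qed.

Section HeightHypotheses.
Variables (h : V -> R) (C : {set {set V}}).
Hypotheses (Ccl : down_closed C) (C0 : set0 \in C).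
Hypothesis hinj : {in vertices C &, injective h}.
Hypotheses (hpl : links_planar h C) (htight : height_tight h C).

Lemma induced_buildable A : A \subset vertices C -> up_closed h C A ->
  buildable ok_perfect set0 (nonempty_faces (induced C A)).
Proof.
have [n] := ubnP #|A|; elim: n A => // n IH A; rewrite ltnS => An AV Aup.
have icl := @down_closed_induced _ _ A Ccl.
have [A0|A0] := eqVneq A set0.
  have -> : nonempty_faces (induced C A) = set0; last exact: Build_base.
  by apply/setP => s; rewrite !inE A0 subset0; case: (_ == _); rewrite /= ?andbF.
have hA : {in A &, injective h} by move=> p q pA qA; apply: hinj; exact: (subsetP AV).
have [v vA vmin] := exists_min hA A0.
have vC := subsetP AV v vA.
have A'V : A :\ v \subset vertices C by apply: subset_trans AV; exact: subsetDl.
have A'up := up_closed_del_min hinj AV Aup vA vmin.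
have bdel : buildable ok_perfect set0 (nonempty_faces (deletion (induced C A) v)).
  rewrite induced_del; apply: IH => //.
  by apply: leq_trans An; rewrite [X in (_ < X)%N](cardsD1 v) vA.
have llay : layered R 2 (link (induced C A) v).
  by apply: layeredS (hpl vC); exact: induced_link_upper.
have lcl := @down_closed_link _ _ v icl.
have [/existsP[w wL]|now] := boolP [exists w, [set w]%SET \in link (induced C A) v].
  apply: (cone_buildable icl wL) => //; first exact: planar_buildable llay lcl wL.
  move=> j z j2 zL zj bz.
  have zdel : supported z (deletion (induced C A) v).
    by apply: supportedS zL; exact: link_sub_del.
  (* The cone over z lies in the star of v; tightness then replaces it by a filling strictly above
     v. *)
  have zC : bounds C z.
    exists (cone v z); last by rewrite bd_cone ?(chain_del_link zL) // bz cone0 addr0.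
    exact: supportedS (induced_sub _ _) (supported_cone zL).
  rewrite induced_del in zdel *.
  have [->//|[a E]] := up_closed_above Ccl hinj A'V A'up.
  rewrite E in zdel *; exact: (htight j2 zdel zj zC).
(* Without a neighbour above it, v starts a new component and is a critical vertex. *)
have vI : v \in vertices (induced C A) by rewrite vertices_induced.
have -> : nonempty_faces (induced C A) =
    ([set v]%SET |: nonempty_faces (deletion (induced C A) v))%SET.
  apply/setP => s; rewrite in_setU1 /nonempty_faces !in_setD1 [in RHS]inE.
  have [->|sv] := eqVneq s [set v]%SET.
    by move: vI; rewrite [v \in _]inE => ->; rewrite andbT; apply/set0Pn; exists v; rewrite inE.
  have [//|s0 /=] := eqVneq s set0.
  have [sI|//] := boolP (s \in induced C A).
  rewrite /=; apply/esym; apply: contra now => vs.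
  have: s :\ v != set0 by rewrite setD_eq0 subset1 negb_or sv.
  case/set0Pn => w ws; apply/existsP; exists w; apply: lcl (s :\ v)%SET _ _ _.
    by rewrite !inE eqxx /= setD1K //; move: sI; rewrite inE.
  by rewrite sub1set.
apply: Build_critical => //.
- by rewrite !inE eqxx !andbF.
- apply: face_closedU.
    move=> s t; rewrite /nonempty_faces !in_setD1 => /andP[_ sD] ts ->.
    exact: (down_closed_del icl) ts.
  by move=> t /proper1 ->; rewrite eqxx.
- by left; rewrite cards1.
Qed.

Lemma induced_non_evasive A : acyclic C -> A \subset vertices C -> up_closed h C A ->
  A != set0 -> non_evasive (induced C A).
Proof.
move=> Cac; have [n] := ubnP #|A|; elim: n A => // n IH A; rewrite ltnS => An AV Aup A0.
have icl := @down_closed_induced _ _ A Ccl.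
have ac B : B \subset vertices C -> up_closed h C B -> B != set0 -> acyclic (induced C B).
  move=> BV Bup /set0Pn[x xB].
  have [->//|[a E]] := up_closed_above Ccl hinj BV Bup.
  rewrite E; apply: (@acyclic_above _ _ _ x) => //.
  by rewrite -E vertices_induced.
have hA : {in A &, injective h} by move=> p q pA qA; apply: hinj; exact: (subsetP AV).
have [v vA vmin] := exists_min hA A0.
have vC := subsetP AV v vA.
have [A1|A1] := eqVneq (A :\ v)%SET set0.
  apply: non_evasive1 => //; rewrite vertices_induced //.
  by rewrite (cardsD1 v) vA A1 cards0.
have A'V : A :\ v \subset vertices C by apply: subset_trans AV; exact: subsetDl.
have A'up := up_closed_del_min hinj AV Aup vA vmin.
have vI : v \in vertices (induced C A) by rewrite vertices_induced.
apply: (@non_evasive_step _ _ v) => //; first exact: ac.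
- by rewrite vertices_induced // (cardsD1 v) vA ltnS card_gt0.
- apply: (@layered2_non_evasive R).
  + by apply: layeredS (hpl vC); exact: induced_link_upper.
  + exact: down_closed_link.
  + exact: link0.
  + by apply: acyclic_link => //; [exact: ac|rewrite induced_del; exact: ac].
- rewrite induced_del; apply: IH => //.
  by apply: leq_trans An; rewrite [X in (_ < X)%N](cardsD1 v) vA.
Qed.

Lemma induced_vertices : induced C (vertices C) = C.
Proof.
apply/eqP; rewrite eqEsubset induced_sub; apply/subsetP => s sC.
by rewrite inE sC face_sub_vertices.
Qed.

Lemma height_buildable : buildable ok_perfect set0 (nonempty_faces C).
Proof. by rewrite -{1}induced_vertices; apply: induced_buildable => // u v. Qed.

Lemma height_non_evasive : acyclic C -> non_evasive C.
Proof.
move=> Cac; rewrite -induced_vertices; apply: induced_non_evasive => //.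
by have [x xC] := acyclic_vertex C0 Cac; apply/set0Pn; exists x.
Qed.

End HeightHypotheses.
End MorseHeight.

(** * Betti numbers and discrete Morse functions *)

Section Homology.
Variable (V : finType).
Implicit Types (v w x y : V) (s t : {set V}) (c z : simplicial_chain V).
Implicit Types (C D K : {set {set V}}).

Lemma bd_cellE s t : bd (cell s) t = ((t \subset s) && (#|s| == #|t|.+1))%:R.
Proof.
rewrite ffunE; case: (boolP (_ && _)) => [/andP[ts /eqP sE]|ne].
  have [x xs] : exists x, (s :\: t = [set x])%SET.
    by apply/cards1P; rewrite cardsD (setIidPr ts) sE subSnn.
  have : x \in (s :\: t)%SET by rewrite xs set11.
  rewrite inE => /andP[xt xs'].
  have sx : (x |: t)%SET = s.
    by apply/eqP; rewrite eqEcard subUset sub1set xs' ts cardsU1 xt sE /=.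
  rewrite (bigD1 x) //= ffunE sx eqxx big1 ?addr0 // => y /andP[yt yx].
  rewrite ffunE; case: eqP => // E; case/negP: yx; rewrite -in_set1 -xs inE yt.
  by rewrite -E setU11.
rewrite big1 // => x xt; rewrite ffunE; case: eqP => // E.
by move: ne; rewrite -E subsetUr cardsU1 xt eqxx.
Qed.

Lemma chain_cells c : c = \sum_s c s *: cell s.
Proof.
apply/ffunP => t; rewrite sum_ffunE (bigD1 t) //= !ffunE eqxx big1 => [|s st].
  by rewrite addr0 /GRing.scale /= mulr1.
by rewrite !ffunE eq_sym (negbTE st) scaler0.
Qed.

Lemma bd_cells c t : bd c t = \sum_s c s * bd (cell s) t.
Proof.
rewrite {1}(chain_cells c) linear_sum sum_ffunE; apply: eq_bigr => s _.
by rewrite linearZ /= ffunE.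
Qed.

Lemma facesP D j s : reflect (s \in D /\ #|s| = j) (s \in faces_of_card D j).
Proof. by rewrite inE; apply: (iffP andP) => -[sD /eqP]. Qed.

Definition face_row_of D j c : 'rV['F_2]_#|faces_of_card D j| :=
  \row_a c (enum_val a).

Lemma boundary_mxE D j a b :
  boundary_mx D j a b = bd (cell (enum_val a)) (enum_val b).
Proof.
rewrite mxE bd_cellE properEcard.
have /facesP[_ ->] := enum_valP a; have /facesP[_ ->] := enum_valP b.
have -> : (j.-1 < j)%N = (j == j.-1.+1) by clear; case: j => //= j; rewrite ltnSn eqxx.
by [].
Qed.

Lemma face_row_mul D j c b : supported c D -> homog j c = c ->
  (face_row_of D j c *m boundary_mx D j) 0 b = bd c (enum_val b).
Proof.
move=> cD cj; rewrite mxE bd_cells.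
rewrite (eq_bigr (fun a : 'I__ => c (enum_val a) * bd (cell (enum_val a)) (enum_val b))).
  rewrite -(big_enum_val (fun s => c s * bd (cell s) (enum_val b))) /= big_mkcond /=.
  apply: eq_bigr => s _; case: ifPn => // /facesP sD.
  have [sD'|sD'] := boolP (s \in D); last by rewrite cD // mul0r.
  rewrite -cj ffunE; case: eqP => [sj|_]; last by rewrite mul0r.
  by case: sD.
by move=> a _; rewrite mxE boundary_mxE.
Qed.

Lemma boundary_mx_row D j a :
  row a (boundary_mx D j.+1) = face_row_of D j (bd (cell (enum_val a))).
Proof. by apply/rowP => b; rewrite !mxE -boundary_mxE mxE. Qed.

Lemma boundary_mx_mul D j : face_closed D -> boundary_mx D j.+1 *m boundary_mx D j = 0.
Proof.
move=> Dcl; apply/row_matrixP => a; rewrite row0 row_mul boundary_mx_row.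
have /facesP[aD aj] := enum_valP a; set s := enum_val a in aD aj *.
(* If D lacks the empty face, the boundary of a vertex leaves D. Restricting loses only that
   coefficient, which no further boundary can see. *)
pose c := restrict (fun t => t \in D) (bd (cell s)).
have cj : homog j c = c.
  apply/ffunP => t; rewrite !ffunE; case: ifPn => // tj; case: ifP => // _.
  by rewrite -[RHS](ffunE (fun t : {set V} => \sum_(x | x \notin t) cell s (x |: t)%SET))
    -/(bd (cell s)) bd_cellE aj eqSS eq_sym (negbTE tj) andbF.
have cD : supported c D by move=> t tD; rewrite ffunE (negbTE tD).
have -> : face_row_of D j (bd (cell s)) = face_row_of D j c.
  by apply/rowP => b; rewrite !mxE [in RHS]ffunE; have /facesP[-> _] := enum_valP b.
apply/rowP => b; rewrite face_row_mul // mxE.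
have := congr1 (fun z : simplicial_chain V => z (enum_val b)) (bdbd (cell s)).
rewrite [in RHS]ffunE => <-; rewrite !ffunE; apply: eq_bigr => x xb.
rewrite ffunE; case: ifPn => // xD; rewrite bd_cellE; case: (boolP (_ \subset _)) => //= xs.
case/negP: xD; apply: Dcl aD xs _; apply/set0Pn; exists x; exact: setU11.
Qed.

(** The image of each boundary matrix lies in the kernel of the next one, and equal ranks make them
    coincide; a preimage row is then read back as a chain. *)
Lemma trivial_homology_acyclic C : down_closed C -> trivial_reduced_homology C -> acyclic C.
Proof.
move=> Ccl Ch z zC bz; apply: bounds_homog => j.
have zjC : supported (homog j z) C by exact: supported_homog.
have bzj := homog_cycle j bz.
have : (face_row_of C j (homog j z) <= boundary_mx C j.+1)%MS.
  apply: submx_trans (_ : (_ <= kermx (boundary_mx C j))%MS) _.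
    apply/sub_kermxP/rowP => b; rewrite face_row_mul ?homogK // bzj ffunE mxE //.
  have im_ker : (boundary_mx C j.+1 <= kermx (boundary_mx C j))%MS.
    by apply/sub_kermxP/boundary_mx_mul/face_closedW.
  have [_ <-] := mxrank_leqif_sup im_ker.
  rewrite eqn_leq mxrankS //=; have := Ch j; rewrite /homology_dim => /eqP.
  by rewrite subn_eq0.
case/submxP => q qE.
pose u := \sum_a q 0 a *: cell (enum_val a : {set V}).
have uC : supported u C.
  apply: supported_sum => a _; have /facesP[aC _] := enum_valP a.
  by move=> s sC; rewrite !ffunE; case: eqP sC => [->|]; rewrite ?aC // scaler0.
have uj : homog j.+1 u = u.
  apply/ffunP => s; rewrite ffunE; case: ifPn => // sj.
  rewrite sum_ffunE big1 // => a _; rewrite !ffunE; case: eqP => [sE|]; last by rewrite scaler0.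
  by have /facesP[_ aj] := enum_valP a; rewrite sE aj eqxx in sj.
have uq : face_row_of C j.+1 u = q.
  apply/rowP => a; rewrite mxE sum_ffunE (bigD1 a) //= !ffunE eqxx big1 => [|b ba].
    by rewrite addr0 /GRing.scale /= mulr1.
  by rewrite !ffunE (inj_eq enum_val_inj) eq_sym (negbTE ba) scaler0.
exists u => //; apply/ffunP => t.
have [tC|tC] := boolP (t \in C); last by rewrite (supported_bd Ccl uC) // zjC.
rewrite -[in LHS]uj bd_homog [LHS]ffunE [RHS]ffunE; case: eqP => // tj.
have tCj : t \in faces_of_card C j by apply/facesP.
have := congr1 (fun r : 'rV_ _ => r 0 (enum_rank_in tCj t)) qE.
by rewrite /= -uq (@face_row_mul C j.+1 u (enum_rank_in tCj t) uC uj) mxE enum_rankK_in // => <-; rewrite ffunE tj eqxx.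
Qed.

(** * The effect of new faces on Betti numbers *)

Definition ambient_row c : 'rV['F_2]_#|{: {set V}}| := \row_t c (enum_val t).

(** The size of [boundary_mx] depends on D. Here its row space sits in a fixed space indexed by all
    subsets of V, where D can be compared with D plus a face. Dropping the empty face gives the
    non-reduced boundary. *)
Definition boundary_space D j : 'M['F_2]_#|{: {set V}}| :=
  (\sum_(s in faces_of_card D j)
     <<ambient_row (restrict (fun t => t != set0) (bd (cell s)))>>)%MS.

Lemma rank_boundary_mx D j : face_closed D -> set0 \notin D ->
  \rank (boundary_mx D j) = \rank (boundary_space D j).
Proof.
move=> Dcl D0.
(* The coordinate inclusion; it is injective on rows and preserves rank. *)
pose E : 'M['F_2]_(#|faces_of_card D j.-1|, #|{: {set V}}|) :=
  \matrix_(b, t) (enum_val b == enum_val t)%:R.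
have Efree : row_free E.
  apply/row_freeP; exists E^T; apply/matrixP => a b; rewrite !mxE.
  rewrite (bigD1 (enum_rank (enum_val a))) //= big1 => [|t ta].
    rewrite !mxE enum_rankK eqxx addr0 mul1r (inj_eq enum_val_inj) eq_sym.
    by case: eqP.
  rewrite !mxE; case: eqP => [aE|]; last by rewrite mul0r.
  by case/eqP: ta; rewrite aE enum_valK.
rewrite -(mxrankMfree _ Efree).
have rowE a : row a (boundary_mx D j *m E) =
    ambient_row (restrict (fun t => t != set0) (bd (cell (enum_val a)))).
  apply/rowP => t; rewrite !mxE ffunE.
  have /facesP[aD aj] := enum_valP a.
  have [tD|tD] := boolP (enum_val t \in faces_of_card D j.-1).
    rewrite (bigD1 (enum_rank_in tD (enum_val t))) //= big1 => [|b bt].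
      rewrite addr0 [E _ _]mxE enum_rankK_in // eqxx mulr1 boundary_mxE enum_rankK_in //.
      by case: eqP => //= t0; move: tD; rewrite t0 !inE (negbTE D0).
    rewrite [E _ _]mxE; case: eqP => [bE|]; last by rewrite mulr0.
    by case/eqP: bt; apply: enum_val_inj; rewrite enum_rankK_in.
  rewrite big1 => [|b _].
    case: eqP => //= t0; rewrite bd_cellE; case: (boolP (_ && _)) => // /andP[ta /eqP aE].
    case/negP: tD; apply/facesP; split; first by apply: Dcl aD ta _; exact/eqP.
    by rewrite -aj aE.
  rewrite [E _ _]mxE; case: eqP => [bE|]; last by rewrite mulr0.
  by case/negP: tD; rewrite -bE; exact: enum_valP.
apply/eqP; rewrite eqn_leq; apply/andP; split; apply: mxrankS.
  apply/row_subP => a; rewrite rowE.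
  by apply: (sumsmx_sup (enum_val a)); rewrite ?genmxE // enum_valP.
apply/sumsmx_subP => s sD; rewrite genmxE.
by rewrite -(enum_rankK_in sD sD) -rowE row_sub.
Qed.

Lemma homology_dimE D j : homology_dim D j =
  (#|faces_of_card D j| - \rank (boundary_mx D j) - \rank (boundary_mx D j.+1))%N.
Proof. by rewrite /homology_dim mxrank_ker. Qed.

Lemma rank_boundary_le D j : face_closed D ->
  (\rank (boundary_mx D j.+1) <= #|faces_of_card D j| - \rank (boundary_mx D j))%N.
Proof.
by move=> Dcl; rewrite -mxrank_ker; apply: mxrankS; apply/sub_kermxP/boundary_mx_mul.
Qed.

Lemma faces_of_cardU D s j : faces_of_card (s |: D)%SET j =
  if #|s| == j then (s |: faces_of_card D j)%SET else faces_of_card D j.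
Proof.
apply/setP => t; case: ifPn => sj; rewrite !inE.
  by case: (eqVneq t s) => [->|] //=; rewrite sj.
by case: (eqVneq t s) => [->|] //=; rewrite (negbTE sj) andbF.
Qed.

Lemma card_facesU D s j : s \notin D ->
  #|faces_of_card (s |: D)%SET j| = ((#|s| == j) + #|faces_of_card D j|)%N.
Proof.
move=> sD; rewrite faces_of_cardU; case: ifP => // _.
by rewrite cardsU1 inE (negbTE sD).
Qed.

Lemma boundary_spaceU D s j : s \notin D -> #|s| = j ->
  boundary_space (s |: D)%SET j =
  (<<ambient_row (restrict (fun t => t != set0) (bd (cell s)))>> + boundary_space D j)%MS.
Proof.
by move=> sD sj; rewrite /boundary_space faces_of_cardU sj eqxx big_setU1 // inE (negbTE sD).
Qed.

Lemma boundary_spaceU_ne D s j : #|s| != j ->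
  boundary_space (s |: D)%SET j = boundary_space D j.
Proof. by move=> sj; rewrite /boundary_space faces_of_cardU (negbTE sj). Qed.

Lemma ambient_row_sum (I : Type) (r : seq I) (P : pred I) (a : I -> 'F_2)
    (F : I -> simplicial_chain V) :
  ambient_row (\sum_(i <- r | P i) a i *: F i) = \sum_(i <- r | P i) a i *: ambient_row (F i).
Proof.
apply/rowP => t; rewrite !mxE sum_ffunE summxE; apply: eq_bigr => i _.
by rewrite !mxE ffunE.
Qed.

(** A face of this kind adds nothing to the image of the boundary, so it enlarges the kernel. The
    boundary of a vertex is the empty face alone, which has been dropped. *)
Lemma boundary_space_bounds D s : (#|s| == 1%N) \/ bounds D (bd (cell s)) ->
  (ambient_row (restrict (fun t => t != set0) (bd (cell s))) <= boundary_space D #|s|)%MS.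
Proof.
case=> [/cards1P[x ->]|[u uD bu]].
  rewrite bd_cell1 (_ : ambient_row _ = 0) ?sub0mx //; apply/rowP => t.
  by rewrite !mxE !ffunE; case: ifP => // /negbTE ->.
case sj: #|s| => [|j].
  have -> : s = set0 by apply/eqP; rewrite -cards_eq0 sj.
  rewrite bd_cell big_set0 (_ : ambient_row _ = 0) ?sub0mx //; apply/rowP => t.
  by rewrite !mxE !ffunE if_same.
have E : bd (cell s) = bd (homog j.+1 u).
  rewrite bd_homog bu; apply/ffunP => t; rewrite [RHS]ffunE bd_cellE sj eqSS eq_sym.
  by case: eqP; rewrite ?andbF.
have -> : restrict (fun t => t != set0) (bd (cell s)) =
    \sum_t homog j.+1 u t *: restrict (fun t => t != set0) (bd (cell t)).
  apply/ffunP => t; rewrite E sum_ffunE ffunE bd_cells.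
  case: ifPn => t0; last by rewrite big1 // => q _; rewrite !ffunE (negbTE t0) scaler0.
  by apply: eq_bigr => q _; rewrite [RHS]ffunE [restrict _ _ t]ffunE t0.
rewrite ambient_row_sum; apply: summx_sub => t _.
have [tD|tD] := boolP (t \in faces_of_card D j.+1).
  by apply: scalemx_sub; apply: (sumsmx_sup t); rewrite ?genmxE.
rewrite ffunE; case: eqP => tj; last by rewrite scale0r sub0mx.
rewrite uD ?scale0r ?sub0mx //; apply: contra tD => tD.
by apply/facesP.
Qed.

Lemma adds_sub_eq m1 m2 n (A : 'M['F_2]_(m1, n)) (B : 'M['F_2]_(m2, n)) :
  (A <= B)%MS -> \rank (<<A>> + B)%MS = \rank B.
Proof.
move=> AB; apply/eqP; rewrite eqn_leq !mxrankS ?addsmxSr //.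
by rewrite addsmx_sub genmxE AB submx_refl.
Qed.

Lemma rank_add_row m n (u : 'rV['F_2]_n) (B : 'M['F_2]_(m, n)) :
  ~~ (u <= B)%MS -> \rank (<<u>> + B)%MS = (\rank B).+1.
Proof.
move=> uB; have u0 : u != 0 by apply: contraNneq uB => ->; rewrite sub0mx.
have ru : \rank u = 1%N.
  by apply/eqP; rewrite eqn_leq rank_leq_row lt0n mxrank_eq0.
have rcap : \rank (<<u>> :&: B)%MS = 0%N.
  apply/eqP; rewrite -leqn0 -ltnS -[X in (_ < X)%N]ru -(mxrank_gen u) ltn_neqAle.
  rewrite mxrankS ?capmxSl // andbT; have [_ ->] := mxrank_leqif_sup (capmxSl <<u>>%MS B).
  by apply: contra uB; rewrite sub_capmx !genmxE => /andP[].
by have := mxrank_sum_cap <<u>>%MS B; rewrite rcap addn0 mxrank_gen ru add1n.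
Qed.

(** All boundary ranks stay the same while the number of faces of the size of s grows by one. *)
Lemma homology_dim_critical D s j : face_closed D -> face_closed (s |: D)%SET ->
  set0 \notin (s |: D)%SET -> s \notin D -> ok_perfect D s ->
  homology_dim (s |: D)%SET j = ((#|s| == j) + homology_dim D j)%N.
Proof.
move=> Dcl sDcl sD0 sD oks.
have D0 : set0 \notin D by apply: contra sD0; exact: setU1r.
have rkE i : \rank (boundary_mx (s |: D)%SET i) = \rank (boundary_mx D i).
  rewrite !rank_boundary_mx //; have [si|si] := eqVneq #|s| i; last by rewrite boundary_spaceU_ne.
  rewrite boundary_spaceU // adds_sub_eq // -si; apply: boundary_space_bounds.
  by case: oks => [/eqP|]; [left|right].
rewrite !homology_dimE !rkE card_facesU //; case: eqP => //= sj; rewrite !add1n.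
have le1 : (\rank (boundary_mx D j) <= #|faces_of_card D j|)%N by exact: rank_leq_row.
by rewrite subSn // subSn // rank_boundary_le.
Qed.

(** The face s enlarges a kernel by one dimension, and t enlarges the matching image by one. *)
Lemma homology_dim_pair D s t j : face_closed D -> face_closed (s |: (t |: D))%SET ->
  set0 \notin (s |: (t |: D))%SET -> s \notin D -> t \notin D ->
  s \subset t -> #|t| = #|s|.+1 ->
  homology_dim (s |: (t |: D))%SET j = homology_dim D j.
Proof.
move=> Dcl stcl st0 sD tD st ts.
have D0 : set0 \notin D by apply: contra st0 => D0; rewrite !setU1r.
have s0 : s != set0 by apply: contraNneq st0 => <-; rewrite setU11.
have nest : s != t by apply: contra_eq_neq ts => ->; rewrite neq_ltn ltnSn.
have stD : s \notin (t |: D)%SET by rewrite in_setU1 negb_or nest.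
have bs : bounds D (bd (cell s)).
  (* The facets of t other than s lie in D, and together they have the same boundary as s. *)
  exists (bd (cell t) + cell s); last by rewrite linearD /= bdbd add0r.
  move=> q qD; rewrite ffunE bd_cellE ffunE; case: (eqVneq q s) => [->|qs].
    by rewrite st ts eqxx addFF.
  rewrite addr0; case: (boolP (_ && _)) => // /andP[qt /eqP tq].
  case/negP: qD; have : q \in (s |: (t |: D))%SET.
    apply: stcl qt _; first by rewrite setU1r // setU11.
    by rewrite -card_gt0; move: tq; rewrite ts => -[<-]; rewrite card_gt0.
  rewrite !in_setU1 (negbTE qs) /=; case: eqP => // qE.
  by move: tq; rewrite qE => /eqP; rewrite ltn_eqF.
have sspace : (ambient_row (restrict (fun q => q != set0) (bd (cell s)))
    <= boundary_space D #|s|)%MS by apply: boundary_space_bounds; right.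
have tspace : ~~ (ambient_row (restrict (fun q => q != set0) (bd (cell t)))
    <= boundary_space D #|t|)%MS.
  (* This functional reads the coefficient at s: it vanishes on boundaries of faces of D, none of
     which contains s, but not on the boundary of t. *)
  pose d : 'cV['F_2]_#|{: {set V}}| := \col_i (enum_val i == s)%:R.
  have rowd c : (ambient_row c *m d) 0 0 = c s.
    rewrite mxE (bigD1 (enum_rank s)) //= big1 => [|i is_].
      by rewrite !mxE enum_rankK eqxx mulr1 addr0.
    rewrite !mxE; case: eqP => [iE|]; last by rewrite mulr0.
    by case/eqP: is_; rewrite -iE enum_valK.
  have kD : (boundary_space D #|t| <= kermx d)%MS.
    apply/sumsmx_subP => q /facesP[qD qt]; rewrite genmxE; apply/sub_kermxP/matrixP => a b.
    rewrite !ord1 rowd mxE ffunE s0 bd_cellE; case: (boolP (s \subset q)) => //= sq.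
    by case/negP: sD; exact: Dcl qD sq s0.
  apply/negP => /submx_trans /(_ kD) /sub_kermxP /matrixP /(_ 0 0).
  by rewrite rowd mxE ffunE s0 bd_cellE st ts eqxx => /eqP.
have rkE i : \rank (boundary_mx (s |: (t |: D))%SET i) = ((#|t| == i) + \rank (boundary_mx D i))%N.
  rewrite !rank_boundary_mx //; have [ti|ti] := eqVneq #|t| i.
    rewrite boundary_spaceU_ne; last by rewrite -ti ts neq_ltn ltnSn.
    by rewrite boundary_spaceU // rank_add_row ?add1n // -ti.
  have [si|si] := eqVneq #|s| i.
    rewrite boundary_spaceU // adds_sub_eq boundary_spaceU_ne //.
    by rewrite -si.
  by rewrite !boundary_spaceU_ne.
rewrite !homology_dimE !rkE !card_facesU // ts eqSS.
have [->|sj] := eqVneq #|s| j.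
  by rewrite gtn_eqF // !add0n !add1n subnAC subSS subnAC.
have [sj1|] := eqVneq #|s|.+1 j; last by rewrite !add0n.
by rewrite !add0n !add1n subSS.
Qed.

(** [critical] for an arbitrary set of faces, so that it applies to the intermediate stages of a
    construction. *)
Definition criticalD D (f : {set V} -> int) s : bool :=
  (s \in D) && [forall t in D, (t != s) && ((t \subset s) || (s \subset t)) ==> (f t != f s)].

Lemma buildable_morse D : set0 \notin D -> buildable (@ok_perfect V) set0 D ->
  exists (f : {set V} -> int) (n : int),
  [/\ {in D, forall s, f s < n},
      {in D &, forall s t : {set V}, s \subset t -> f s <= f t},
      (forall k, (#|[set s in D | f s == k]%SET| <= 2)%N) &
      forall i, #|[set s | criticalD D f s && (#|s| == i.+1)]%SET| = homology_dim D i.+1].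
Proof.
have e0 : face_closed (set0 : {set {set V}}) by move=> s t; rewrite inE.
move=> D0 bD; elim: bD D0 => {D} [|D s bD IH sD Dcl oks|D s t bD IH sD tD st ts Dcl] D0.
- exists (fun=> 0), 0; split => [s|s t|k|i]; rewrite ?inE //.
    by rewrite (_ : [set _ in _ | _]%SET = set0) ?cards0 //; apply/setP => s; rewrite !inE.
  rewrite homology_dimE (_ : [set _ | _]%SET = set0).
    apply/esym/eqP; rewrite cards0 -leqn0 -subnDA; apply: leq_trans (leq_subr _ _) _.
    by rewrite (_ : faces_of_card _ _ = set0) ?cards0 //; apply/setP => s; rewrite !inE.
  by apply/setP => s; rewrite !inE /criticalD inE.
- have D0' : set0 \notin D by apply: contra D0; exact: setU1r.
  have [f [n [fn fmono f2 fcrit]]] := IH D0'.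
  have Dcl' := buildable_closed e0 bD.
  have s0 : s != set0 by apply: contraNneq D0 => <-; rewrite setU11.
  pose g q := if q == s then n else f q.
  have gs : g s = n by rewrite /g eqxx.
  have gD q : q \in D -> g q = f q by rewrite /g; case: eqP => // ->; rewrite (negbTE sD).
  have nsub q : q \in D -> ~~ (s \subset q) by move=> qD; apply: contra sD => sq; exact: Dcl' sq s0.
  exists g, (n + 1); split.
  + move=> q; rewrite in_setU1 => /orP[/eqP->|qD]; first by rewrite gs ltrDl.
    by rewrite gD // (lt_trans (fn _ qD)) // ltrDl.
  + move=> q r; rewrite !in_setU1 => /orP[/eqP->|qD] /orP[/eqP->|rD] qr //.
    * by rewrite (negbTE (nsub r rD)) in qr.
    * by rewrite gs gD // ltW // fn.
    * by rewrite !gD //; exact: fmono.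
  + move=> k; have [->|kn] := eqVneq k n.
      apply: (@leq_trans #|[set s]%SET|); last by rewrite cards1.
      apply: subset_leq_card; apply/subsetP => q; rewrite !inE => /andP[/orP[//|qD]].
      by rewrite gD // lt_eqF // fn.
    apply: leq_trans (f2 k); apply: subset_leq_card; apply/subsetP => q.
    rewrite !inE => /andP[/orP[/eqP->|qD]]; first by rewrite gs eq_sym (negbTE kn).
    by rewrite gD // qD.
  + move=> i; rewrite homology_dim_critical // -fcrit.
    have crE q : criticalD (s |: D)%SET g q = (q == s) || criticalD D f q.
      rewrite /criticalD in_setU1; have [->|qs] := eqVneq q s.
        rewrite /=; apply/'forall_implyP => r; rewrite in_setU1 => /orP[/eqP->|rD].
          by rewrite eqxx.
        by rewrite gs gD // lt_eqF ?fn //= implybT.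
      rewrite /=; have [qD|//] := boolP (q \in D); rewrite /=.
      apply/'forall_implyP/'forall_implyP => H r rD.
        by have := H r; rewrite in_setU1 rD orbT !gD //; apply.
      move: rD; rewrite in_setU1 => /orP[/eqP->|rD].
        by rewrite gs gD // gt_eqF ?fn //= implybT.
      by rewrite !gD //; exact: H.
    have [si|si] := eqVneq #|s| i.+1.
      rewrite (_ : [set _ | _]%SET = (s |: [set q | criticalD D f q && (#|q| == i.+1)])%SET).
        by rewrite cardsU1 !inE /criticalD (negbTE sD).
      apply/setP => q; rewrite !inE crE; case: (eqVneq q s) => [->|] //=.
      by rewrite si eqxx.
    congr #|pred_of_set _|; apply/setP => q; rewrite !inE crE.
    by case: (eqVneq q s) => [->|] //=; rewrite (negbTE si) andbF.
- have D0' : set0 \notin D by apply: contra D0 => D0; rewrite !setU1r.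
  have [f [n [fn fmono f2 fcrit]]] := IH D0'.
  have Dcl' := buildable_closed e0 bD.
  have s0 : s != set0 by apply: contraNneq D0 => <-; rewrite setU11.
  have nest : s != t by apply: contra_eq_neq ts => ->; rewrite neq_ltn ltnSn.
  pose g q := if (q == s) || (q == t) then n else f q.
  have gs : g s = n by rewrite /g eqxx.
  have gt : g t = n by rewrite /g eqxx orbT.
  have gD q : q \in D -> g q = f q.
    by rewrite /g => qD; case: eqP qD => [->|_ qD]; [rewrite (negbTE sD)|case: eqP qD => // ->; rewrite (negbTE tD)].
  have nsub q : q \in D -> ~~ (s \subset q) by move=> qD; apply: contra sD => sq; exact: Dcl' sq s0.
  have nsubt q : q \in D -> ~~ (t \subset q).
    by move=> qD; apply: contra (nsub q qD); exact: subset_trans.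
  exists g, (n + 1); split.
  + move=> q; rewrite !in_setU1 => /or3P[/eqP->|/eqP->|qD]; rewrite ?gs ?gt ?ltrDl //.
    by rewrite gD // (lt_trans (fn _ qD)) // ltrDl.
  + move=> q r; rewrite !in_setU1 => /or3P[/eqP->|/eqP->|qD] /or3P[/eqP->|/eqP->|rD] qr;
      rewrite ?gs ?gt ?(gD q) ?(gD r) //; try exact/ltW/fn.
    * by rewrite (negbTE (nsub r rD)) in qr.
    * by rewrite (negbTE (nsubt r rD)) in qr.
    * exact: fmono.
  + move=> k; have [->|kn] := eqVneq k n.
      apply: (@leq_trans #|[set s; t]%SET|); last by rewrite cards2 nest.
      apply: subset_leq_card; apply/subsetP => q.
      rewrite !inE => /andP[/or3P[->//|->|qD]]; first by rewrite orbT.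
      by rewrite gD // lt_eqF // fn.
    apply: leq_trans (f2 k); apply: subset_leq_card; apply/subsetP => q.
    rewrite !inE => /andP[/or3P[/eqP->|/eqP->|qD]]; rewrite ?gs ?gt 1?eq_sym ?(negbTE kn) //.
    by rewrite gD // qD eq_sym.
  + move=> i; rewrite homology_dim_pair // -fcrit.
    congr #|pred_of_set _|; apply/setP => q; rewrite !inE; congr (_ && _).
    rewrite /criticalD !in_setU1.
    have [->|qs] := eqVneq q s.
      rewrite (negbTE sD) /=; apply/negP => /'forall_implyP /(_ t).
      by rewrite !in_setU1 eqxx orbT st orbT eq_sym nest gs gt eqxx => /(_ isT).
    have [->|qt] := eqVneq q t.
      rewrite (negbTE tD) /=; apply/negP => /'forall_implyP /(_ s).
      by rewrite !in_setU1 eqxx st nest gs gt eqxx => /(_ isT).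
    rewrite /=; have [qD|//] := boolP (q \in D); rewrite /=.
    apply/'forall_implyP/'forall_implyP => H r rD.
      by have := H r; rewrite !in_setU1 rD !orbT !gD //; apply.
    move: rD; rewrite !in_setU1 => /or3P[/eqP->|/eqP->|rD].
    * by rewrite gs gD // gt_eqF ?fn //= implybT.
    * by rewrite gt gD // gt_eqF ?fn //= implybT.
    * by rewrite !gD //; exact: H.
Qed.

Lemma buildable_perfect C : buildable (@ok_perfect V) set0 (nonempty_faces C) ->
  exists f : {set V} -> int, discrete_morse C f /\ perfect C f.
Proof.
move=> bC; have [|f [n [_ fmono f2 fcrit]]] := buildable_morse _ bC.
  by rewrite !inE eqxx.
by exists f; split; [split|].
Qed.

End Homology.

(** * Linear embeddings *)

Section Geometry.
Variables (R : realType) (V : finType).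
Implicit Types (v w x y : V) (s t : {set V}) (C D L : {set {set V}}).

Lemma dotBr k (l x y : 'rV[R]_k) : dot l (x - y) = dot l x - dot l y.
Proof.
by rewrite /dot -sumrB; apply: eq_bigr => i _; rewrite !mxE mulrBr.
Qed.

Lemma dotZr k (l x : 'rV[R]_k) (a : R) : dot l (a *: x) = a * dot l x.
Proof.
by rewrite /dot mulr_sumr; apply: eq_bigr => i _; rewrite !mxE mulrCA.
Qed.

Lemma dotNl k (l x : 'rV[R]_k) : dot (- l) x = - dot l x.
Proof.
by rewrite /dot -sumrN; apply: eq_bigr => i _; rewrite !mxE mulNr.
Qed.

Lemma dot_ker k (l x : 'rV[R]_k) : (x <= kermx l^T)%MS = (dot l x == 0).
Proof.
have E : x *m l^T = (dot l x)%:M.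
  by apply/matrixP => i j; rewrite !ord1 !mxE mulr1n; apply: eq_bigr => q _; rewrite !mxE mulrC.
apply/sub_kermxP/eqP => [|xl]; last by rewrite E xl raddf0.
by rewrite E => /matrixP /(_ 0 0); rewrite !mxE mulr1n.
Qed.

Lemma poly_nonroot (P : {poly R}) : P != 0 -> exists x : R, ~~ root P x.
Proof.
move=> P0; apply: contrapT => noroot.
have := @max_poly_roots _ P [seq n%:R : R | n <- iota 0 (size P)] P0.
rewrite size_map size_iota ltnn => H; suff: false by [].
apply: H.
  by apply/allP => x _; apply: contrapT => /negP xr; apply: noroot; exists x.
by rewrite map_inj_uniq ?iota_uniq // => m n /eqP; rewrite eqr_nat => /eqP.
Qed.

(* The functionals (1, x, x^2, ...) already suffice: each difference is killed
   by finitely many of them. *)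
Lemma exists_generic_functional k (q : V -> 'rV[R]_k) :
  exists l : 'rV[R]_k, forall u v, q u != q v -> dot l (q u) != dot l (q v).
Proof.
pose P (uv : V * V) : {poly R} := \poly_(i < k) (if insub i is Some j then (q uv.1 - q uv.2) 0 j else 0).
have [|x xr] := @poly_nonroot (\prod_(uv | q uv.1 != q uv.2) P uv).
  apply/prodf_neq0 => uv; rewrite -subr_eq0; apply: contraNneq => P0.
  apply/eqP/rowP => j; rewrite [RHS]mxE.
  have := congr1 (fun f : {poly R} => f`_j) P0; rewrite coef_poly coef0 ltn_ord.
  by rewrite valK.
exists (\row_i x ^+ i) => u v uv; rewrite -subr_eq0 -dotBr.
move: xr; rewrite /root horner_prod => /prodf_neq0 /(_ (u, v) uv).
rewrite horner_poly; apply: contra => /eqP E; rewrite -[X in _ == X]E; apply/eqP; apply/esym.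
by apply: eq_bigr => i _; rewrite valK [X in X * _ = _]mxE mulrC.
Qed.

Definition vertex_point v : {ffun V -> R} := [ffun u => (u == v)%:R].

Lemma barycentric_vertex_point D v : v \in vertices D -> barycentric R D (vertex_point v).
Proof.
rewrite inE => vD; split.
- by move=> u; rewrite ffunE ler0n.
- by rewrite (bigD1 v) //= big1 => [|u /negbTE uv]; rewrite ffunE ?uv // eqxx addr0.
- rewrite (_ : [set _ | _]%SET = [set v]%SET) //; apply/setP => u.
  by rewrite !inE ffunE pnatr_eq0 eqb0 negbK.
Qed.

Lemma simplexwise_linear_vertex_point k (p : V -> 'rV[R]_k) v :
  simplexwise_linear p (vertex_point v) = p v.
Proof.
rewrite /simplexwise_linear (bigD1 v) //= big1 => [|u /negbTE uv].
  by rewrite ffunE eqxx scale1r addr0.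
by rewrite ffunE uv scale0r.
Qed.

Lemma embedding_vertices k D (p : V -> 'rV[R]_k) : linear_embedding D p ->
  {in vertices D &, injective p}.
Proof.
move=> emb u v uD vD puv.
have E : vertex_point u = vertex_point v.
  apply: emb; first exact/mem_set/barycentric_vertex_point.
    exact/mem_set/barycentric_vertex_point.
  by rewrite !simplexwise_linear_vertex_point.
by apply/eqP; have := congr1 (fun f : {ffun V -> R} => f u) E; rewrite !ffunE eqxx;
  case: eqP => // _ /eqP; rewrite oner_eq0.
Qed.

(** Radial projection moves each u along its ray from p v until it is one unit higher than v. If two
    points have the same image, shrinking that image towards p v gives one point of the star of v
    with two descriptions, and the embedding of C identifies them. *)
Lemma upper_link_embedding k C (p : V -> 'rV[R]_k) (l : 'rV[R]_k) v :
  let h u := dot l (p u) in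
  down_closed C -> linear_embedding C p ->
  linear_embedding (upper_link h C v) (fun u => (h u - h v)^-1 *: (p u - p v)).
Proof.
move=> h Ccl emb a b /set_mem[a0 a1 /upper_linkP[va aC ah]].
move=> /set_mem[b0 b1 /upper_linkP[vb bC bh]] ab.
pose w (c : {ffun V -> R}) u := c u / (h u - h v).
pose W c := \sum_u w c u.
have key (c : {ffun V -> R}) : (forall u, 0 <= c u) -> \sum_u c u = 1 ->
    v \notin [set u | c u != 0]%SET ->
    {in [set u | c u != 0]%SET, forall u, h v < h u} ->
  [/\ w c v = 0, forall u, 0 <= w c u, 0 < W c & forall u, w c u = 0 -> c u = 0].
  move=> c0 c1 vc ch.
  have cpos u : c u != 0 -> 0 < h u - h v by move=> cu; rewrite subr_gt0 ch // inE.
  have cv : c v = 0 by apply/eqP; rewrite inE negbK in vc.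
  have w0 u : 0 <= w c u.
    have [cu|cu] := eqVneq (c u) 0; first by rewrite /w cu mul0r.
    by rewrite divr_ge0 // ltW // cpos.
  have wc u : w c u = 0 -> c u = 0.
    have [//|cu /eqP] := eqVneq (c u) 0.
    by rewrite /w mulf_eq0 invr_eq0 (negbTE cu) /= gt_eqF ?cpos.
  split=> //; first by rewrite /w cv mul0r.
  rewrite lt_neqAle sumr_ge0 // andbT eq_sym; apply/eqP => /psumr_eq0P W0.
  have := oner_neq0 R; rewrite -c1 big1 ?eqxx // => u _; apply: wc; exact: W0.
have [wav wa0 Wa awa] := key a a0 a1 va ah.
have [wbv wb0 Wb bwb] := key b b0 b1 vb bh.
(* A common scale that makes both [e * W a] and [e * W b] at most 1, so that the weight left for v
   is nonnegative. *)
pose e := (W a + W b)^-1.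
have e0 : 0 < e by rewrite invr_gt0 addr_gt0.
have eab : e * (W a + W b) = 1 by rewrite mulVf // gt_eqF // addr_gt0.
pose pt (c : {ffun V -> R}) : {ffun V -> R} :=
  [ffun u => e * w c u + (1 - e * W c) * (u == v)%:R].
have ptC (c : {ffun V -> R}) : (forall u, 0 <= w c u) -> e * W c <= 1 ->
    (v |: [set u | c u != 0])%SET \in C -> pt c \in barycentric R C.
  move=> c0 eW cC; apply: mem_set; split.
  - by move=> u; rewrite ffunE; apply: addr_ge0; apply: mulr_ge0; rewrite ?ler0n ?subr_ge0 //; exact: ltW.
  - rewrite (eq_bigr (fun u => e * w c u + (1 - e * W c) * (u == v)%:R)) => [|u _]; last by rewrite ffunE.
    rewrite big_split /= -!mulr_sumr -/(W c) (bigD1 v) //= eqxx big1 => [|u /negbTE ->//].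
    by rewrite addr0 mulr1 addrC subrK.
  - apply: Ccl cC _; apply/subsetP => u; rewrite !inE ffunE.
    case: (eqVneq u v) => //= uv; rewrite mulr0 addr0 => eu.
    by apply: contraNneq eu => cu; rewrite /w cu mul0r mulr0.
have ptE (c : {ffun V -> R}) : simplexwise_linear p (pt c) =
    p v + e *: simplexwise_linear (fun u => (h u - h v)^-1 *: (p u - p v)) c.
  rewrite /simplexwise_linear scaler_sumr.
  rewrite (eq_bigr (fun u => e *: (c u *: ((h u - h v)^-1 *: (p u - p v)))
      + (e * w c u) *: p v + ((1 - e * W c) * (u == v)%:R) *: p u)); last first.
    move=> u _; rewrite ffunE scalerDl; congr (_ + _).
    by rewrite !scalerA -mulrA -/(w c u) -scalerDr subrK.
  rewrite !big_split /= -scaler_suml -mulr_sumr -/(W c) (bigD1 v (F := fun u => _ *: p u)) //=.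
  rewrite eqxx mulr1 [X in _ + (_ + X)]big1 => [|u /negbTE ->]; last by rewrite mulr0 scale0r.
  by rewrite addr0 -addrA -scalerDl addrC (addrC _ (1 - _)) subrK scale1r.
have abE : pt a = pt b.
  apply: emb; rewrite ?ptC //.
  - by rewrite -eab ler_pM2l // lerDl ltW.
  - by rewrite -eab ler_pM2l // lerDr ltW.
  - by rewrite !ptE; move: ab => /= ->.
apply/ffunP => u; have [->|uv] := eqVneq u v.
  by rewrite (awa _ wav) (bwb _ wbv).
have := congr1 (fun f : {ffun V -> R} => f u) abE; rewrite !ffunE (negbTE uv) !mulr0 !addr0.
move/(mulfI (lt0r_neq0 e0)) => wab.
have [au|au] := eqVneq (a u) 0.
  by rewrite au (bwb u) // -wab /w au mul0r.
have hu : h u - h v != 0 by rewrite gt_eqF // subr_gt0 ah // inE.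
by move: wab => /(congr1 ( *%R^~ (h u - h v))); rewrite /w !divfK.
Qed.

Lemma layered_no_vertex d D : vertices D = set0 -> layered R d D.
Proof.
case: d => [|d] /= D0; first by rewrite D0 cards0.
by exists (fun=> 0); split => [u v|u]; rewrite D0 inE.
Qed.

(** The ambient space never changes; the dimension is carried by U, a space of directions containing
    all differences of vertices. Radial projection brings all vertices of an upper link to equal
    height, so U can be cut with the kernel of the functional. *)
Lemma embedding_layered k d D (q : V -> 'rV[R]_k) (U : 'M[R]_k) :
  down_closed D -> linear_embedding D q ->
  {in vertices D &, forall u v, (q u - q v <= U)%MS} -> (\rank U <= d)%N ->
  layered R d D.
Proof.
elim: d D q U => [|d IH] D q U Dcl emb qU rU.
  have U0 : U = 0 by apply/eqP; rewrite -mxrank_eq0 -leqn0.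
  apply/card_le1_eqP => u v uD vD; apply: (embedding_vertices emb) => //.
  by apply/eqP; rewrite -subr_eq0 -submx0 -U0 qU.
have [l lq] := exists_generic_functional q.
pose h u := dot l (q u).
have sep : {in vertices D &, injective h}.
  move=> u v uD vD huv; apply: (embedding_vertices emb) => //.
  by apply/eqP; apply: contraT => /lq; rewrite -/(h u) -/(h v) huv eqxx.
have up (m : 'rV[R]_k) v : {in vertices D &, injective (fun u => dot m (q u))} ->
    v \in vertices D -> layered R d (upper_link (fun u => dot m (q u)) D v).
  move=> minj vD; set L := upper_link _ D v.
  have [L0|/set0Pn[u uL]] := eqVneq (vertices L) set0; first exact: layered_no_vertex.
  have LV x : x \in vertices L -> x \in vertices D /\ dot m (q v) < dot m (q x).
    rewrite inE => /upper_linkP[vx vxD hx]; split; last by apply: hx; rewrite inE.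
    by apply: mem_vertices vxD _ => //; rewrite !inE eqxx orbT.
  have emb' := @upper_link_embedding _ D q m v Dcl emb.
  apply: (IH L _ (U :&: kermx m^T)%MS) emb' _ _; first exact: down_closed_upper_link.
    have q'U x : x \in vertices L -> ((dot m (q x) - dot m (q v))^-1 *: (q x - q v) <= U)%MS.
      by move=> /LV[xD _]; apply: scalemx_sub; exact: qU.
    move=> x y xL yL /=; rewrite sub_capmx; apply/andP; split.
      by apply: addmx_sub; rewrite ?eqmx_opp; exact: q'U.
    rewrite dot_ker dotBr !dotZr !dotBr.
    have [_ hx] := LV x xL; have [_ hy] := LV y yL.
    by rewrite !mulVf ?subrr // gt_eqF // subr_gt0.
  (* The rank really drops: the direction from v to the higher vertex u belongs to U and is not in
     the kernel. *)
  rewrite -ltnS; apply: leq_trans rU; rewrite ltn_neqAle mxrankS ?capmxSl // andbT.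
  have [_ ->] := mxrank_leqif_sup (capmxSl U (kermx m^T)).
  have [uD hu] := LV u uL; apply/negP => UU.
  have := submx_trans (qU u v uD vD) UU; rewrite sub_capmx dot_ker dotBr.
  by rewrite subr_eq0 gt_eqF // andbF.
exists h; split => // v vD; split; first exact: up.
rewrite (_ : (fun u => - h u) = (fun u => dot (- l) (q u))).
  by apply: up => // u u' uD u'D; rewrite !dotNl => /oppr_inj; exact: sep.
by apply/funext => u; rewrite dotNl.
Qed.

Lemma embedding_links_planar C (p : V -> 'rV[R]_3) (l : 'rV[R]_3) : l != 0 ->
  down_closed C -> linear_embedding C p -> links_planar (fun u => dot l (p u)) C.
Proof.
move=> l0 Ccl emb v vC; have emb' := @upper_link_embedding _ C p l v Ccl emb.
apply: (@embedding_layered 3 2 _ _ (kermx l^T)) emb' _ _.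
- exact: down_closed_upper_link.
- move=> x y xL yL /=; rewrite dot_ker dotBr !dotZr !dotBr.
  have hL u : u \in vertices (upper_link (fun u => dot l (p u)) C v) -> dot l (p v) < dot l (p u).
    by rewrite inE => /upper_linkP[_ _]; apply; rewrite inE.
  by rewrite !mulVf ?subrr // gt_eqF // subr_gt0 hL.
- by rewrite mxrank_ker mxrank_tr rank_rV l0.
Qed.

End Geometry.

(** * Compactness *)

Section Compactness.
Local Open Scope classical_set_scope.
Local Open Scope ring_scope.
Variable (R : realType).

Lemma continuous_combination n k (v : 'I_n -> 'rV[R]_k) :
  continuous (fun a : 'rV[R]_n => \sum_i a 0 i *: v i).
Proof.
apply: continuous_big => [|i _ x]; first exact: add_continuous.
by apply: continuousZr_tmp; exact: coord_continuous.
Qed.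

Lemma compact_face n (P : pred 'I_n) :
  compact [set a : 'rV[R]_n | [/\ forall i, 0 <= a 0 i, \sum_i a 0 i = 1
     & forall i, ~~ P i -> a 0 i = 0]]%classic.
Proof.
apply: bounded_closed_compact.
  exists 1; split; first exact: num_real.
  move=> M M1 a [a0 a1 _]; rewrite /Num.norm /= mx_normrE; apply: bigmax_le.
    exact: ltW (lt_trans ltr01 M1).
  move=> [i j] _ /=; rewrite ord1 ger0_norm //; apply: le_trans (ltW M1).
  by rewrite -a1 (bigD1 j) //= lerDl sumr_ge0.
rewrite (_ : mkset _ = ((\bigcap_i (fun a : 'rV[R]_n => a 0 i) @^-1` [set x | 0 <= x])
   `&` (fun a : 'rV[R]_n => \sum_i a 0 i) @^-1` [set x | x = 1]
   `&` (\bigcap_(i in [set i | ~~ P i]) (fun a : 'rV[R]_n => a 0 i) @^-1` [set x | x = 0]))%classic).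
  apply: closedI; first apply: closedI.
  - apply: closed_bigI => i _; apply: preimage_closed; last exact: closed_ge.
    by move=> a _; exact: coord_continuous.
  - apply: preimage_closed; last exact: closed_eq.
    move=> a _; apply: continuous_big => [|i _]; first exact: add_continuous.
    exact: coord_continuous.
  - apply: closed_bigI => i _; apply: preimage_closed; last exact: closed_eq.
    by move=> a _; exact: coord_continuous.
apply/seteqP; split => a /=.
  case=> a0 a1 aP; split; last by move=> i iP; exact: aP.
  by split=> [i _|]; [exact: a0|exact: a1].
by case=> -[a0 a1] aP; split=> [i||i]; [exact: (a0 i)|exact: a1|exact: (aP i)].
Qed.

Lemma compact_std_simplex n : compact (std_simplex R n).
Proof.
rewrite (_ : std_simplex R n = [set a : 'rV[R]_n.+1 | [/\ forall i, 0 <= a 0 i,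
   \sum_i a 0 i = 1 & forall i, ~~ predT i -> a 0 i = 0]]%classic).
  exact: compact_face.
by apply/seteqP; split => a /= [] a0 a1; split.
Qed.

Lemma compact_subtype (X : topologicalType) (A : set X) :
  compact A -> compact [set: A]%classic.
Proof.
move=> /compact_near_coveringP/near_covering_withinP Acov.
apply/compact_near_coveringP => I F P FF cov.
pose Q i y := forall Ay : A y, P i (SigSub (mem_set Ay)).
have : \near F, (A `<=` Q F)%classic.
  apply: (Acov I F Q FF) => x Ax.
  have [[/= U G] [xU FG] UG] := cov (SigSub (mem_set Ax)) Logic.I.
  case: xU => W [[B oB BW] Wx WU].
  exists (B, G); first by split => //; apply: open_nbhs_nbhs; split => //; move: Wx; rewrite -BW.
  move=> [y i] [/= By Gi] _ Ay; apply: (UG (SigSub (mem_set Ay), i)); split => //=.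
  by apply: WU; rewrite -BW.
apply: filterS => i AQ x _.
have := AQ _ (set_valP x) (set_valP x); congr (P i _); exact: val_inj.
Qed.


Lemma near_at_right0_ex (P : R -> Prop) :
  (\forall e \near 0^'+, P e) -> exists2 e : R, 0 < e & P e.
Proof.
move=> nP; near (0 : R)^'+ => e; exists e; first by near: e; exact: nbhs_right_gt.
by near: e.
Unshelve. all: by end_near. Qed.

(** A Lebesgue number for the cover of T by preimages of the complements of the closed sets F i,
    with balls measured in M. The sets F i will be the polyhedra of the vertex deletions. *)
Lemma compact_lebesgue (T : topologicalType) (M : pseudoMetricType R) (I : Type)
    (f : T -> M) (F : I -> set M) (H : I -> Prop) :
  compact [set: T]%classic -> continuous f -> (forall i, closed (F i)) ->
  (forall t, exists2 i, H i & ~ F i (f t)) ->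
  exists2 e : R, 0 < e &
    forall t, exists2 i, H i & forall y, ball (f t) e y -> ~ F i y.
Proof.
move=> /compact_near_coveringP Tcov fcont Fcl cover.
pose P (e : R) t := exists2 i, H i & forall y, ball (f t) e y -> ~ F i y.
have near_P : \forall e \near 0^'+, ([set: T] `<=` P e)%classic.
  apply: Tcov => t _; have [i Hi Fi] := cover t.
  have /nbhs_ballP[r /= r0 rF] : nbhs (f t) (~` F i)%classic.
    by apply: open_nbhs_nbhs; split => //; apply: closed_openC; exact: Fcl.
  have tr : \forall t' \near t, ball (f t) (r / 2) (f t').
    by apply: fcont; apply: nbhsx_ballx; rewrite divr_gt0.
  near=> t' e.
  have er : e <= r / 2 by apply: ltW; near: e; apply: nbhs_right_lt; rewrite divr_gt0.
  have tt' : ball (f t) (r / 2) (f t') by near: t'.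
  exists i => // y ey; apply: rF; rewrite [r]splitr.
  by apply: (ball_triangle tt'); exact: le_ball ey.
have [e e0 eP] := near_at_right0_ex near_P.
by exists e => // t; exact: eP.
Unshelve. all: by end_near. Qed.

(** Heine-Cantor. *)
Lemma compact_uniform (T M : pseudoMetricType R) (f : T -> M) :
  compact [set: T]%classic -> continuous f -> forall e : R, 0 < e ->
  exists2 d : R, 0 < d & forall t t', ball t d t' -> ball (f t) e (f t').
Proof.
move=> /compact_near_coveringP Tcov fcont e e0.
pose P (d : R) t := forall t', ball t d t' -> ball (f t) e (f t').
have near_P : \forall d \near 0^'+, ([set: T] `<=` P d)%classic.
  apply: Tcov => t _.
  have /nbhs_ballP[r /= r0 rf] : \forall t' \near t, ball (f t) (e / 2) (f t').
    by apply: fcont; apply: nbhsx_ballx; rewrite divr_gt0.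
  near=> t1 d.
  have dr : d <= r / 2 by apply: ltW; near: d; apply: nbhs_right_lt; rewrite divr_gt0.
  have t1r : ball t (r / 2) t1 by near: t1; apply: nbhsx_ballx; rewrite divr_gt0.
  move=> t2 t12.
  rewrite [e]splitr; apply: (ball_triangle (y := f t)).
    apply/ball_sym/rf; apply: le_ball t1r; rewrite ler_pdivrMr //.
    by rewrite ler_peMr ?ltW // ltr1n.
  apply: rf; rewrite [r]splitr; apply: ball_triangle t1r _.
  exact: le_ball t12.
have [d d0 dP] := near_at_right0_ex near_P.
by exists d => // t; exact: dP.
Unshelve. all: by end_near. Qed.

Lemma ball_std_simplex n (t t' : std_simplex R n) (d : R) : 0 < d ->
  (forall i, `|set_val t 0 i - set_val t' 0 i| < d) -> ball t d t'.
Proof.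
move=> d0 tt'; rewrite -initial_ballE; split => // i j; rewrite ord1.
by rewrite -ball_normE; exact: tt'.
Qed.

Lemma singular_continuous n k (S : set 'rV[R]_k) (s : singular_simplex R n S) :
  continuous (fun t => set_val (s t)).
Proof.
by move=> t; apply: continuous_comp; [exact: cts_fun|exact: initial_continuous].
Qed.

Lemma singular_uniform n k (S : set 'rV[R]_k) (s : singular_simplex R n S) (e : R) :
  0 < e -> exists2 d : R, 0 < d & forall t t' : std_simplex R n,
  (forall i, `|set_val t 0 i - set_val t' 0 i| < d) ->
  ball (set_val (s t)) e (set_val (s t')).
Proof.
move=> e0; have [d d0 dP] := compact_uniform
  (compact_subtype (@compact_std_simplex n)) (@singular_continuous n k S s) e0.
by exists d => // t t' /(ball_std_simplex d0) /dP.
Qed.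

(** A finite union of linear images of compact simplices. *)
Lemma polyhedron_closed (V : finType) k (D : {set {set V}}) (p : V -> 'rV[R]_k) :
  down_closed D -> closed (polyhedron D p).
Proof.
move=> Dcl.
pose face (s : {set V}) := [set a : 'rV[R]_#|V| | [/\ forall i, 0 <= a 0 i, \sum_i a 0 i = 1
     & forall i, ~~ (enum_val i \in s) -> a 0 i = 0]]%classic.
pose lin (a : 'rV[R]_#|V|) := \sum_i a 0 i *: p (enum_val i).
rewrite (_ : polyhedron D p = \bigcup_(s in [set s | s \in D]) (lin @` face s))%classic.
  apply: closed_bigcup => [|s _]; first exact: finite_finset.
  apply: compact_closed; first exact: norm_hausdorff.
  apply: continuous_compact; last exact: compact_face.
  by apply: continuous_subspaceT => x; exact: continuous_combination.
apply/seteqP; split => x /=.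
  case=> a [a0 a1 aD] <-; exists [set v | a v != 0]%SET => //.
  exists (\row_i a (enum_val i)).
    split => [i||i]; rewrite ?mxE //.
      rewrite -[RHS]a1 (reindex (@enum_val V predT)) /=; first by apply: eq_bigr => i _; rewrite mxE.
      exact/onW_bij/enum_val_bij.
    by rewrite inE negbK => /eqP.
  rewrite /lin /simplexwise_linear [RHS](reindex (@enum_val V predT)) /=.
    by apply: eq_bigr => i _; rewrite mxE.
  exact/onW_bij/enum_val_bij.
case=> s sD [a [a0 a1 as_] <-].
exists [ffun v => a 0 (enum_rank v)].
  split => [v||]; rewrite ?ffunE //.
    rewrite -[RHS]a1 (reindex (@enum_val V predT)) /=; first by apply: eq_bigr => i _; rewrite ffunE enum_valK.
    exact/onW_bij/enum_val_bij.
  apply: Dcl sD _; apply/subsetP => v; rewrite inE ffunE; apply: contraR => vs.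
  by apply/eqP/as_; rewrite enum_rankK.
rewrite /lin /simplexwise_linear [LHS](reindex (@enum_val V predT)) /=.
  by apply: eq_bigr => i _; rewrite ffunE enum_valK.
exact/onW_bij/enum_val_bij.
Qed.

End Compactness.

(** * From simplicial to singular chains *)

Section Realization.
Variables (R : realType) (V : finType) (k : nat) (p : V -> 'rV[R]_k) (v0 : V).
Implicit Types (s : {set V}) (c : simplicial_chain V).

Lemma F2_cases (a : 'F_2) : a = 0 \/ a = 1.
Proof. by case: a => [[|[|]]] // lt; [left|right]; apply: val_inj. Qed.

Lemma additiveZ2 (A B : lmodType 'F_2) (f : A -> B) : {morph f : x y / x + y} -> f 0 = 0 ->
  forall (a : 'F_2) x, f (a *: x) = a *: f x.
Proof.
move=> fD f0 a x; case: (F2_cases a) => ->; first by rewrite !scale0r.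
by rewrite !scale1r.
Qed.

Lemma fglift_additive (K : choiceType) (M : lmodType 'F_2) (f : K -> M) :
  {morph fglift f : x y / x + y} /\ fglift f 0 = 0.
Proof.
have fB := @lift_is_additive _ _ _ f.
by split=> [x y|]; [rewrite -{1}(oppFF y) fB oppFF|rewrite -{1}(subrr 0) fB subrr].
Qed.

Lemma fglift_sumZ (K : choiceType) (M : lmodType 'F_2) (f : K -> M) (I : Type) (r : seq I)
    (P : pred I) (a : I -> 'F_2) (F : I -> {freeg K / 'F_2}) :
  fglift f (\sum_(i <- r | P i) a i *: F i) = \sum_(i <- r | P i) a i *: fglift f (F i).
Proof.
have [fD f0] := fglift_additive f.
rewrite (big_morph _ fD f0); apply: eq_bigr => i _.
exact: additiveZ2.
Qed.

Lemma fglift_expand (K : choiceType) (M : lmodType 'F_2) (f : K -> M) (w : {freeg K / 'F_2}) :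
  fglift f w = \sum_(x <- dom w) coeff x w *: f x.
Proof.
have [fD f0] := fglift_additive f.
rewrite -{1}(freeg_sumE w) (big_morph _ fD f0).
by apply: eq_bigr => x _; exact: liftU.
Qed.

Lemma fglift1 (K : choiceType) (M : lmodType 'F_2) (f : K -> M) (x : K) :
  fglift f << x >> = f x.
Proof. by rewrite liftU scale1r. Qed.

Definition affine_map n (f : 'I_n.+1 -> V) (t : 'rV[R]_n.+1) : 'rV[R]_k :=
  \sum_i t 0 i *: p (f i).

Lemma affine_map_face n (f : 'I_n.+2 -> V) (i : 'I_n.+2) (t : 'rV[R]_n.+1) :
  affine_map f (face_row i t) = affine_map (fun j => f (lift i j)) t.
Proof.
rewrite /affine_map (bigD1_ord i) //= mxE unlift_none scale0r add0r.
by apply: eq_bigr => j _; rewrite mxE liftK.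
Qed.

Section IntoSet.
Variable S : set 'rV[R]_k.

Definition spans n (f : 'I_n.+1 -> V) : Prop :=
  forall t, std_simplex R n t -> S (affine_map f t).

Definition affine_fun n (f : 'I_n.+1 -> V) (H : spans f) (t : std_simplex R n) : S :=
  SigSub (mem_set (H _ (set_valP t))).

Lemma affine_fun_continuous n (f : 'I_n.+1 -> V) (H : spans f) : continuous (affine_fun H).
Proof.
apply: continuous_comp_initial => t.
apply: (@continuous_comp _ _ _ set_val (affine_map f)).
  exact: initial_continuous.
exact: continuous_combination.
Qed.

Definition affine_simplex n (f : 'I_n.+1 -> V) (H : spans f) : singular_simplex R n S :=
  mkcts (@affine_fun_continuous n f H).

(* Zero when the simplex does not lie in [S], to avoid carrying proofs around. *)
Definition affine_chain n (f : 'I_n.+1 -> V) : chain R n S :=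
  if pselect (spans f) is left H then << affine_simplex H >> else 0.

Lemma affine_chainE n (f : 'I_n.+1 -> V) (H : spans f) :
  affine_chain f = << affine_simplex H >>.
Proof.
rewrite /affine_chain; case: pselect => // H'.
by rewrite (Prop_irrelevance H' H).
Qed.

Lemma spans_face n (f : 'I_n.+2 -> V) (i : 'I_n.+2) :
  spans f -> spans (fun j => f (lift i j)).
Proof. by move=> fS t tS; rewrite -affine_map_face; apply/fS/face_row_std. Qed.

Lemma boundary_affine_chain n (f : 'I_n.+2 -> V) : spans f ->
  singular_boundary (affine_chain f) = \sum_(i < n.+2) affine_chain (fun j => f (lift i j)).
Proof.
move=> fS; rewrite (affine_chainE fS) /singular_boundary fglift1.
apply: eq_bigr => i _; rewrite (affine_chainE (spans_face i fS)).
congr << _ >>; apply/continuousEP => t; apply: val_inj => /=.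
exact: affine_map_face.
Qed.

(** The order of [enum] turns a face into a parametrized simplex; over F_2 no orientation is
    involved. *)
Definition simplex_chain n s : chain R n S :=
  affine_chain (fun i : 'I_n.+1 => nth v0 (enum s) i).

Definition realize n c : chain R n S :=
  \sum_(s : {set V} | #|s| == n.+1) c s *: simplex_chain n s.

End IntoSet.

(** Deleting the i-th vertex preserves the order of the others, so the i-th face of a realized
    simplex is exactly the realization of the smaller face. *)
Lemma nth_enum_setD1 s i j : (i < #|s|)%N ->
  nth v0 (enum (s :\ nth v0 (enum s) i)%SET) j = nth v0 (enum s) (bump i j).
Proof.
move=> si; set x := nth v0 (enum s) i.
have -> : enum (s :\ x)%SET = rem x (enum s).
  rewrite rem_filter ?enum_uniq // /enum_mem -filter_predI.
  by apply: eq_filter => y; rewrite /= !inE.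
have xi : index x (enum s) = i by rewrite index_uniq ?enum_uniq // -cardE.
rewrite remE xi nth_cat size_take -cardE si; case: ltnP => ji.
  by rewrite nth_take // /bump leqNgt ji.
by rewrite nth_drop /bump ji addSn subnKC.
Qed.

Lemma sum_faces (A : nmodType) n s (G : {set V} -> A) : #|s| = n.+1 ->
  \sum_(i < n.+1) G (s :\ nth v0 (enum s) i)%SET = \sum_(x in s) G (s :\ x)%SET.
Proof.
move=> sn; rewrite -[RHS]big_enum /= (big_nth v0) -cardE sn big_mkord.
by [].
Qed.

(** The assumption on spans concerns the top faces only, and excludes the default value of
    [affine_chain]; faces of simplices in S lie in S. *)
Lemma realize_boundary S n c :
  (forall s, c s != 0 -> #|s| = n.+2 -> spans S (fun i : 'I_n.+2 => nth v0 (enum s) i)) ->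
  singular_boundary (realize S n.+1 c) = realize S n (bd c).
Proof.
move=> cS; rewrite /realize /singular_boundary fglift_sumZ.
transitivity (\sum_(s : {set V} | #|s| == n.+2)
    \sum_(x in s) c s *: simplex_chain S n (s :\ x)%SET).
  apply: eq_bigr => s /eqP sn; have [->|cs] := eqVneq (c s) 0.
    by rewrite scale0r big1 // => x _; rewrite scale0r.
  rewrite -scaler_sumr; congr (_ *: _).
  rewrite -/(singular_boundary _) boundary_affine_chain; last exact: cS.
  rewrite -(sum_faces _ sn); apply: eq_bigr => i _; congr affine_chain.
  by apply/funext => j; rewrite nth_enum_setD1 ?sn.
rewrite (exchange_big_dep predT) //=.
transitivity (\sum_x \sum_(t : {set V} | (#|t| == n.+1) && (x \notin t))
    c (x |: t)%SET *: simplex_chain S n t).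
  apply: eq_bigr => x _.
  rewrite (reindex_onto (fun t => x |: t)%SET (fun s => s :\ x)%SET) /=; last first.
    by move=> s /andP[_ xs]; rewrite setD1K.
  apply: eq_big => [t|t /andP[/andP[_ _] /eqP xt]]; last by rewrite xt.
  rewrite setU11 andbT cardsU1; case: (boolP (x \in t)) => xt /=.
    rewrite andbF; apply/negP => /andP[_ /eqP E].
    by move: xt; rewrite -E !inE eqxx.
  by rewrite setU1K // eqxx eqSS !andbT.
rewrite (exchange_big_dep (fun t : {set V} => #|t| == n.+1)) /=; last by move=> x t _ /andP[].
apply: eq_bigr => t tn; rewrite ffunE scaler_suml; apply: eq_bigl => x.
by rewrite tn.
Qed.

Lemma pushforward_realize (A B : set 'rV[R]_k) (AB : (A `<=` B)%classic) n c :
  (forall s, c s != 0 -> #|s| = n.+1 -> spans A (fun i : 'I_n.+1 => nth v0 (enum s) i)) ->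
  Defs.pushforward (sub_incl AB) (realize A n c) = realize B n c.
Proof.
move=> cA; rewrite /realize /Defs.pushforward fglift_sumZ; apply: eq_bigr => s /eqP sn.
have [->|cs] := eqVneq (c s) 0; first by rewrite !scale0r.
congr (_ *: _); have sA := cA s cs sn.
have sB : spans B (fun i : 'I_n.+1 => nth v0 (enum s) i) by move=> t /sA /AB.
rewrite /simplex_chain (affine_chainE sA) (affine_chainE sB) fglift1.
by congr << _ >>; apply/continuousEP => t; exact: val_inj.
Qed.

End Realization.

(** * Subdivided segments and triangles *)

Section Grid.
Variable V : finType.
Implicit Types (x y z : V) (D : {set {set V}}).

(** Setting degenerate edges to zero makes [bd_edge] hold for all x and y. *)
Definition edge x y : simplicial_chain V := if x == y then 0 else cell [set x; y]%SET.

Lemma bd_edge x y : bd (edge x y) = cell [set x]%SET + cell [set y]%SET.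
Proof.
by rewrite /edge; case: eqVneq => [->|xy]; [rewrite linear0 addFF|exact: bd_cell2].
Qed.

Lemma supported_edge D x y : [set x; y]%SET \in D -> supported (edge x y) D.
Proof.
by rewrite /edge; case: eqP => _ xyD; [exact: supported0|exact: supported_cell].
Qed.

Lemma telescopeFF (T : lmodType 'F_2) (h : nat -> T) N :
  \sum_(j < N) (h j + h j.+1) = h 0%N + h N.
Proof.
elim: N => [|N IH]; first by rewrite big_ord0 addFF.
by rewrite big_ord_recr /= IH -addrA (addrA (h N)) addFF add0r.
Qed.

Definition path_chain (G : nat -> V) N : simplicial_chain V :=
  \sum_(j < N) edge (G j) (G j.+1).

(* The interior edges cancel in pairs, and each small square is a cycle in a
   simplex of [D]. *)
Lemma grid_bounds D (G : nat -> nat -> V) N : down_closed D ->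
  (forall i j, (i < N)%N -> (j < N)%N ->
     [set G i j; G i.+1 j; G i j.+1; G i.+1 j.+1]%SET \in D) ->
  bounds D (path_chain (fun i => G i 0%N) N + path_chain (fun i => G i N) N
            + (path_chain (G 0%N) N + path_chain (G N) N)).
Proof.
move=> Dcl GD.
pose h i j := edge (G i j) (G i.+1 j).
pose v i j := edge (G i j) (G i j.+1).
have -> : path_chain (fun i => G i 0%N) N + path_chain (fun i => G i N) N
            + (path_chain (G 0%N) N + path_chain (G N) N) =
    \sum_(i < N) \sum_(j < N) ((h i j + h i j.+1) + (v i j + v i.+1 j)).
  rewrite -!big_split /=; under [RHS]eq_bigr => i _ do rewrite big_split /= telescopeFF.
  rewrite [RHS]big_split /= [X in _ = _ + X]exchange_big /= -!big_split /=.
  by apply: eq_bigr => j _; rewrite (telescopeFF (fun i => v i j)).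
apply: bounds_sum => i _; apply: bounds_sum => j _.
set s := [set G i j; G i.+1 j; G i j.+1; G i.+1 j.+1]%SET.
have sD : s \in D by exact: GD.
have pD : powerset s \subset D by apply/subsetP => t; rewrite inE => /(Dcl _ _ sD).
apply: boundsS pD _; apply: (@acyclic_cone _ _ (G i j)).
- by move=> t; rewrite !inE subUset sub1set !inE eqxx.
- have sup x y : x \in s -> y \in s -> supported (edge x y) (powerset s).
    by move=> xs ys; apply: supported_edge; rewrite inE subUset !sub1set xs ys.
  by apply: supportedD; apply: supportedD; apply: sup; rewrite !inE eqxx ?orbT.
- rewrite !linearD /= !bd_edge.
  set a := cell _; set b := cell _; set c := cell _; set d := cell _.
  by rewrite (addrACA a c) addFF.
Qed.

(** A walk along one edge passes back and forth, and the passages cancel in pairs modulo 2. *)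
Lemma path_chain_edge (G : nat -> V) N x y :
  (forall j, (j <= N)%N -> G j = x \/ G j = y) ->
  path_chain G N = edge (G 0%N) (G N).
Proof.
elim: N => [|N IH] GN; first by rewrite /path_chain big_ord0 /edge eqxx.
rewrite /path_chain big_ord_recr /= -/(path_chain G N) IH; last first.
  by move=> j jN; apply: GN; exact: leqW.
have tri a b c : (a = x \/ a = y) -> (b = x \/ b = y) -> (c = x \/ c = y) ->
    edge a b + edge b c = edge a c.
  have ee z : edge z z = 0 by rewrite /edge eqxx.
  have es z w : edge z w = edge w z by rewrite /edge eq_sym setUC.
  move=> [->|->] [->|->] [->|->]; rewrite ?ee ?addr0 ?add0r //.
    by rewrite (es y) addFF.
  by rewrite (es x) addFF.
by apply: tri; apply: GN.
Qed.

End Grid.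

Section Subdivision.
Variables (R : realType) (V : finType) (k : nat).

Lemma std_simplex_vertex n : std_simplex R n (delta_mx 0 0).
Proof.
split=> [i|]; first by rewrite mxE ler0n.
rewrite (bigD1 0) //= mxE !eqxx big1 ?addr0 // => i /negbTE i0.
by rewrite mxE i0.
Qed.

(* Junk value (the first vertex) when [t] is not in the simplex. *)
Definition to_simplex n (t : 'rV[R]_n.+1) : std_simplex R n :=
  if pselect (std_simplex R n t) is left H then SigSub (mem_set H)
  else SigSub (mem_set (std_simplex_vertex n)).

Lemma to_simplexK n (t : 'rV[R]_n.+1) : std_simplex R n t -> set_val (to_simplex t) = t.
Proof. by rewrite /to_simplex; case: pselect. Qed.

Lemma to_simplexE n (t : std_simplex R n) u : set_val t = u -> to_simplex u = t.
Proof.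
move=> tu; apply: val_inj; rewrite -[LHS]/(set_val (to_simplex u)) to_simplexK -?tu //.
exact: set_valP.
Qed.

Lemma face_rowP n (i : 'I_n.+2) (t : 'rV[R]_n.+1) (u : 'rV[R]_n.+2) :
  u 0 i = 0 -> (forall j, u 0 (lift i j) = t 0 j) -> face_row i t = u.
Proof.
move=> ui uj; apply/rowP => j; rewrite mxE.
by case: unliftP => [l ->|->]; rewrite ?ui ?uj.
Qed.

Definition segment_point N j : 'rV[R]_2 :=
  \row_(i < 2) (if (i : nat) is 0%N then 1 - j%:R / N%:R else j%:R / N%:R).

(** The triangle is a square whose side i = 0 is collapsed to the first vertex, so a square grid
    subdivides it. The sides i = N, j = N and j = 0 are its edges opposite vertices 0, 1 and 2. *)
Definition triangle_point N i j : 'rV[R]_3 :=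
  \row_(l < 3) match (l : nat) with
    | 0%N => 1 - i%:R / N%:R
    | 1%N => i%:R / N%:R * (1 - j%:R / N%:R)
    | _ => i%:R / N%:R * (j%:R / N%:R)
    end.

Lemma ratio_bounds N j : (0 < N)%N -> (j <= N)%N -> 0 <= j%:R / N%:R :> R /\ j%:R / N%:R <= 1 :> R.
Proof.
move=> N0 jN; split; first by rewrite divr_ge0 ?ler0n.
by rewrite ler_pdivrMr ?ltr0n // mul1r ler_nat.
Qed.

Lemma ratio_full N : (0 < N)%N -> N%:R / N%:R = 1 :> R.
Proof. by move=> N0; rewrite divff // pnatr_eq0 -lt0n. Qed.

Lemma segment_point_std N j : (0 < N)%N -> (j <= N)%N -> std_simplex R 1 (segment_point N j).
Proof.
move=> N0 jN; have [j0 j1] := ratio_bounds N0 jN; split.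
  by case=> [[|[|//]] lt]; rewrite mxE //= subr_ge0.
by rewrite !big_ord_recl big_ord0 !mxE /=; ring.
Qed.

Lemma triangle_point_std N i j : (0 < N)%N -> (i <= N)%N -> (j <= N)%N ->
  std_simplex R 2 (triangle_point N i j).
Proof.
move=> N0 iN jN; have [i0 i1] := ratio_bounds N0 iN; have [j0 j1] := ratio_bounds N0 jN; split.
  by case=> [[|[|[|//]]] lt]; rewrite mxE /= ?subr_ge0 // mulr_ge0 // subr_ge0.
by rewrite !big_ord_recl big_ord0 !mxE /=; ring.
Qed.

(** A coordinate is a product of at most two factors in the unit interval, each moving by at most
    1/N. *)
Lemma triangle_point_close N i j i' j' l : (0 < N)%N ->
  (i <= i' <= i.+1)%N -> (j <= j' <= j.+1)%N -> (i' <= N)%N -> (j' <= N)%N ->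
  `|triangle_point N i j 0 l - triangle_point N i' j' 0 l| <= 2 / N%:R.
Proof.
move=> N0 /andP[ii' i'i] /andP[jj' j'j] i'N j'N.
have [i0 i1] := ratio_bounds N0 (leq_trans ii' i'N).
have [i0' i1'] := ratio_bounds N0 i'N.
have [j0 j1] := ratio_bounds N0 (leq_trans jj' j'N).
have [j0' j1'] := ratio_bounds N0 j'N.
have Nr : 0 < N%:R :> R by rewrite ltr0n.
have diff m m' : (m <= m')%N -> (m' <= m.+1)%N ->
    m%:R / N%:R <= m'%:R / N%:R :> R /\ m'%:R / N%:R <= m%:R / N%:R + 1 / N%:R :> R.
  move=> mm' m'm; rewrite -mulrDl !ler_pM2r ?invr_gt0 // ler_nat; split=> //.
  by rewrite -(natrD R m 1) ler_nat addn1.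
have [a1 a2] := diff i i' ii' i'i; have [b1 b2] := diff j j' jj' j'j.
have -> : 2 / N%:R = 1 / N%:R + 1 / N%:R :> R by rewrite -mulrDl.
have e0 : 0 <= 1 / N%:R :> R by rewrite divr_ge0 // ltW.
set a := i%:R / _ in i0 i1 a1 a2 *; set a' := i'%:R / _ in i0' i1' a1 a2 *.
set b := j%:R / _ in j0 j1 b1 b2 *; set b' := j'%:R / _ in j0' j1' b1 b2 *.
set e := 1 / _ in e0 a2 b2 *.
by rewrite ler_norml; case: l => [[|[|[|//]]] lt]; rewrite !mxE /= -/a -/a' -/b -/b';
  apply/andP; split; nra.
Qed.

Lemma segment_point_close N j l : (0 < N)%N -> (j < N)%N ->
  `|segment_point N j 0 l - segment_point N j.+1 0 l| <= 2 / N%:R.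
Proof.
move=> N0 jN; have Nr : 0 < N%:R^-1 :> R by rewrite invr_gt0 ltr0n.
rewrite -natr1 /segment_point ler_norml.
case: l => [[|[|//]] lt]; rewrite !mxE /= ?mulrDl; apply/andP; split; lra.
Qed.

End Subdivision.

(** * Simplicial approximation in degrees 0 and 1 *)

Section Approximation.
Variables (R : realType) (V : finType) (k : nat) (X : set 'rV[R]_k) (g : X -> V).
Variables (D : {set {set V}}) (Dcl : down_closed D).

Definition approx0 (s : singular_simplex R 0 X) : simplicial_chain V :=
  cell [set g (s (to_simplex (const_mx 1)))]%SET.

Definition approx1 N (s : singular_simplex R 1 X) : simplicial_chain V :=
  path_chain (fun j => g (s (to_simplex (segment_point R N j)))) N.

Definition close n (d : R) (t t' : std_simplex R n) : Prop :=
  forall i, `|set_val t 0 i - set_val t' 0 i| < d.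

(** Four points because a grid cell has four corners; closeness to the first of them is enough. *)
Definition adapted n (s : singular_simplex R n X) (d : R) : Prop :=
  forall t0 t1 t2 t3 : std_simplex R n, close d t0 t1 -> close d t0 t2 -> close d t0 t3 ->
    [set g (s t0); g (s t1); g (s t2); g (s t3)]%SET \in D.

Lemma face_map_to_simplex n (i : 'I_n.+2) (t : 'rV[R]_n.+1) u :
  std_simplex R n t -> face_row i t = u -> face_map i (to_simplex t) = to_simplex u.
Proof.
by move=> tS tu; apply/esym/to_simplexE; rewrite -tu -{2}(to_simplexK tS).
Qed.

Lemma close_refl n (d : R) (t : std_simplex R n) : 0 < d -> close d t t.
Proof. by move=> d0 i; rewrite subrr normr0. Qed.

Lemma approx0_boundary N d (s : singular_simplex R 1 X) : (0 < N)%N -> 2 / N%:R < d ->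
  adapted s d -> bounds D (fglift approx0 (singular_boundary << s >>)).
Proof.
move=> N0 Nd sad; have d0 : 0 < d by apply: le_lt_trans Nd; rewrite divr_ge0 ?ler0n.
have [fD _] := fglift_additive approx0.
rewrite /singular_boundary fglift1 !big_ord_recl big_ord0 addr0 fD !fglift1 /approx0 /=.
have c1 : std_simplex R 0 (const_mx 1) by split=> [i|]; rewrite ?big_ord1 mxE ?ler01.
pose G j := g (s (to_simplex (segment_point R N j))).
rewrite (@face_map_to_simplex _ _ _ (segment_point R N N) c1); last first.
  apply: face_rowP => [|j]; rewrite !mxE /=; first by rewrite ratio_full // subrr.
  by rewrite ratio_full.
rewrite (@face_map_to_simplex _ _ _ (segment_point R N 0) c1); last first.
  apply: face_rowP => [|j]; rewrite !mxE /=; first by rewrite mul0r.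
  by rewrite ord1 /= mul0r subr0.
exists (path_chain G N).
  apply: supported_sum => j _; apply: supported_edge.
  have jN := ltn_ord j.
  pose t m : std_simplex R 1 := to_simplex (segment_point R N m).
  have tt : close d (t j) (t j.+1).
    move=> l; rewrite !to_simplexK; try by apply: segment_point_std => //; exact: ltnW.
    by apply: le_lt_trans Nd; exact: segment_point_close.
  apply: Dcl (sad (t j) (t j.+1) (t j.+1) (t j.+1) tt tt tt) _.
  by rewrite subUset !sub1set !inE !eqxx ?orbT.
rewrite linear_sum /= (eq_bigr (fun j : 'I_N => cell [set G j]%SET + cell [set G j.+1]%SET)).
  by rewrite (telescopeFF (fun j => cell [set G j]%SET)) addrC.
by move=> j _; exact: bd_edge.
Qed.

Lemma approx1_boundary N d (s : singular_simplex R 2 X) : (0 < N)%N -> 2 / N%:R < d ->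
  adapted s d -> bounds D (fglift (approx1 N) (singular_boundary << s >>)).
Proof.
move=> N0 Nd sad; have d0 : 0 < d by apply: le_lt_trans Nd; rewrite divr_ge0 ?ler0n.
have [fD _] := fglift_additive (approx1 N).
rewrite /singular_boundary fglift1 !big_ord_recl big_ord0 addr0 !fD !fglift1.
pose G i j := g (s (to_simplex (triangle_point R N i j))).
have face (i : 'I_3) (F : nat -> nat -> V) :
    (forall j, (j <= N)%N -> exists2 u, face_row i (segment_point R N j) = u &
       F j 0%N = g (s (to_simplex u))) ->
    approx1 N (s \o face_map i : singular_simplex R 1 X) = path_chain (fun j => F j 0%N) N.
  move=> FE; have Fg j : (j <= N)%N ->
      g (s (face_map i (to_simplex (segment_point R N j)))) = F j 0%N.
    move=> jN; have [u uE ->] := FE j jN.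
    by rewrite (face_map_to_simplex (segment_point_std _ N0 jN) uE).
  by apply: eq_bigr => j _ /=; rewrite !Fg // ltnW.
rewrite (face _ (fun j _ => G N j)); last first.
  move=> j jN; exists (triangle_point R N N j) => //.
  apply: face_rowP => [|[[|[|//]] lt]]; rewrite !mxE /= ratio_full ?subrr //; ring.
rewrite (face _ (fun j _ => G j N)); last first.
  move=> j jN; exists (triangle_point R N j N) => //.
  by apply: face_rowP => [|[[|[|//]] lt]]; rewrite !mxE /= ?ratio_full //; ring.
rewrite (face _ (fun j _ => G j 0%N)); last first.
  move=> j jN; exists (triangle_point R N j 0) => //.
  by apply: face_rowP => [|[[|[|//]] lt]]; rewrite !mxE /= ?mul0r //; ring.
(* The three edges of the triangle are three sides of the square, and the collapsed fourth side
   contributes zero, so [grid_bounds] applies. *)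
have -> : path_chain (fun j => G N j) N + (path_chain (fun j => G j N) N
      + path_chain (fun j => G j 0%N) N) =
    path_chain (fun i => G i 0%N) N + path_chain (fun i => G i N) N
      + (path_chain (G 0%N) N + path_chain (G N) N).
  have -> : path_chain (G 0%N) N = 0.
    rewrite /path_chain big1 // => j _; rewrite /edge (_ : G 0%N j.+1 = G 0%N j) ?eqxx //.
    rewrite /G (_ : triangle_point R N 0 j.+1 = triangle_point R N 0 j) //.
    by apply/rowP => -[[|[|[|//]]] lt]; rewrite !mxE /= ?mul0r.
  by rewrite add0r addrC; congr (_ + _); exact: addrC.
apply: grid_bounds => // i j iN jN.
pose t a b : std_simplex R 2 := to_simplex (triangle_point R N a b).
have tt a b : (i <= a <= i.+1)%N -> (j <= b <= j.+1)%N -> close d (t i j) (t a b).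
  move=> ia jb l; have aN : (a <= N)%N by case/andP: ia => _ /leq_trans; exact.
  have bN : (b <= N)%N by case/andP: jb => _ /leq_trans; exact.
  rewrite !to_simplexK; try by apply: triangle_point_std => //; exact: ltnW.
  by apply: le_lt_trans Nd; exact: triangle_point_close.
by apply: (sad (t i j) (t i.+1 j) (t i j.+1) (t i.+1 j.+1)); apply: tt; rewrite ?leqnn ?leqnSn.
Qed.

End Approximation.

(** * Tightness *)

Section Tight.
Variables (R : realType) (V : finType) (k : nat) (C : {set {set V}}) (p : V -> 'rV[R]_k).
Variable l : 'rV[R]_k.
Hypotheses (Ccl : down_closed C) (emb : linear_embedding C p).
Let h u := dot l (p u).

Lemma dot_sum (I : finType) (x : I -> R) (q : I -> 'rV[R]_k) :
  dot l (\sum_i x i *: q i) = \sum_i x i * dot l (q i).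
Proof.
rewrite /dot; under [RHS]eq_bigr => i _ do rewrite mulr_sumr.
rewrite exchange_big /=; apply: eq_bigr => j _; rewrite summxE mulr_sumr.
by apply: eq_bigr => i _; rewrite mxE mulrCA.
Qed.

Lemma affine_map_polyhedron (D : {set {set V}}) n (f : 'I_n.+1 -> V) t (s : {set V}) :
  down_closed D -> s \in D -> std_simplex R n t -> (forall i, t 0 i != 0 -> f i \in s) ->
  polyhedron D p (affine_map p f t).
Proof.
move=> Dcl sD [t0 t1] fs.
(* As f may repeat a vertex, the weights over each fibre are added. *)
exists [ffun v => \sum_(i | f i == v) t 0 i].
  split => [v||].
  - by rewrite ffunE sumr_ge0.
  - rewrite -t1 (eq_bigr (fun v => \sum_(i | f i == v) t 0 i)) => [|v _]; last by rewrite ffunE.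
    by rewrite [RHS](partition_big f predT).
  - apply: Dcl sD _; apply/subsetP => v; rewrite inE ffunE => vt.
    apply: contraNT vt => vs; rewrite big1 // => i /eqP fi.
    by apply/eqP; apply: contraNT vs => /fs; rewrite fi.
rewrite /simplexwise_linear /affine_map [RHS](partition_big f predT) //=.
apply: eq_bigr => v _; rewrite ffunE scaler_suml.
by apply: eq_bigr => i /eqP <-.
Qed.

(** By injectivity of the embedding, a point lies outside the polyhedron of the deletion exactly
    when v belongs to its carrier. This makes membership in the carrier an open condition in the
    ambient space. *)
Lemma polyhedron_del (v : V) (a : {ffun V -> R}) : barycentric R C a ->
  polyhedron (deletion C v) p (simplexwise_linear p a) <-> a v = 0.
Proof.
move=> aC; split=> [[b [b0 b1 bC] ba]|av].
  have bE : b = a.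
    apply: emb => //; last exact/mem_set.
    by apply: mem_set; split => //; exact: (subsetP (del_sub C v) _ bC).
  by case/setIdP: bC => _; rewrite bE inE negbK => /eqP.
case: aC => a0 a1 aC; exists a => //; split => //.
by apply/setIdP; split=> //; rewrite inE av eqxx.
Qed.

Variable a : R.
Let X : set 'rV[R]_k := (open_halfspace l a `&` polyhedron C p)%classic.
Let D := above h C a.

Let Dcl : down_closed D.
Proof.
move=> s t /aboveP[sC sa] ts; apply/aboveP; split; first exact: Ccl ts.
by move=> u /(subsetP ts) /sa.
Qed.

Let DC : D \subset C.
Proof. by apply/subsetP => s /aboveP[]. Qed.

(** The height of x is a convex combination of the heights of the vertices of its carrier, which
    cannot all be at most a. *)
Lemma halfspace_vertex (x : X) :
  exists2 v, a < h v & ~ polyhedron (deletion C v) p (set_val x).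
Proof.
have [ax [b bC bx]] := set_valP x.
apply: contrapT => none; move: ax; rewrite -bx /open_halfspace /= dot_sum.
apply/negP; rewrite -leNgt; have [b0 b1 _] := bC.
rewrite -[leRHS]mul1r -b1 mulr_suml; apply: ler_sum => v _.
have [->|bv] := eqVneq (b v) 0; first by rewrite !mul0r.
apply: ler_wpM2l => //; rewrite leNgt; apply/negP => av; apply: none; exists v => //.
rewrite -[set_val x]/(\val x) -bx => /(polyhedron_del v bC) /eqP.
exact/negP.
Qed.

Lemma spans_above (s : {set V}) n (f : 'I_n.+1 -> V) : s \in D -> (forall i, f i \in s) ->
  spans p X f.
Proof.
move=> sD fs t tS; have [t0 t1] := tS; have /aboveP[sC sa] := sD; split; last first.
  exact: (affine_map_polyhedron Ccl sC tS).
rewrite /open_halfspace /= /affine_map dot_sum -[ltLHS]mul1r -t1 mulr_suml.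
have [i ti] : exists i, t 0 i != 0.
  apply: contrapT => none; have := oner_neq0 R; rewrite -t1 big1 ?eqxx // => i _.
  by apply/eqP; apply: contraT => ti; case: none; exists i.
rewrite (bigD1 i) //= [ltRHS](bigD1 i) //=; apply: ltr_leD.
  have ti0 : 0 < t 0 i by rewrite lt_neqAle eq_sym ti t0.
  by rewrite ltr_pM2l //; exact: sa.
by apply: ler_sum => j _; apply: ler_wpM2l => //; apply/ltW/sa.
Qed.

Lemma spans_complex (s : {set V}) n (f : 'I_n.+1 -> V) : s \in C -> (forall i, f i \in s) ->
  spans p (polyhedron C p) f.
Proof. by move=> sC fs t tS; exact: (affine_map_polyhedron Ccl sC tS). Qed.

Definition vertex_choice (g : X -> V) : Prop := forall x : X,
  a < h (g x) /\ ~ polyhedron (deletion C (g x)) p (set_val x).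

Lemma vertex_choice_carrier g (x : X) n (f : 'I_n.+1 -> V) t s : vertex_choice g ->
  s \in C -> std_simplex R n t -> (forall i, t 0 i != 0 -> f i \in s) ->
  set_val x = affine_map p f t -> g x \in s.
Proof.
move=> gP sC tS fs xE; apply: contraT => gs; have [_ []] := gP x.
rewrite xE; apply: (affine_map_polyhedron _ _ tS fs); last by rewrite inE sC.
exact: down_closed_del.
Qed.

Lemma uniform_positive (T : eqType) (r : seq T) (P : T -> R -> Prop) :
  (forall x d e, 0 < e -> e <= d -> P x d -> P x e) ->
  (forall x, x \in r -> exists2 d : R, 0 < d & P x d) ->
  exists2 d : R, 0 < d & forall x, x \in r -> P x d.
Proof.
move=> Pdown; elim: r => [|x r IH] Pr; first by exists 1.
have [|d d0 dP] := IH; first by move=> y yr; apply: Pr; rewrite inE yr orbT.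
have [e e0 eP] := Pr x (mem_head _ _).
have m0 : 0 < Num.min d e by rewrite lt_min d0.
exists (Num.min d e) => // y; rewrite inE => /orP[/eqP->|yr].
  by apply: Pdown eP; rewrite // ge_min lexx orbT.
by apply: Pdown (dP y yr); rewrite // ge_min lexx.
Qed.

(** The open stars of the vertices above the level cover the simplices of w. A Lebesgue number e of
    this cover controls the choice of g, and uniform continuity converts e into a fineness d of the
    parameter simplex. *)
Lemma exists_adapted n (w : chain R n X) :
  exists (g : X -> V) (d : R), [/\ 0 < d, vertex_choice g &
    forall s, s \in dom w -> adapted g D s d].
Proof.
have [e e0 eP] : exists2 e : R, 0 < e & forall s : singular_simplex R n X, s \in dom w ->
    forall t, exists2 v, a < h v & forall y, ball (set_val (s t)) e y ->
      ~ polyhedron (deletion C v) p y.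
  apply: uniform_positive.
    move=> s d e e0 ed sd t; have [v av vd] := sd t; exists v => // y ey; apply: vd.
    exact: le_ball ey.
  move=> s _; apply: compact_lebesgue.
  - exact/compact_subtype/compact_std_simplex.
  - exact: singular_continuous.
  - by move=> v; apply: polyhedron_closed; exact: down_closed_del.
  - by move=> t; exact: halfspace_vertex.
(* A single g on all of X treats simplices with a common face alike. The last clause is conditional
   since a star containing the whole e-ball is guaranteed only at points of the simplices of w. *)
pose good (x : X) v := [/\ a < h v, ~ polyhedron (deletion C v) p (set_val x) &
  (exists2 v', a < h v' & forall y, ball (set_val x) e y -> ~ polyhedron (deletion C v') p y) ->
  forall y, ball (set_val x) e y -> ~ polyhedron (deletion C v) p y].
have [g gP] : {g : X -> V & forall x, good x (g x)}.
  apply: (@choice _ _ good) => x.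
  have [[v av vx]|none] := pselect (exists2 v', a < h v' &
      forall y, ball (set_val x) e y -> ~ polyhedron (deletion C v') p y).
    by exists v; split => //; apply: vx; exact: ballxx.
  by have [v av vx] := halfspace_vertex x; exists v; split.
have [d d0 dP] : exists2 d : R, 0 < d & forall s : singular_simplex R n X, s \in dom w ->
    forall t t' : std_simplex R n, close d t t' -> ball (set_val (s t)) e (set_val (s t')).
  apply: uniform_positive => [s d d' d'0 d'd sd t t' tt'|s _]; last exact: singular_uniform.
  by apply: sd => i; exact: lt_le_trans (tt' i) d'd.
exists g, d; split => // [x|s sw t0 t1 t2 t3 c1 c2 c3]; first by have [] := gP x.
have [_ [b bC bx]] := set_valP (s t0).
(* The point s t0 lies in the e-ball around s t, hence in the open star of g (s t). So all the
   chosen vertices belong to the one face carrying s t0. *)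
have inb t : close d t0 t -> a < h (g (s t)) /\ b (g (s t)) != 0.
  move=> ct; have [ag _ gball] := gP (s t); split=> //.
  apply/negP => /eqP /(polyhedron_del _ bC); rewrite bx; apply: gball.
    exact: eP.
  by apply: ball_sym; exact: dP.
apply/aboveP; have [_ _ bsC] := bC; split.
  apply: Ccl bsC _; rewrite !subUset !sub1set !inE.
  have [_ ->] := inb t0 (close_refl _ d0); have [_ ->] := inb t1 c1.
  by have [_ ->] := inb t2 c2; have [_ ->] := inb t3 c3.
move=> u; rewrite !inE -!orbA => /or4P[]/eqP->.
- by have [] := inb t0 (close_refl _ d0).
- by have [] := inb t1 c1.
- by have [] := inb t2 c2.
- by have [] := inb t3 c3.
Qed.

Lemma bounds_approx n (S : singular_simplex R n X -> simplicial_chain V) (w : chain R n.+1 X) :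
  (forall s, s \in dom w -> bounds D (fglift S (singular_boundary << s >>))) ->
  bounds D (fglift S (singular_boundary w)).
Proof.
move=> Sw; rewrite [singular_boundary w]fglift_expand fglift_sumZ big_seq.
apply: bounds_sum => s /Sw; rewrite /singular_boundary fglift1 => -[u uD bu].
exists (coeff s w *: u); last by rewrite linearZ /= bu.
by move=> q qD; rewrite ffunE uD // scaler0.
Qed.

Variable v0 : V.

Lemma homog_cells j (z : simplicial_chain V) : homog j z = z ->
  z = \sum_(s : {set V} | #|s| == j) z s *: cell s.
Proof.
move=> zj; rewrite {1}(chain_cells z) (bigID (fun s : {set V} => #|s| == j)) /=.
rewrite [X in _ + X]big1 ?addr0 // => s sj.
by rewrite -zj ffunE (negbTE sj) scale0r.
Qed.

Lemma mem_nth_enum (s : {set V}) n (i : 'I_n) : #|s| = n -> nth v0 (enum s) i \in s.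
Proof. by move=> sn; rewrite -mem_enum mem_nth // -cardE sn. Qed.

(** The carrier of a vertex is that vertex, so g has no other choice. *)
Lemma approx0_realize g z : vertex_choice g -> supported z D -> homog 1 z = z ->
  fglift (approx0 g) (realize p v0 X 0 z) = z.
Proof.
move=> gP zD zj; rewrite /realize fglift_sumZ [RHS](homog_cells zj).
apply: eq_bigr => s /eqP s1; have [->|zs] := eqVneq (z s) 0; first by rewrite !scale0r.
have sD := supported_mem zD zs; have sC := subsetP DC s sD.
have sp : spans p X (fun i : 'I_1 => nth v0 (enum s) i).
  by apply: spans_above sD _ => i; exact: mem_nth_enum.
congr (_ *: _); rewrite /simplex_chain (affine_chainE sp) fglift1 /approx0; congr cell.
have c1 : std_simplex R 0 (const_mx 1) by split=> [i|]; rewrite ?big_ord1 mxE ?ler01.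
apply/eqP; rewrite eqEcard sub1set cards1 s1 leqnn andbT.
apply: (@vertex_choice_carrier g _ 0 (fun i : 'I_1 => nth v0 (enum s) i) (const_mx 1)) => //.
  by move=> i _; exact: mem_nth_enum.
by rewrite -[in RHS](to_simplexK c1).
Qed.

(** The subdivision points of an edge are sent to its two ends, and each end to itself, so the
    resulting walk collapses to the edge by [path_chain_edge]. *)
Lemma approx1_realize g N z : (0 < N)%N -> vertex_choice g -> supported z D ->
  homog 2 z = z -> fglift (approx1 g N) (realize p v0 X 1 z) = z.
Proof.
move=> N0 gP zD zj; rewrite /realize fglift_sumZ [RHS](homog_cells zj).
apply: eq_bigr => s /eqP s2; have [->|zs] := eqVneq (z s) 0; first by rewrite !scale0r.
have sD := supported_mem zD zs; have sC := subsetP DC s sD.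
pose f (i : 'I_2) := nth v0 (enum s) i.
have fs i : f i \in s by exact: mem_nth_enum.
have sp : spans p X f by apply: spans_above sD _.
congr (_ *: _); rewrite /simplex_chain (affine_chainE sp) fglift1 /approx1.
pose x j := affine_simplex sp (to_simplex (segment_point R N j)).
have xE j : (j <= N)%N -> set_val (x j) = affine_map p f (segment_point R N j).
  by move=> jN; rewrite -[in RHS](to_simplexK (segment_point_std _ N0 jN)).
have sE : s = [set f ord0; f ord_max]%SET.
  apply/esym/eqP; rewrite eqEcard subUset !sub1set !fs s2 cards2.
  by rewrite /f nth_uniq ?enum_uniq // -cardE s2.
have f01 : f ord0 != f ord_max by rewrite /f nth_uniq ?enum_uniq // -cardE s2.
have gs j : (j <= N)%N -> g (x j) \in s.
  move=> jN; apply: (vertex_choice_carrier gP sC (segment_point_std _ N0 jN) _ (xE j jN)).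
  by move=> i _; exact: fs.
have gend j i : (j <= N)%N -> (forall i', segment_point R N j 0 i' != 0 -> i' = i) -> g (x j) = f i.
  move=> jN ji; apply/set1P.
  apply: (vertex_choice_carrier gP _ (segment_point_std _ N0 jN) _ (xE j jN)).
    by apply: Ccl sC _; rewrite sub1set fs.
  by move=> i' /ji ->; rewrite inE.
rewrite (@path_chain_edge _ (fun j => g (x j)) N (f ord0) (f ord_max)); last first.
  by move=> j jN; have := gs j jN; rewrite sE !inE => /orP[]/eqP; [left|right].
rewrite (gend 0%N ord0) //; last first.
  move=> [[|[|//]] lt]; rewrite mxE /=; first by move=> _; exact: val_inj.
  by rewrite mul0r eqxx.
rewrite (gend N ord_max) //; last first.
  move=> [[|[|//]] lt]; rewrite mxE /=; last by move=> _; exact: val_inj.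
  by rewrite ratio_full // subrr eqxx.
by rewrite /edge (negbTE f01) sE.
Qed.

Lemma exists_fine (d : R) : 0 < d -> exists2 N, (0 < N)%N & 2 / N%:R < d.
Proof.
move=> d0; exists (Num.truncn (2 / d)).+1 => //.
rewrite ltr_pdivrMr ?ltr0n // mulrC -ltr_pdivrMr //.
exact: truncnS_gt.
Qed.

Lemma realize0 (S : set 'rV[R]_k) n : realize p v0 S n 0 = 0.
Proof. by rewrite /realize big1 // => s _; rewrite ffunE scale0r. Qed.

Lemma pushforward0 (S T : topologicalType) n (f : continuousType S T) :
  Defs.pushforward (R := R) f (0 : chain R n S) = 0.
Proof. exact: (proj2 (fglift_additive _)). Qed.

Lemma singular_boundary0 n (S : topologicalType) : singular_boundary (0 : chain R n.+1 S) = 0.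
Proof. exact: (proj2 (fglift_additive _)). Qed.

Lemma tight_filling n z : tight l (polyhedron C p) -> (n < 2)%N -> supported z D ->
  homog n.+1 z = z -> bounds C z -> exists w : chain R n.+1 X,
  singular_boundary w = realize p v0 X n z.
Proof.
move=> tgt n2 zD zj [u uC bu].
have spX m (c : simplicial_chain V) : supported c D ->
    forall s, c s != 0 -> #|s| = m.+1 -> spans p X (fun i : 'I_m.+1 => nth v0 (enum s) i).
  move=> cD s /(supported_mem cD) sD sm; apply: (spans_above sD) => i.
  exact: mem_nth_enum.
have spY m (c : simplicial_chain V) : supported c C ->
    forall s, c s != 0 -> #|s| = m.+1 ->
    spans p (polyhedron C p) (fun i : 'I_m.+1 => nth v0 (enum s) i).
  move=> cC s /(supported_mem cC) sC sm; apply: (spans_complex sC) => i.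
  exact: mem_nth_enum.
(* Injectivity is applied to the realized cycle and the zero cycle, which become homologous in the
   polyhedron through the realization of u. *)
have [|||w wE] := tgt a n (realize p v0 X n z) 0.
- case: n n2 zj => [//|[|//]] _ zj /=; rewrite realize_boundary; last exact: spX.
  by rewrite -bu bdbd realize0.
- by case: n {n2 zj} => [//|n]; exact: singular_boundary0.
- exists (realize p v0 (polyhedron C p) n.+1 u).
  rewrite realize_boundary; last exact: spY.
  by rewrite bu pushforward0 subr0 pushforward_realize //; exact: spX.
by exists w; rewrite wE subr0.
Qed.

End Tight.

(** Approximating the realization of z returns z itself, while approximating a singular boundary
    above the level gives a simplicial boundary above the level. *)
Lemma tight_height_tight (R : realType) (V : finType) k (C : {set {set V}})
    (p : V -> 'rV[R]_k) (l : 'rV[R]_k) : down_closed C -> linear_embedding C p ->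
  tight l (polyhedron C p) -> height_tight (fun u => dot l (p u)) C.
Proof.
move=> Ccl emb tgt a j z j2 zD zj zC.
have [->|z0] := eqVneq z 0; first exact: bounds0.
(* A default value for [nth], taken from a face of z, which is nonempty because j is positive. *)
have [v0 _] : exists v0 : V, true.
  apply: contrapT => noV; case/eqP: z0; apply/ffunP => s; rewrite -zj !ffunE.
  case: ifP => // /eqP sj; case/andP: j2; rewrite -sj card_gt0 => /set0Pn[v _].
  by case: noV; exists v.
case: j j2 zj => [//|n] /= n2 zj.
have [w wE] := tight_filling Ccl v0 tgt n2 zD zj zC.
have [g [d [d0 gP gw]]] := exists_adapted Ccl emb w.
have [N N0 Nd] := exists_fine d0.
have Dcl : down_closed (above (fun u => dot l (p u)) C a).
  move=> s t /aboveP[sC sa] ts; apply/aboveP; split; first exact: Ccl ts.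
  by move=> u /(subsetP ts) /sa.
case: n n2 zj w wE gw => [|[|//]] _ zj w wE gw.
  rewrite -(approx0_realize Ccl v0 gP zD zj) -wE; apply: bounds_approx => s sw.
  by apply: (approx0_boundary Dcl N0 Nd); exact: gw.
rewrite -(approx1_realize Ccl v0 N0 gP zD zj) -wE; apply: bounds_approx => s sw.
by apply: (approx1_boundary Dcl N0 Nd); exact: gw.
Qed.

Theorem theorem2p6 (R : realType) (V : finType) (C : {set {set V}})
    (hC : simplicial_complex C) (pi : 'rV[R]_3) (hpi : pi != 0)
    (hemb : exists p : V -> 'rV[R]_3,
       [/\ linear_embedding C p,
           tight pi (polyhedron C p)
         & general_position pi C p]) :
  (exists f : {set V} -> int, discrete_morse C f /\ perfect C f) /\
  (trivial_reduced_homology C -> non_evasive C).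
Proof.
have [C0 Ccl] := hC; have [p [emb tgt gen]] := hemb.
have hpl := embedding_links_planar hpi Ccl emb.
have hti := tight_height_tight Ccl emb tgt.
split; first exact: buildable_perfect (height_buildable Ccl gen hpl hti).
move=> triv; apply: (height_non_evasive Ccl C0 gen hpl hti).
exact: trivial_homology_acyclic.
Qed.
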